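(* If $D$ is a $0'$-computable model of $T_{\mathrm{both}}$, then the reduct $D\upharpoonright S$ of $D$ to the language containing only the ternary predicate $S$ admits a computable copy.
   Context: $\mathsf{ZF}-\mathsf{inf}+\mathsf{TC}$ is the first-order theory in the language $\{\in\}$ consisting of the usual axioms of Zermelo–Fraenkel set theory with the axiom of infinity removed, together with the axiom of transitive closure: every set is contained in a transitive set (equivalently, modulo the other axioms, every set belongs to some level $V_\alpha$ of the von Neumann hierarchy). $T_{\mathrm{both}}$ is the set of all sentences in the signature $\{\in,S\}$ provable from $\mathsf{ZF}-\mathsf{inf}+\mathsf{TC}$ plus the following definition of the ternary predicate $S$. A copy of a structure is a structure isomorphic to it; an $X$-computable structure over a finite relational signature is one with $X$-computable domain (a subset of $\mathbb{N}$) and $X$-computable atomic diagram. **Definition of $S$ (inside $\mathsf{ZF}-\mathsf{inf}+\mathsf{TC}$).** Let $q=10$; ordinal multiplication $q\alpha$ is taken to be continuous in $\alpha$, i.e. $q\sup\alpha_i=\sup(q\alpha_i)$. Pairs are Kuratowski pairs. For an ordinal $\alpha$, a set $A\subseteq V_{q\alpha}$ and a set $SA\subseteq(A\cup\{q\alpha\})^3$, let $w(\alpha,A,SA)=(q\alpha,(A,SA))$; this lies in $V_{q(\alpha+1)}\setminus V_{q\alpha}$. Define by transfinite recursion ternary relations $S_\alpha$ on $V_{q\alpha}$, each extending the previous ones. $S_0$ is the relation on $V_0=\emptyset$, and at limit stages $S_\lambda=\bigcup_{\alpha<\lambda}S_\alpha$. For the successor step: a pair $(A,SA)$ with $A\subseteq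 V_{q\alpha}$ is good for $\alpha$ if $SA\subseteq(A\cup\{q\alpha\})^3$, $SA\cap A^3=\{(a,b,c)\in A^3: S_\alpha(a,b,c)\}$, and for every $a,b\in A$ with $a\in b$ we have $(a,b,q\alpha)\in SA$. Given $(a,b,c)\in V_{q(\alpha+1)}^3$: - if $a,b,c\in V_{q\alpha}$, set $S_{\alpha+1}(a,b,c)\equiv S_\alpha(a,b,c)$; - if for some pair $(A,SA)$ good for $\alpha$, each of $a,b,c$ is either in $A$ or equal to $w=w(\alpha,A,SA)$, then $S_{\alpha+1}(a,b,c)$ holds if and only if the triple obtained from $(a,b,c)$ by replacing every occurrence of $w$ by $q\alpha$ belongs to $SA$; - for every other triple, $S_{\alpha+1}(a,b,c)$ holds. Finally $S(a,b,c)$ holds iff $S_\alpha(a,b,c)$ holds for some (equivalently, every) $\alpha$ with $a,b,c\in V_{q\alpha}$. *)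

(* Defs.v *)
From Stdlib Require Import List Arith Cantor.

Set Implicit Arguments.

(** * Relative computability *)

Definition pr (a b : nat) : nat := Cantor.to_nat (a, b).

(* Programs for partial recursive functions of one variable with an oracle;
   functions of several variables are handled through the pairing [pr]. *)
Inductive code : Type :=
  | CZero | CSucc | CLeft | CRight | COracle
  | CPair (f g : code)
  | CComp (f g : code)
  | CPrec (f g : code)
  | CMu (f : code).

(* [prec_graph F G a k r]: r is the value at (a, k) of the function h with
   h(a, 0) = F(a) and h(a, k + 1) = G(a, k, h(a, k)). *)
Fixpoint prec_graph (F G : nat -> nat -> Prop) (a k r : nat) : Prop :=
  match k with
  | 0 => F a r
  | S k' => exists i, prec_graph F G a k' i /\ G (pr a (pr k' i)) r
  end.

(* [eval X c n r]: the program c with oracle X halts on input n with value r. *)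
Fixpoint eval (X : nat -> Prop) (c : code) (n r : nat) : Prop :=
  match c with
  | CZero => r = 0
  | CSucc => r = S n
  | CLeft => r = fst (Cantor.of_nat n)
  | CRight => r = snd (Cantor.of_nat n)
  | COracle => (X n /\ r = 1) \/ (~ X n /\ r = 0)
  | CPair f g => exists a b, eval X f n a /\ eval X g n b /\ r = pr a b
  | CComp f g => exists m, eval X g n m /\ eval X f m r
  | CPrec f g => exists a k, n = pr a k /\ prec_graph (eval X f) (eval X g) a k r
  | CMu f => eval X f (pr n r) 0
             /\ forall k, k < r -> exists v, eval X f (pr n k) (S v)
  end.

Fixpoint encode (c : code) : nat :=
  match c with
  | CZero => pr 0 0
  | CSucc => pr 1 0
  | CLeft => pr 2 0
  | CRight => pr 3 0
  | COracle => pr 4 0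
  | CPair f g => pr 5 (pr (encode f) (encode g))
  | CComp f g => pr 6 (pr (encode f) (encode g))
  | CPrec f g => pr 7 (pr (encode f) (encode g))
  | CMu f => pr 8 (encode f)
  end.

Definition computable_in (X P : nat -> Prop) : Prop :=
  exists c, forall n, (P n -> eval X c n 1) /\ (~ P n -> eval X c n 0).

(* Numbers that are not of the form [encode c] index the nowhere defined
   function. *)
Definition jump (X : nat -> Prop) (e : nat) : Prop :=
  exists c, encode c = e /\ exists v, eval X c e v.

Definition empty_oracle : nat -> Prop := fun _ => False.
Definition zero' : nat -> Prop := jump empty_oracle.

(** * Structures with domain a set of natural numbers *)

(* The values of the relations outside the domain are irrelevant: they are
   used neither in satisfaction, nor in diagrams, nor in isomorphisms. *)
Record both_structure : Type := BothStructure {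
  bdom : nat -> Prop;
  bmem : nat -> nat -> Prop;
  bS : nat -> nat -> nat -> Prop;
  bdom_inhabited : exists a, bdom a }.

Record S_structure : Type := SStructure {
  sdom : nat -> Prop;
  sS : nat -> nat -> nat -> Prop;
  sdom_inhabited : exists a, sdom a }.

Definition reduct_S (D : both_structure) : S_structure :=
  SStructure (bdom D) (bS D) (bdom_inhabited D).

(* The true atomic sentences with constants from the domain; a sentence is
   coded by a tag for its predicate (0 for =, 1 for S, 2 for membership)
   paired with its arguments. *)
Definition S_diagram (C : S_structure) (n : nat) : Prop :=
  (exists a, sdom C a /\ n = pr 0 (pr a a))
  \/ (exists a b c, sdom C a /\ sdom C b /\ sdom C c /\ sS C a b c
        /\ n = pr 1 (pr a (pr b c))).

Definition both_diagram (D : both_structure) (n : nat) : Prop :=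
  S_diagram (reduct_S D) n
  \/ (exists a b, bdom D a /\ bdom D b /\ bmem D a b /\ n = pr 2 (pr a b)).

Definition computable_both_structure (X : nat -> Prop) (D : both_structure) :=
  computable_in X (bdom D) /\ computable_in X (both_diagram D).

Definition computable_S_structure (X : nat -> Prop) (C : S_structure) :=
  computable_in X (sdom C) /\ computable_in X (S_diagram C).

Definition isomorphic (C C' : S_structure) : Prop :=
  exists f : nat -> nat,
    (forall a, sdom C a -> sdom C' (f a))
    /\ (forall a b, sdom C a -> sdom C b -> f a = f b -> a = b)
    /\ (forall b, sdom C' b -> exists a, sdom C a /\ f a = b)
    /\ (forall a b c, sdom C a -> sdom C b -> sdom C c ->
          (sS C a b c <-> sS C' (f a) (f b) (f c))).

(** * First-order logic in the signature {membership, S} *)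

(* Variables are de Bruijn indices; there are no other terms. *)
Inductive form : Type :=
  | Bot
  | Eq (i j : nat)
  | Mem (i j : nat)
  | SP (i j k : nat)
  | Imp (p q : form)
  | And (p q : form)
  | Or (p q : form)
  | All (p : form)
  | Ex (p : form).

Definition scons (A : Type) (x : A) (r : nat -> A) (i : nat) : A :=
  match i with 0 => x | S i' => r i' end.

Fixpoint ren (r : nat -> nat) (p : form) : form :=
  match p with
  | Bot => Bot
  | Eq i j => Eq (r i) (r j)
  | Mem i j => Mem (r i) (r j)
  | SP i j k => SP (r i) (r j) (r k)
  | Imp p q => Imp (ren r p) (ren r q)
  | And p q => And (ren r p) (ren r q)
  | Or p q => Or (ren r p) (ren r q)
  | All p => All (ren (scons 0 (fun i => S (r i))) p)
  | Ex p => Ex (ren (scons 0 (fun i => S (r i))) p)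
  end.

Definition shift : form -> form := ren S.
Definition subst0 (t : nat) : form -> form := ren (scons t (fun i => i)).

(* All free variables of the formula are below n. *)
Fixpoint bounded (n : nat) (p : form) : Prop :=
  match p with
  | Bot => True
  | Eq i j | Mem i j => i < n /\ j < n
  | SP i j k => i < n /\ j < n /\ k < n
  | Imp p q | And p q | Or p q => bounded n p /\ bounded n q
  | All p | Ex p => bounded (S n) p
  end.

Definition sentence (p : form) : Prop := bounded 0 p.

Fixpoint S_free (p : form) : Prop :=
  match p with
  | Bot | Eq _ _ | Mem _ _ => True
  | SP _ _ _ => False
  | Imp p q | And p q | Or p q => S_free p /\ S_free q
  | All p | Ex p => S_free p
  end.

(* Classical natural deduction with equality. The axioms in T are meant to be
   sentences, so they need no shifting under quantifiers. *)
Inductive prv (T : form -> Prop) : list form -> form -> Prop :=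
  | prv_ax G p : T p -> prv T G p
  | prv_hyp G p : In p G -> prv T G p
  | prv_raa G p : prv T (Imp p Bot :: G) Bot -> prv T G p
  | prv_impI G p q : prv T (p :: G) q -> prv T G (Imp p q)
  | prv_impE G p q : prv T G (Imp p q) -> prv T G p -> prv T G q
  | prv_andI G p q : prv T G p -> prv T G q -> prv T G (And p q)
  | prv_andE1 G p q : prv T G (And p q) -> prv T G p
  | prv_andE2 G p q : prv T G (And p q) -> prv T G q
  | prv_orI1 G p q : prv T G p -> prv T G (Or p q)
  | prv_orI2 G p q : prv T G q -> prv T G (Or p q)
  | prv_orE G p q r :
      prv T G (Or p q) -> prv T (p :: G) r -> prv T (q :: G) r -> prv T G r
  | prv_allI G p : prv T (map shift G) p -> prv T G (All p)
  | prv_allE G p t : prv T G (All p) -> prv T G (subst0 t p)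
  | prv_exI G p t : prv T G (subst0 t p) -> prv T G (Ex p)
  | prv_exE G p q :
      prv T G (Ex p) -> prv T (p :: map shift G) (shift q) -> prv T G q
  | prv_eqI G i : prv T G (Eq i i)
  | prv_eqE G p i j :
      prv T G (Eq i j) -> prv T G (subst0 i p) -> prv T G (subst0 j p).

Fixpoint sat (D : both_structure) (r : nat -> nat) (p : form) : Prop :=
  match p with
  | Bot => False
  | Eq i j => r i = r j
  | Mem i j => bmem D (r i) (r j)
  | SP i j k => bS D (r i) (r j) (r k)
  | Imp p q => sat D r p -> sat D r q
  | And p q => sat D r p /\ sat D r q
  | Or p q => sat D r p \/ sat D r q
  | All p => forall a, bdom D a -> sat D (scons a r) p
  | Ex p => exists a, bdom D a /\ sat D (scons a r) p
  end.

Definition model (D : both_structure) (T : form -> Prop) : Prop :=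
  forall p, T p -> forall r, (forall i, bdom D (r i)) -> sat D r p.

(** * A notation for formulas with named bound variables *)

(* A [fm] is a formula waiting for the number d of binders above it. A
   variable is represented by the number of binders above its own binder (its
   de Bruijn level), hence has de Bruijn index d - 1 - x at depth d. *)
Definition var := nat.
Definition fm := nat -> form.

Definition idx (d : nat) (x : var) : nat := d - S x.

Definition fBot : fm := fun _ => Bot.
Definition fEq (x y : var) : fm := fun d => Eq (idx d x) (idx d y).
Definition fMem (x y : var) : fm := fun d => Mem (idx d x) (idx d y).
Definition fSP (x y z : var) : fm := fun d => SP (idx d x) (idx d y) (idx d z).
Definition fImp (p q : fm) : fm := fun d => Imp (p d) (q d).
Definition fAnd (p q : fm) : fm := fun d => And (p d) (q d).
Definition fOr (p q : fm) : fm := fun d => Or (p d) (q d).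
Definition fAll (p : var -> fm) : fm := fun d => All (p d (S d)).
Definition fEx (p : var -> fm) : fm := fun d => Ex (p d (S d)).
Definition fNot (p : fm) : fm := fImp p fBot.
Definition fIff (p q : fm) : fm := fAnd (fImp p q) (fImp q p).

(* The formula p with its free de Bruijn index i interpreted as variable s i. *)
Definition inst (p : form) (s : nat -> var) : fm :=
  fun d => ren (fun i => idx d (s i)) p.

Fixpoint alls (n : nat) (p : form) : form :=
  match n with 0 => p | S n' => All (alls n' p) end.

(* The universal closure over n parameters, which are the variables
   0, ..., n - 1 of p. *)
Definition close (n : nat) (p : fm) : form := alls n (p n).

Declare Scope fm_scope.
Delimit Scope fm_scope with fm.
Bind Scope fm_scope with fm.
Notation "x =' y" := (fEq x y) (at level 70) : fm_scope.
Notation "x ∈' y" := (fMem x y) (at level 70) : fm_scope.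
Notation "¬' p" := (fNot p) (at level 75, right associativity) : fm_scope.
Notation "p ∧' q" := (fAnd p q) (at level 80, right associativity) : fm_scope.
Notation "p ∨' q" := (fOr p q) (at level 85, right associativity) : fm_scope.
Notation "p →' q" := (fImp p q) (at level 90, right associativity) : fm_scope.
Notation "p ↔' q" := (fIff p q) (at level 95, no associativity) : fm_scope.
Notation "∀' x .. y , p" := (fAll (fun x => .. (fAll (fun y => p)) ..))
  (at level 200, x binder, y binder, right associativity) : fm_scope.
Notation "∃' x .. y , p" := (fEx (fun x => .. (fEx (fun y => p)) ..))
  (at level 200, x binder, y binder, right associativity) : fm_scope.
Local Open Scope fm_scope.

(** * Set-theoretic vocabulary *)

Definition sEmpty (x : var) : fm := ∀' z, ¬' z ∈' x.
Definition sSub (x y : var) : fm := ∀' z, z ∈' x →' z ∈' y.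
Definition sTransitive (x : var) : fm := ∀' y, y ∈' x →' sSub y x.

(* In the presence of foundation, the ordinals are the transitive sets of
   transitive sets. *)
Definition sOrdinal (x : var) : fm :=
  sTransitive x ∧' ∀' y, y ∈' x →' sTransitive y.

(* y = x ∪ {x} *)
Definition sSucc (x y : var) : fm := ∀' z, z ∈' y ↔' (z ∈' x ∨' z =' x).

Definition sLimit (x : var) : fm :=
  sOrdinal x ∧' ¬' sEmpty x ∧' ¬' ∃' y, sSucc y x.

(* p = {a, b} *)
Definition sUpair (p a b : var) : fm := ∀' z, z ∈' p ↔' (z =' a ∨' z =' b).

(* p = (a, b) = {{a}, {a, b}} *)
Definition sPair (p a b : var) : fm :=
  ∃' u v, sUpair u a a ∧' sUpair v a b ∧' sUpair p u v.

(* t = (a, b, c) = ((a, b), c) *)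
Definition sTriple (t a b c : var) : fm := ∃' p, sPair p a b ∧' sPair t p c.

(* (a, b) ∈ f *)
Definition sApp (f a b : var) : fm := ∃' p, sPair p a b ∧' p ∈' f.

(* (a, b, c) ∈ R *)
Definition sHolds (R a b c : var) : fm := ∃' t, sTriple t a b c ∧' t ∈' R.

(* f is a function with domain d *)
Definition sFunction (f d : var) : fm :=
  (∀' p, p ∈' f →' ∃' x y, x ∈' d ∧' sPair p x y)
  ∧' (∀' x, x ∈' d →' ∃' y, sApp f x y ∧' ∀' z, sApp f x z →' z =' y).

(* α is an ordinal and y = F(α), where F is given by transfinite recursion:
   F(0) = ∅, F(γ + 1) is the v with [step γ F(γ) v], and F(λ) is the union
   of the F(γ), γ < λ, for limit λ. *)
Definition sRec (step : var -> var -> var -> fm) (α y : var) : fm :=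
  sOrdinal α ∧' ∃' d f, sSucc α d ∧' sFunction f d ∧' sApp f α y ∧'
    ∀' β v, β ∈' d →' sApp f β v →'
      (sEmpty β ∧' sEmpty v)
      ∨' (∃' γ u, sSucc γ β ∧' sApp f γ u ∧' step γ u v)
      ∨' (sLimit β ∧' ∀' z, z ∈' v ↔' ∃' γ u, γ ∈' β ∧' sApp f γ u ∧' z ∈' u).

(* v = u + k *)
Fixpoint sPlus (k : nat) (u v : var) : fm :=
  match k with
  | 0 => v =' u
  | S k' => ∃' w, sSucc u w ∧' sPlus k' w v
  end.

Definition q : nat := 10.

(* κ = qα; that is, q0 = 0, q(γ + 1) = qγ + q, continuous at limits *)
Definition sQ (α κ : var) : fm := sRec (fun _ u v => sPlus q u v) α κ.

(* U = V_α *)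
Definition sV (α U : var) : fm :=
  sRec (fun _ u v => ∀' z, z ∈' v ↔' sSub z u) α U.

(** * The predicate S *)

(* In what follows κ = qα, U = V_κ, and R is the relation S_α. *)

Definition sGood (κ U R A SA : var) : fm :=
  sSub A U
  ∧' (∀' t, t ∈' SA →' ∃' a b c,
        (a ∈' A ∨' a =' κ) ∧' (b ∈' A ∨' b =' κ) ∧' (c ∈' A ∨' c =' κ)
        ∧' sTriple t a b c)
  ∧' (∀' a b c, a ∈' A →' b ∈' A →' c ∈' A →'
        (sHolds SA a b c ↔' sHolds R a b c))
  ∧' (∀' a b, a ∈' A →' b ∈' A →' a ∈' b →' sHolds SA a b κ).

(* w = (κ, (A, SA)) *)
Definition sW (w κ A SA : var) : fm := ∃' p, sPair p A SA ∧' sPair w κ p.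

(* (A, SA) is good for α, w = w(α, A, SA) and a, b, c ∈ A ∪ {w} *)
Definition sCovers (κ U R A SA w a b c : var) : fm :=
  sGood κ U R A SA ∧' sW w κ A SA
  ∧' (a ∈' A ∨' a =' w) ∧' (b ∈' A ∨' b =' w) ∧' (c ∈' A ∨' c =' w).

(* x' is obtained from x by replacing w by κ *)
Definition sRepl (w κ x x' : var) : fm :=
  (x =' w ∧' x' =' κ) ∨' (¬' x =' w ∧' x' =' x).

(* S_{α+1}(a, b, c), for a, b, c ∈ V_{q(α+1)} *)
Definition sSnext (κ U R a b c : var) : fm :=
  let old := a ∈' U ∧' b ∈' U ∧' c ∈' U in
  (old ∧' sHolds R a b c)
  ∨' (¬' old ∧' ∃' A SA w, sCovers κ U R A SA w a b c ∧'
        ∃' a' b' c', sRepl w κ a a' ∧' sRepl w κ b b' ∧' sRepl w κ c c'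
          ∧' sHolds SA a' b' c')
  ∨' (¬' old ∧' ¬' ∃' A SA w, sCovers κ U R A SA w a b c).

(* R = S_α, as a set of triples *)
Definition sSrel (α R : var) : fm :=
  sRec (fun γ Q Q' =>
    ∃' κ U γ' κ' U', sQ γ κ ∧' sV κ U ∧' sSucc γ γ' ∧' sQ γ' κ' ∧' sV κ' U' ∧'
      ∀' t, t ∈' Q' ↔' ∃' a b c, a ∈' U' ∧' b ∈' U' ∧' c ∈' U'
        ∧' sTriple t a b c ∧' sSnext κ U Q a b c) α R.

Definition S_definition : form :=
  close 0 (∀' a b c, fSP a b c ↔'
    ∃' α κ U R, sQ α κ ∧' sV κ U ∧' a ∈' U ∧' b ∈' U ∧' c ∈' U
      ∧' sSrel α R ∧' sHolds R a b c).

(** * The theories *)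

(* The schemas range over the formulas p without S. In separation, index 0 of
   p is the element and 1, ..., n are the parameters; in replacement, 0 and 1
   are the argument and the value, and 2, ..., n + 1 are the parameters. *)
Inductive ZF_inf_TC : form -> Prop :=
  | ax_extensionality : ZF_inf_TC (close 0
      (∀' x y, (∀' z, z ∈' x ↔' z ∈' y) →' x =' y))
  | ax_foundation : ZF_inf_TC (close 0
      (∀' x, ¬' sEmpty x →' ∃' y, y ∈' x ∧' ¬' ∃' z, z ∈' x ∧' z ∈' y))
  | ax_empty : ZF_inf_TC (close 0 (∃' x, sEmpty x))
  | ax_pairing : ZF_inf_TC (close 0 (∀' x y, ∃' p, sUpair p x y))
  | ax_union : ZF_inf_TC (close 0
      (∀' x, ∃' u, ∀' z, z ∈' u ↔' ∃' y, y ∈' x ∧' z ∈' y))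
  | ax_power : ZF_inf_TC (close 0
      (∀' x, ∃' u, ∀' z, z ∈' u ↔' sSub z x))
  | ax_separation n p : S_free p -> bounded (1 + n) p -> ZF_inf_TC (close n
      (∀' u, ∃' v, ∀' x, x ∈' v ↔'
         (x ∈' u ∧' inst p (scons x (fun i => i)))))
  | ax_replacement n p : S_free p -> bounded (2 + n) p ->
      let P x y := inst p (scons x (scons y (fun i => i))) in
      ZF_inf_TC (close n
        (∀' u, (∀' x y z, x ∈' u →' P x y →' P x z →' y =' z) →'
           ∃' v, ∀' y, y ∈' v ↔' ∃' x, x ∈' u ∧' P x y))
  | ax_transitive_closure : ZF_inf_TC (close 0
      (∀' x, ∃' y, sTransitive y ∧' sSub x y)).

Definition T_both (p : form) : Prop :=
  sentence p /\ prv (fun a => ZF_inf_TC a \/ a = S_definition) nil p.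

(* Main.v *)
(** The proof uses two properties of [S] in D. First, [a ∈ b] implies
    [S(a, b, c)] for every [c]: this is built into goodness. Second, for a
    finite list [l] every one-point type over [l] respecting the first property
    is realized by some [w = (qα, (A, SA))], and [w] neither belongs to nor
    contains any element of [l].

    By the limit lemma the diagram of D is the limit of computable guesses. The
    copy receives one element per stage; at stage [s] a finite partial map from
    the copy to D is built greedily from the current guess, requirement after
    requirement: put [e] into its domain, put [e] into its range. A map is
    accepted only if it preserves [S] according to the guess and if, whenever
    [f(i) ∈ f(j)] is guessed, [S(i, j, c)] holds for all [c] present in the
    copy. Wrong guesses do no harm: by the second property a correct map can
    always be extended to a further element [e] of the copy, and since the value
    [w] has no membership relation with the earlier values, later elements of the
    copy cannot spoil it. If a range requirement finds no preimage for [e], the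
    new element of the copy gets the type of [e] over the
    current map, all other new triples satisfying [S]; by the first property
    this is consistent with the acceptance condition. Hence every requirement
    settles after finitely many changes, and the limit map is an isomorphism. *)
Require Import Defs.
From Stdlib Require Import List Arith Lia Bool Cantor Classical ClassicalEpsilon.
Import ListNotations.

(** The copy is committed stage by stage while the guesses are revised, so a point added under a
    wrong guess has an arbitrary type over the others and must still receive a value. The acceptance
    condition is the hypothesis of the extension property, asked in advance for every point of the
    copy. It concerns points not yet present, so no stage can verify it; but relative to the true
    diagram a rejected map stays rejected, and so acceptance settles for each map.

    Domain and range requirements settle for different reasons. A value for [e] exists in D from the
    outset. A preimage may have to be created; it then persists because every map built during a
    stage is still acceptable to the enlarged copy.

    In the set-theoretic half D may be ill-founded seen from outside, so induction and recursion are
    limited to definable classes. The types over a finite list may be undefinable all the same: a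
    set with finitely many elements, counted outside D, is obtained by adjunction. The constant q =
    10 leaves room for the rank of w, computed where w is placed in the hierarchy. *)

Definition unl (n : nat) : nat := fst (Cantor.of_nat n).
Definition unr (n : nat) : nat := snd (Cantor.of_nat n).

Lemma unl_pr a b : unl (pr a b) = a.
Proof. unfold unl, pr. now rewrite Cantor.cancel_of_to. Qed.

Lemma unr_pr a b : unr (pr a b) = b.
Proof. unfold unr, pr. now rewrite Cantor.cancel_of_to. Qed.

Lemma pr_un n : pr (unl n) (unr n) = n.
Proof.
  unfold unl, unr, pr. rewrite <- surjective_pairing. apply Cantor.cancel_to_of.
Qed.

Lemma pr_inj a b c d : pr a b = pr c d -> a = c /\ b = d.
Proof.
  intro H. split.
  - rewrite <- (unl_pr a b), H. apply unl_pr.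
  - rewrite <- (unr_pr a b), H. apply unr_pr.
Qed.

Lemma pr_le_r a b : b <= pr a b.
Proof. pose proof (Cantor.to_nat_non_decreasing a b). unfold pr. lia. Qed.

(** * Computable functions between coded types *)

Class Enc (A : Type) := enc : A -> nat.
#[global] Instance Enc_nat : Enc nat := fun n => n.
#[global] Instance Enc_bool : Enc bool := fun b => if b then 1 else 0.
#[global] Instance Enc_prod A B `{Enc A} `{Enc B} : Enc (A * B) :=
  fun p => pr (enc (fst p)) (enc (snd p)).
(** The successor keeps the code of a nonempty list apart from 0, the code of [[]]; its predecessor
    is then the code of the pair of head and tail. *)
Fixpoint enc_list {A} `{Enc A} (l : list A) : nat :=
  match l with [] => 0 | x :: t => S (pr (enc x) (enc_list t)) end.
#[global] Instance Enc_list A `{Enc A} : Enc (list A) := enc_list.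

(** The program has to behave only on codes; on numbers outside the range of [enc] it may do
    anything. *)
Definition comp {A B} `{Enc A} `{Enc B} (f : A -> B) : Prop :=
  exists c, forall a, eval empty_oracle c (enc a) (enc (f a)).

Lemma comp_ext {A B : Type} `{Enc A} `{Enc B}
  (f g : A -> B) : comp f -> (forall a, f a = g a) -> comp g.
Proof. intros [c Hc] Hfg. exists c. intro a. rewrite <- Hfg. apply Hc. Qed.

Lemma eval_id n : eval empty_oracle (CPair CLeft CRight) n n.
Proof. exists (unl n), (unr n). repeat split. symmetry. apply pr_un. Qed.

Lemma comp_id {A : Type} `{Enc A} : comp (fun a : A => a).
Proof. exists (CPair CLeft CRight). intro a. apply eval_id. Qed.

Lemma comp_const {A B : Type} `{Enc A} `{Enc B}
  (b : B) : comp (fun _ : A => b).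
Proof.
  assert (K : forall m, exists c, forall n, eval empty_oracle c n m).
  { induction m as [|m [c Hc]].
    - now exists CZero.
    - exists (CComp CSucc c). intro n. exists m. now split. }
  destruct (K (enc b)) as [c Hc]. exists c. intro. apply Hc.
Qed.

Lemma comp_comp {A B C : Type} `{Enc A} `{Enc B} `{Enc C}
  (f : B -> C) (g : A -> B) :
  comp f -> comp g -> comp (fun a => f (g a)).
Proof.
  intros [c Hc] [d Hd]. exists (CComp c d). intro a. exists (enc (g a)). now split.
Qed.

Lemma comp_pair {A B C : Type} `{Enc A} `{Enc B} `{Enc C}
  (f : A -> B) (g : A -> C) :
  comp f -> comp g -> comp (fun a => (f a, g a)).
Proof.
  intros [c Hc] [d Hd]. exists (CPair c d). intro a.
  exists (enc (f a)), (enc (g a)). repeat split; auto.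
Qed.

Lemma comp_fst {A B C : Type} `{Enc A} `{Enc B} `{Enc C}
  (f : A -> B * C) : comp f -> comp (fun a => fst (f a)).
Proof.
  intros [c Hc]. exists (CComp CLeft c). intro a. exists (enc (f a)).
  split; [apply Hc|]. symmetry. apply unl_pr.
Qed.

Lemma comp_snd {A B C : Type} `{Enc A} `{Enc B} `{Enc C}
  (f : A -> B * C) : comp f -> comp (fun a => snd (f a)).
Proof.
  intros [c Hc]. exists (CComp CRight c). intro a. exists (enc (f a)).
  split; [apply Hc|]. symmetry. apply unr_pr.
Qed.

Lemma comp_S {A : Type} `{Enc A}
  (f : A -> nat) : comp f -> comp (fun a => S (f a)).
Proof.
  intros [c Hc]. exists (CComp CSucc c). intro a. exists (enc (f a)). split; [apply Hc|reflexivity].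
Qed.

(** The nested triple in the hypothesis on [G] matches the argument [pr a (pr k' i)] that
    [prec_graph] hands to its step program. *)
Lemma comp_natrec {A B : Type} `{Enc A} `{Enc B}
  (F : A -> B) (G : A -> nat -> B -> B) (n : A -> nat) :
  comp F -> comp (fun p : A * (nat * B) => G (fst p) (fst (snd p)) (snd (snd p))) ->
  comp n ->
  comp (fun a => nat_rect (fun _ => B) (F a) (G a) (n a)).
Proof.
  intros [c Hc] [d Hd] [e He].
  exists (CComp (CPrec c d) (CPair (CPair CLeft CRight) e)). intro a.
  exists (pr (enc a) (enc (n a))). split.
  { exists (enc a), (enc (n a)). split; [apply eval_id|]. split; [apply He|reflexivity]. }
  exists (enc a), (enc (n a)). split; [reflexivity|].
  change (enc (n a)) with (n a). induction (n a) as [|k IH]; [apply Hc|].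
  exists (enc (nat_rect (fun _ => B) (F a) (G a) k)). split; [exact IH|].
  exact (Hd (a, (k, nat_rect (fun _ => B) (F a) (G a) k))).
Qed.

Lemma comp_unl {A : Type} `{Enc A}
  (f : A -> nat) : comp f -> comp (fun a => unl (f a)).
Proof.
  intros [c Hc]. exists (CComp CLeft c). intro a. exists (f a).
  split; [apply Hc|reflexivity].
Qed.

Lemma comp_unr {A : Type} `{Enc A}
  (f : A -> nat) : comp f -> comp (fun a => unr (f a)).
Proof.
  intros [c Hc]. exists (CComp CRight c). intro a. exists (f a).
  split; [apply Hc|reflexivity].
Qed.

Lemma comp_pr {A : Type} `{Enc A}
  (f g : A -> nat) : comp f -> comp g -> comp (fun a => pr (f a) (g a)).
Proof.
  intros [c Hc] [d Hd]. exists (CPair c d). intro a.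
  exists (f a), (g a). split; [apply Hc|]. split; [apply Hd|reflexivity].
Qed.

Lemma comp_enc {A B : Type} `{Enc A} `{Enc B}
  (f : A -> B) : comp f -> comp (fun a => enc (f a) : nat).
Proof. intros [c Hc]. exists c. exact Hc. Qed.

(** The code of a Boolean is 0 or 1, so branching is a recursion of that length whose base is the
    else branch. *)
Lemma comp_if {A B : Type} `{Enc A} `{Enc B}
  (b : A -> bool) (f g : A -> B) :
  comp b -> comp f -> comp g -> comp (fun a => if b a then f a else g a).
Proof.
  intros Hb Hf Hg.
  apply (comp_ext (fun a => nat_rect (fun _ => B) (g a) (fun _ _ => f a) (enc (b a)))).
  - apply (comp_natrec g (fun a _ _ => f a)); [assumption| |now apply comp_enc].
    apply (comp_comp f); [assumption|]. apply comp_fst, comp_id.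
  - intro a. now destruct (b a).
Qed.

Lemma comp_pred {A : Type} `{Enc A}
  (f : A -> nat) : comp f -> comp (fun a => pred (f a)).
Proof.
  intro Hf.
  apply (comp_ext (fun a => nat_rect (fun _ => nat) 0 (fun k _ => k) (f a))).
  - apply (comp_natrec (fun _ => 0) (fun _ k _ => k)); [apply comp_const| |assumption].
    apply comp_fst, comp_snd, comp_id.
  - intro a. now destruct (f a).
Qed.

(* The branches are evaluated only where they are meaningful: [g] is not
   applied to [pred 0], which need not code an element and a list. *)
Lemma comp_list_case {A B C : Type} `{Enc A} `{Enc B} `{Enc C}
  (l : A -> list B) (f : A -> C) (g : A -> B -> list B -> C) :
  comp l -> comp f ->
  comp (fun p : A * (B * list B) => g (fst p) (fst (snd p)) (snd (snd p))) ->
  comp (fun a => match l a with [] => f a | x :: t => g a x t end).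
Proof.
  intros Hl [c Hc] [d Hd].
  destruct (comp_pred _ (comp_enc _ Hl)) as [e He].
  assert (Hs : comp (fun a => if Nat.leb (enc (l a)) 0 then 0 else 1)).
  { apply (comp_ext (fun a => nat_rect (fun _ => nat) 0 (fun _ _ => 1) (enc (l a)))).
    - apply (comp_natrec (fun _ => 0) (fun _ _ _ => 1));
        [apply comp_const|apply comp_const|now apply comp_enc].
    - intro a. now destruct (enc (l a)). }
  destruct Hs as [h Hh].
  (* The recursion runs 0 or 1 times, as [h] says, on a parameter made of [a] and the predecessor of
     the code of the list. The base runs [c] on [a]; the step runs [d] on the whole parameter, which
     codes [(a, (x, t))] when the list is nonempty. *)
  exists (CComp (CPrec (CComp c CLeft) (CComp d CLeft)) (CPair (CPair (CPair CLeft CRight) e) h)).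
  intro a. specialize (Hc a). specialize (He a). specialize (Hh a).
  destruct (l a) as [|x t] eqn:El.
  - exists (pr (pr (enc a) 0) 0). split.
    + exists (pr (enc a) 0), 0. split; [|now split].
      exists (enc a), 0. split; [apply eval_id|now split].
    + exists (pr (enc a) 0), 0. split; [reflexivity|]. simpl.
      exists (enc a). split; [symmetry; apply unl_pr|assumption].
  - exists (pr (pr (enc a) (pr (enc x) (enc t))) 1). split.
    + exists (pr (enc a) (pr (enc x) (enc t))), 1. split; [|now split].
      exists (enc a), (pr (enc x) (enc t)). split; [apply eval_id|now split].
    + exists (pr (enc a) (pr (enc x) (enc t))), 1. split; [reflexivity|].
      exists (enc (f a)). split.
      * exists (enc a). split; [symmetry; apply unl_pr|assumption].
      * exists (pr (enc a) (pr (enc x) (enc t))). split; [symmetry; apply unl_pr|].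
        exact (Hd (a, (x, t))).
Qed.

Lemma comp_cons {A B : Type} `{Enc A} `{Enc B}
  (f : A -> B) (g : A -> list B) :
  comp f -> comp g -> comp (fun a => f a :: g a).
Proof.
  intros Hf Hg.
  destruct (comp_S _ (comp_pr _ _ (comp_enc _ Hf) (comp_enc _ Hg))) as [c Hc].
  exists c. exact Hc.
Qed.

Lemma length_enc_list {B : Type} `{Enc B}
  (l : list B) : length l <= enc l.
Proof.
  induction l as [|x t IH]; [apply Nat.le_refl|]. simpl. apply le_n_S.
  etransitivity; [exact IH|]. apply pr_le_r.
Qed.

(** The state of the recursion is the remaining list with the accumulator. The code of the list
    bounds its length and is used as the number of rounds; surplus rounds idle on [[]]. *)
Lemma comp_fold_left {A B C : Type} `{Enc A} `{Enc B} `{Enc C}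
  (F : A -> C -> B -> C) (l : A -> list B) (c : A -> C) :
  comp (fun p : A * (C * B) => F (fst p) (fst (snd p)) (snd (snd p))) ->
  comp l -> comp c ->
  comp (fun a => fold_left (F a) (l a) (c a)).
Proof.
  intros HF Hl Hc.
  pose (G a (k : nat) (st : list B * C) :=
    match fst st with [] => ([], snd st) | x :: t => (t, F a (snd st) x) end).
  apply (comp_ext (fun a =>
    snd (nat_rect (fun _ => (list B * C)%type) (l a, c a) (G a) (enc (l a))))).
  - apply comp_snd. apply (comp_natrec (fun a => (l a, c a)) G);
      [now apply comp_pair| |now apply comp_enc].
    unfold G.
    apply (comp_list_case (fun p : A * (nat * (list B * C)) => fst (snd (snd p)))
      (fun p => ([], snd (snd (snd p))))
      (fun p x t => (t, F (fst p) (snd (snd (snd p))) x))).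
    + apply comp_fst, comp_snd, comp_snd, comp_id.
    + apply comp_pair; [apply comp_const|]. apply comp_snd, comp_snd, comp_snd, comp_id.
    + apply comp_pair; [apply comp_snd, comp_snd, comp_id|].
      apply (comp_comp (fun p : A * (C * B) => F (fst p) (fst (snd p)) (snd (snd p)))
        (fun p : (A * (nat * (list B * C))) * (B * list B) =>
          (fst (fst p), (snd (snd (snd (fst p))), fst (snd p))))); [assumption|].
      repeat apply comp_pair.
      * apply comp_fst, comp_fst, comp_id.
      * apply comp_snd, comp_snd, comp_snd, comp_fst, comp_id.
      * apply comp_fst, comp_snd, comp_id.
  - intro a.
    assert (K : forall n st, length (fst st) <= n ->
      nat_rect (fun _ => (list B * C)%type) st (G a) n
      = ([], fold_left (F a) (fst st) (snd st))).
    (* [nat_rect] exposes its last round. Since [G] ignores the counter, the first round can be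
       split off instead, which suits the traversal of the list. *)
    { assert (R : forall n st, nat_rect (fun _ => (list B * C)%type) st (G a) (S n)
        = nat_rect (fun _ => (list B * C)%type) (G a 0 st) (G a) n).
      { induction n as [|n IH]; intro st; [reflexivity|].
        change (G a (S n) (nat_rect (fun _ => (list B * C)%type) st (G a) (S n))
          = G a n (nat_rect (fun _ => (list B * C)%type) (G a 0 st) (G a) n)).
        now rewrite IH. }
      induction n as [|n IH]; intros [l' c'] Hn; simpl in Hn.
      - destruct l'; [reflexivity|simpl in Hn; lia].
      - rewrite R. rewrite IH; unfold G; destruct l'; simpl in *; try reflexivity; lia. }
    rewrite K; [reflexivity|]. apply length_enc_list.
Qed.
(** Reversing the list, itself a left fold, reduces this to [comp_fold_left]. *)
Lemma comp_fold_right {A B C : Type} `{Enc A} `{Enc B} `{Enc C}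
  (F : A -> B -> C -> C) (l : A -> list B) (c : A -> C) :
  comp (fun p : A * (B * C) => F (fst p) (fst (snd p)) (snd (snd p))) ->
  comp l -> comp c ->
  comp (fun a => fold_right (F a) (c a) (l a)).
Proof.
  intros HF Hl Hc.
  apply (comp_ext (fun a =>
    fold_left (fun c x => F a x c) (fold_left (fun t x => x :: t) (l a) []) (c a))).
  - apply (comp_fold_left (fun a c x => F a x c)); [| |assumption].
    + apply (comp_comp (fun p : A * (B * C) => F (fst p) (fst (snd p)) (snd (snd p)))
        (fun p : A * (C * B) => (fst p, (snd (snd p), fst (snd p))))); [assumption|].
      repeat apply comp_pair; [apply comp_fst|apply comp_snd, comp_snd|apply comp_fst, comp_snd];
        apply comp_id.
    + apply (comp_fold_left (fun _ t x => x :: t)); [|assumption|apply comp_const].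
      apply comp_cons; [apply comp_snd, comp_snd, comp_id|apply comp_fst, comp_snd, comp_id].
  - intro a.
    replace (fold_left (fun t x => x :: t) (l a) []) with (rev (l a)).
    + now rewrite <- fold_left_rev_right, rev_involutive.
    + rewrite <- (app_nil_r (rev (l a))). generalize (@nil B).
      induction (l a) as [|x t IH]; intro s; [reflexivity|].
      simpl. now rewrite <- IH, <- app_assoc.
Qed.

Lemma comp_app {A B : Type} `{Enc A} `{Enc B}
  (f g : A -> list B) : comp f -> comp g -> comp (fun a => f a ++ g a).
Proof.
  intros Hf Hg. apply (comp_ext (fun a => fold_right cons (g a) (f a))).
  - apply (comp_fold_right (fun _ => cons)); try assumption.
    apply comp_cons; [apply comp_fst, comp_snd, comp_id|apply comp_snd, comp_snd, comp_id].
  - intro a. induction (f a) as [|x t IH]; [reflexivity|]. simpl. now rewrite IH.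
Qed.

Lemma comp_andb {A : Type} `{Enc A}
  (f g : A -> bool) : comp f -> comp g -> comp (fun a => f a && g a).
Proof.
  intros Hf Hg. apply (comp_if f g (fun _ => false)); [assumption..|apply comp_const].
Qed.

Lemma comp_orb {A : Type} `{Enc A}
  (f g : A -> bool) : comp f -> comp g -> comp (fun a => f a || g a).
Proof.
  intros Hf Hg. apply (comp_if f (fun _ => true) g); [assumption|apply comp_const|assumption].
Qed.

Lemma comp_negb {A : Type} `{Enc A}
  (f : A -> bool) : comp f -> comp (fun a => negb (f a)).
Proof.
  intros Hf. apply (comp_if f (fun _ => false) (fun _ => true));
    [assumption|apply comp_const..].
Qed.

Lemma comp_implb {A : Type} `{Enc A}
  (f g : A -> bool) : comp f -> comp g -> comp (fun a => implb (f a) (g a)).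
Proof.
  intros Hf Hg. apply (comp_if f g (fun _ => true)); [assumption..|apply comp_const].
Qed.

Lemma comp_eqb_bool {A : Type} `{Enc A}
  (f g : A -> bool) : comp f -> comp g -> comp (fun a => Bool.eqb (f a) (g a)).
Proof.
  intros Hf Hg. apply (comp_ext (fun a => if f a then g a else negb (g a))).
  - apply (comp_if f g (fun a => negb (g a))); [assumption..|now apply comp_negb].
  - intro a. now destruct (f a), (g a).
Qed.

Lemma comp_sub {A : Type} `{Enc A}
  (f g : A -> nat) : comp f -> comp g -> comp (fun a => f a - g a).
Proof.
  intros Hf Hg.
  apply (comp_ext (fun a => nat_rect (fun _ => nat) (f a) (fun _ h => pred h) (g a))).
  - apply (comp_natrec f (fun _ _ h => pred h)); try assumption.
    apply comp_pred, comp_snd, comp_snd, comp_id.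
  - intro a. induction (g a) as [|k IH]; simpl; lia.
Qed.

Lemma comp_add {A : Type} `{Enc A}
  (f g : A -> nat) : comp f -> comp g -> comp (fun a => f a + g a).
Proof.
  intros Hf Hg.
  apply (comp_ext (fun a => nat_rect (fun _ => nat) (g a) (fun _ h => S h) (f a))).
  - apply (comp_natrec g (fun _ _ h => S h)); try assumption.
    apply comp_S, comp_snd, comp_snd, comp_id.
  - intro a. induction (f a) as [|k IH]; simpl; [reflexivity|now rewrite IH].
Qed.

Lemma comp_leb {A : Type} `{Enc A}
  (f g : A -> nat) : comp f -> comp g -> comp (fun a => Nat.leb (f a) (g a)).
Proof.
  intros Hf Hg.
  apply (comp_ext (fun a =>
    nat_rect (fun _ => bool) true (fun _ _ => false) (f a - g a))).
  - apply (comp_natrec (fun _ => true) (fun _ _ _ => false));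
      [apply comp_const|apply comp_const|now apply comp_sub].
  - intro a. destruct (f a - g a) eqn:Ef; simpl; symmetry;
      [apply Nat.leb_le|apply Nat.leb_gt]; lia.
Qed.

Lemma comp_ltb {A : Type} `{Enc A}
  (f g : A -> nat) : comp f -> comp g -> comp (fun a => Nat.ltb (f a) (g a)).
Proof. intros Hf Hg. apply comp_leb; [now apply comp_S|assumption]. Qed.

Lemma comp_eqb {A : Type} `{Enc A}
  (f g : A -> nat) : comp f -> comp g -> comp (fun a => Nat.eqb (f a) (g a)).
Proof.
  intros Hf Hg.
  apply (comp_ext (fun a => Nat.leb (f a) (g a) && Nat.leb (g a) (f a))).
  - apply comp_andb; now apply comp_leb.
  - intro a. destruct (Nat.eqb_spec (f a) (g a)) as [->|Hn].
    + now rewrite Nat.leb_refl.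
    + destruct (Nat.leb_spec (f a) (g a)), (Nat.leb_spec (g a) (f a)); simpl; lia.
Qed.

Lemma comp_existsb {A B : Type} `{Enc A} `{Enc B}
  (P : A -> B -> bool) (l : A -> list B) :
  comp (fun p : A * B => P (fst p) (snd p)) -> comp l ->
  comp (fun a => existsb (P a) (l a)).
Proof.
  intros HP Hl. apply (comp_ext (fun a => fold_right (fun x b => P a x || b) false (l a))).
  - apply (comp_fold_right (fun a x b => P a x || b)); [|assumption|apply comp_const].
    apply comp_orb; [|apply comp_snd, comp_snd, comp_id].
    apply (comp_comp (fun p : A * B => P (fst p) (snd p))
      (fun p : A * (B * bool) => (fst p, fst (snd p)))); [assumption|].
    apply comp_pair; [apply comp_fst, comp_id|apply comp_fst, comp_snd, comp_id].
  - intro a. induction (l a) as [|x t IH]; [reflexivity|]. simpl. now rewrite IH.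
Qed.

Lemma comp_forallb {A B : Type} `{Enc A} `{Enc B}
  (P : A -> B -> bool) (l : A -> list B) :
  comp (fun p : A * B => P (fst p) (snd p)) -> comp l ->
  comp (fun a => forallb (P a) (l a)).
Proof.
  intros HP Hl. apply (comp_ext (fun a => fold_right (fun x b => P a x && b) true (l a))).
  - apply (comp_fold_right (fun a x b => P a x && b)); [|assumption|apply comp_const].
    apply comp_andb; [|apply comp_snd, comp_snd, comp_id].
    apply (comp_comp (fun p : A * B => P (fst p) (snd p))
      (fun p : A * (B * bool) => (fst p, fst (snd p)))); [assumption|].
    apply comp_pair; [apply comp_fst, comp_id|apply comp_fst, comp_snd, comp_id].
  - intro a. induction (l a) as [|x t IH]; [reflexivity|]. simpl. now rewrite IH.
Qed.

Lemma comp_flat_map {A B C : Type} `{Enc A} `{Enc B} `{Enc C}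
  (F : A -> B -> list C) (l : A -> list B) :
  comp (fun p : A * B => F (fst p) (snd p)) -> comp l ->
  comp (fun a => flat_map (F a) (l a)).
Proof.
  intros HP Hl. apply (comp_ext (fun a => fold_right (fun x s => F a x ++ s) [] (l a))).
  - apply (comp_fold_right (fun a x s => F a x ++ s)); [|assumption|apply comp_const].
    apply comp_app; [|apply comp_snd, comp_snd, comp_id].
    apply (comp_comp (fun p : A * B => F (fst p) (snd p))
      (fun p : A * (B * list C) => (fst p, fst (snd p)))); [assumption|].
    apply comp_pair; [apply comp_fst, comp_id|apply comp_fst, comp_snd, comp_id].
  - intro a. induction (l a) as [|x t IH]; [reflexivity|]. simpl. now rewrite IH.
Qed.

Lemma comp_seq0 {A : Type} `{Enc A}
  (f : A -> nat) : comp f -> comp (fun a => seq 0 (f a)).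
Proof.
  intro Hf.
  apply (comp_ext (fun a => nat_rect (fun _ => list nat) [] (fun k s => s ++ [k]) (f a))).
  - apply (comp_natrec (fun _ => []) (fun _ k s => s ++ [k])); [apply comp_const| |assumption].
    apply comp_app; [apply comp_snd, comp_snd, comp_id|].
    apply comp_cons; [apply comp_fst, comp_snd, comp_id|apply comp_const].
  - intro a. induction (f a) as [|k IH]; [reflexivity|]. rewrite seq_S, <- IH. reflexivity.
Qed.

(* The least [x < n] with [P x], or [n] if there is none. *)
Definition search (P : nat -> bool) (n : nat) : nat :=
  nat_rect (fun _ => nat) 0 (fun _ m => if P m then m else S m) n.

Lemma search_S P n :
  search P (S n) = if P (search P n) then search P n else S (search P n).
Proof. reflexivity. Qed.

Lemma search_spec P n :
  search P n <= n /\ (forall x, x < search P n -> P x = false)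
  /\ (search P n < n -> P (search P n) = true).
Proof.
  induction n as [|n (H1 & H2 & H3)]; [simpl; repeat split; intros; lia|].
  rewrite search_S. destruct (P (search P n)) eqn:EP; repeat split; try lia; auto.
  - intros x Hx. destruct (Nat.eq_dec x (search P n)) as [->|]; [assumption|].
    apply H2. lia.
Qed.

Lemma search_eq P n y :
  y < n -> P y = true -> (forall x, x < y -> P x = false) -> search P n = y.
Proof.
  intros Hy HP Hlt. destruct (search_spec P n) as (H1 & H2 & H3).
  destruct (lt_eq_lt_dec (search P n) y) as [[Hl|He]|Hg].
  - rewrite (Hlt _ Hl) in H3. discriminate H3. lia.
  - assumption.
  - rewrite (H2 _ Hg) in HP. discriminate.
Qed.

Lemma comp_search {A} `{Enc A} (P : A -> nat -> bool) (n : A -> nat) :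
  comp (fun p : A * nat => P (fst p) (snd p)) -> comp n ->
  comp (fun a => search (P a) (n a)).
Proof.
  intros HP Hn.
  apply (comp_natrec (fun _ => 0) (fun a _ m => if P a m then m else S m));
    [apply comp_const| |assumption].
  assert (K : comp (fun p : A * (nat * nat) => snd (snd p))).
  { apply comp_snd, comp_snd, comp_id. }
  apply (comp_if (fun p : A * (nat * nat) => P (fst p) (snd (snd p)))); [|assumption|].
  - apply (comp_comp (fun p : A * nat => P (fst p) (snd p))
      (fun p : A * (nat * nat) => (fst p, snd (snd p)))); [assumption|].
    apply comp_pair; [apply comp_fst, comp_id|assumption].
  - now apply comp_S.
Qed.

(** A hook for [comp1], redefined whenever further functions have been shown computable. *)
Ltac comp_user := fail.
Ltac comp1 :=
  lazymatch goal with
  | |- comp (fun a => a) => apply comp_id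
  | |- comp (fun _ => ?c) => apply (comp_const c)
  | |- comp fst => apply (comp_fst (fun a => a))
  | |- comp snd => apply (comp_snd (fun a => a))
  | |- comp (fun a => fst (@?f a)) => apply (comp_fst f)
  | |- comp (fun a => snd (@?f a)) => apply (comp_snd f)
  | |- comp (fun a => (@?f a, @?g a)) => apply (comp_pair f g)
  | |- comp (fun a => @?f a && @?g a) => apply (comp_andb f g)
  | |- comp (fun a => @?f a || @?g a) => apply (comp_orb f g)
  | |- comp (fun a => negb (@?f a)) => apply (comp_negb f)
  | |- comp (fun a => implb (@?f a) (@?g a)) => apply (comp_implb f g)
  | |- comp (fun a => Bool.eqb (@?f a) (@?g a)) => apply (comp_eqb_bool f g)
  | |- comp (fun a => @?f a =? @?g a) => apply (comp_eqb f g)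
  | |- comp (fun a => @?f a <? @?g a) => apply (comp_ltb f g)
  | |- comp (fun a => @?f a <=? @?g a) => apply (comp_leb f g)
  | |- comp (fun a => S (@?f a)) => apply (comp_S f)
  | |- comp (fun a => @?f a + @?g a) => apply (comp_add f g)
  | |- comp (fun a => @?f a - @?g a) => apply (comp_sub f g)
  | |- comp (fun a => pr (@?f a) (@?g a)) => apply (comp_pr f g)
  | |- comp (fun a => unl (@?f a)) => apply (comp_unl f)
  | |- comp (fun a => unr (@?f a)) => apply (comp_unr f)
  | |- comp (fun a => if @?b a then @?f a else @?g a) => apply (comp_if b f g)
  | |- comp (fun a => @?f a :: @?g a) => apply (comp_cons f g)
  | |- comp (fun a => @?f a ++ @?g a) => apply (comp_app f g)
  | |- comp (fun a => existsb (@?P a) (@?l a)) => apply (comp_existsb P l)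
  | |- comp (fun a => forallb (@?P a) (@?l a)) => apply (comp_forallb P l)
  | |- comp (fun a => flat_map (@?P a) (@?l a)) => apply (comp_flat_map P l)
  | |- comp (fun a => seq 0 (@?f a)) => apply (comp_seq0 f)
  | |- comp (fun a => search (@?P a) (@?n a)) => apply (comp_search P n)
  | |- _ => first [assumption | comp_user]
  end; cbv beta.
Ltac comp_tac := repeat comp1.

(** * Eventual truth along the stages, and limits of bounded searches *)

Definition eventually (P : nat -> Prop) : Prop := exists n, forall s, n <= s -> P s.

Lemma eventually_and P Q :
  eventually P -> eventually Q -> eventually (fun s => P s /\ Q s).
Proof.
  intros [n Hn] [m Hm]. exists (n + m). intros s Hs. split; [apply Hn|apply Hm]; lia.
Qed.

Lemma eventually_mono (P Q : nat -> Prop) :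
  (forall s, P s -> Q s) -> eventually P -> eventually Q.
Proof. intros H [n Hn]. exists n. auto. Qed.

Lemma eventually_all_below (P : nat -> nat -> Prop) n :
  (forall x, x < n -> eventually (P x)) ->
  eventually (fun s => forall x, x < n -> P x s).
Proof.
  induction n as [|n IH]; intro H; [exists 0; lia|].
  assert (H1 := eventually_and _ _ (IH (fun x Hx => H x (Nat.lt_lt_succ_r _ _ Hx))) (H n (Nat.lt_succ_diag_r n))).
  revert H1. apply eventually_mono. intros s [Ha Hb] x Hx.
  destruct (Nat.eq_dec x n) as [->|]; [assumption|]. apply Ha. lia.
Qed.

Lemma eventually_all_in {A} (P : A -> nat -> Prop) l :
  (forall x, In x l -> eventually (P x)) ->
  eventually (fun s => forall x, In x l -> P x s).
Proof.
  induction l as [|y l IH]; intro H; [exists 0; contradiction|].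
  assert (H1 := eventually_and _ _ (IH (fun x Hx => H x (or_intror Hx))) (H y (or_introl eq_refl))).
  revert H1. apply eventually_mono. intros s [Ha Hb] x [<-|Hx]; auto.
Qed.

Lemma least_exists (P : nat -> Prop) :
  (exists n, P n) -> exists n, P n /\ forall m, m < n -> ~ P m.
Proof.
  intros [n Hn]. apply NNPP. intro Hno.
  assert (K : forall k m, m < k -> ~ P m).
  { induction k as [|k IH]; [lia|]. intros m Hm HPm. apply Hno.
    exists m. split; [assumption|]. intros j Hj. apply IH. lia. }
  exact (K (S n) n (Nat.lt_succ_diag_r n) Hn).
Qed.

(** Convergence of [P] is only pointwise, but the search is decided by the finitely many arguments
    up to the least solution of [Q]. *)
Lemma search_limit (P : nat -> nat -> bool) (Q : nat -> bool) :
  (forall x, eventually (fun s => P s x = Q x)) ->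
  (exists x, Q x = true) ->
  exists y, Q y = true /\ eventually (fun s => search (P s) s = y).
Proof.
  intros HPQ Hex. destruct (least_exists _ Hex) as (y & Hy & Hlt).
  exists y. split; [assumption|].
  assert (H := eventually_all_below (fun x s => P s x = Q x) (S y) (fun x _ => HPQ x)).
  assert (H0 : eventually (fun s => y < s)) by (exists (S y); lia).
  generalize (eventually_and _ _ H H0). apply eventually_mono.
  intros s [Hs Hys]. apply search_eq; [assumption| |].
  - now rewrite Hs by lia.
  - intros x Hx. rewrite Hs by lia. now apply not_true_is_false, Hlt.
Qed.

(** * Certificates for computations and the limit lemma *)

Lemma encode_inj c d : encode c = encode d -> c = d.
Proof.
  revert d. induction c; intros []; simpl; intro H;
    apply pr_inj in H as [Ht H]; try discriminate Ht; try reflexivity;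
    try (apply pr_inj in H as [H1 H2]); f_equal; auto.
Qed.

Lemma prec_graph_functional (F G : nat -> nat -> Prop) :
  (forall n r s, F n r -> F n s -> r = s) ->
  (forall n r s, G n r -> G n s -> r = s) ->
  forall a k r s, prec_graph F G a k r -> prec_graph F G a k s -> r = s.
Proof.
  intros HF HG a k. induction k as [|k IH]; simpl; [apply HF|].
  intros r s (i & Hi & Hr) (j & Hj & Hs). rewrite (IH _ _ Hj Hi) in Hs. eauto.
Qed.

Lemma eval_functional X c n r s : eval X c n r -> eval X c n s -> r = s.
Proof.
  revert n r s. induction c; simpl; intros n r s; try (intros; congruence).
  - intros [[H ->]|[H ->]] [[H' ->]|[H' ->]]; (reflexivity || contradiction).
  - intros (a & b & Ha & Hb & ->) (a' & b' & Ha' & Hb' & ->).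
    now rewrite (IHc1 _ _ _ Ha Ha'), (IHc2 _ _ _ Hb Hb').
  - intros (m & Hm & Hr) (m' & Hm' & Hs). rewrite (IHc2 _ _ _ Hm' Hm) in Hs. eauto.
  - intros (a & k & -> & Hr) (a' & k' & E & Hs). apply pr_inj in E as [<- <-].
    exact (prec_graph_functional _ _ IHc1 IHc2 _ _ _ _ Hr Hs).
  - intros [H0 H1] [H0' H1']. destruct (lt_eq_lt_dec r s) as [[Hl|He]|Hg]; [|assumption|].
    + destruct (H1' _ Hl) as [v Hv]. discriminate (IHc _ _ _ H0 Hv).
    + destruct (H1 _ Hg) as [v Hv]. discriminate (IHc _ _ _ H0' Hv).
Qed.

(* The item [(0, (g, _))] claims that [g] is the code of a program, and
   [(S e, (n, r))] claims that [e] codes a program with value [r] on [n]. *)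
Definition item : Type := nat * (nat * nat).

Definition has_eval (f n r : nat) (L : list item) : bool :=
  existsb (fun it => (fst it =? S f) && (fst (snd it) =? n) && (snd (snd it) =? r)) L.

Definition has_code (g : nat) (L : list item) : bool :=
  existsb (fun it => (fst it =? 0) && (fst (snd it) =? g)) L.

Definition justified_code (g : nat) (L : list item) : bool :=
  ((unl g <? 5) && (unr g =? 0))
  || ((5 <=? unl g) && (unl g <=? 7)
      && has_code (unl (unr g)) L && has_code (unr (unr g)) L)
  || ((unl g =? 8) && has_code (unr g) L).

(** One disjunct for each constructor, with two for [CPrec]; intermediate values are looked for
    among the third components of the items in [L]. At recursion argument 0 the step program is not
    run, so [has_code] has to vouch for it. In the clause for [CMu], [S (v - 1)] is [v] for positive
    [v] and is never 0, so the scan finds positive values only. *)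
Definition justified_eval (orc : nat -> nat -> bool) (e n r : nat) (L : list item) : bool :=
  ((unl e =? 0) && (unr e =? 0) && (r =? 0))
  || ((unl e =? 1) && (unr e =? 0) && (r =? S n))
  || ((unl e =? 2) && (unr e =? 0) && (r =? unl n))
  || ((unl e =? 3) && (unr e =? 0) && (r =? unr n))
  || ((unl e =? 4) && (unr e =? 0) && orc n r)
  || ((unl e =? 5) && has_eval (unl (unr e)) n (unl r) L
      && has_eval (unr (unr e)) n (unr r) L)
  || ((unl e =? 6) && existsb (fun it =>
        has_eval (unr (unr e)) n (snd (snd it)) L
        && has_eval (unl (unr e)) (snd (snd it)) r L) L)
  || ((unl e =? 7) && (unr n =? 0) && has_eval (unl (unr e)) (unl n) r L
      && has_code (unr (unr e)) L)
  || ((unl e =? 7) && negb (unr n =? 0) && existsb (fun it =>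
        has_eval e (pr (unl n) (unr n - 1)) (snd (snd it)) L
        && has_eval (unr (unr e)) (pr (unl n) (pr (unr n - 1) (snd (snd it)))) r L) L)
  || ((unl e =? 8) && has_eval (unr e) (pr n r) 0 L
      && forallb (fun k => existsb (fun it =>
           has_eval (unr e) (pr n k) (S (snd (snd it) - 1)) L) L) (seq 0 r)).

Definition justified (orc : nat -> nat -> bool) (it : item) (L : list item) : bool :=
  if fst it =? 0 then justified_code (fst (snd it)) L
  else justified_eval orc (fst it - 1) (fst (snd it)) (snd (snd it)) L.

(** The first component of the accumulator rebuilds the tail: each item must be justified by those
    behind it. As a fold, the test falls under [comp_fold_right]. *)
Definition valid (orc : nat -> nat -> bool) (L : list item) : bool :=
  snd (fold_right (fun it acc => (it :: fst acc, justified orc it (fst acc) && snd acc))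
    ([], true) L).

Lemma valid_cons orc it L : valid orc (it :: L) = justified orc it L && valid orc L.
Proof.
  unfold valid. simpl. f_equal. f_equal.
  induction L as [|x L IH]; [reflexivity|]. simpl. now rewrite IH.
Qed.

Lemma has_eval_In f n r L : has_eval f n r L = true <-> In (S f, (n, r)) L.
Proof.
  unfold has_eval. rewrite existsb_exists. split.
  - intros ([x [y z]] & Hin & H). simpl in H.
    rewrite !andb_true_iff, !Nat.eqb_eq in H. now destruct H as [[-> ->] ->].
  - intro H. exists (S f, (n, r)). split; [assumption|]. simpl. now rewrite !Nat.eqb_refl.
Qed.

Lemma has_code_In g L : has_code g L = true <-> exists z, In (0, (g, z)) L.
Proof.
  unfold has_code. rewrite existsb_exists. split.
  - intros ([x [y z]] & Hin & H). simpl in H.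
    rewrite !andb_true_iff, !Nat.eqb_eq in H. destruct H as [-> ->]. now exists z.
  - intros [z H]. exists (0, (g, z)). split; [assumption|]. simpl. now rewrite Nat.eqb_refl.
Qed.

Definition answers (X : nat -> Prop) (orc : nat -> nat -> bool) : Prop :=
  forall n r, orc n r = true <-> (X n /\ r = 1) \/ (~ X n /\ r = 0).

Definition claim (X : nat -> Prop) (it : item) : Prop :=
  match it with
  | (0, (g, _)) => exists c, encode c = g
  | (S e, (n, r)) => exists c, encode c = e /\ eval X c n r
  end.

Lemma un_eq n a b : unl n = a -> unr n = b -> n = pr a b.
Proof. intros <- <-. symmetry. apply pr_un. Qed.

Ltac bool_hyps :=
  repeat match goal with
  | H : _ || _ = true |- _ => apply orb_true_iff in H as [H|H]
  | H : _ && _ = true |- _ => apply andb_true_iff in H as [? ?]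
  | H : (_ =? _) = true |- _ => apply Nat.eqb_eq in H
  | H : (_ <=? _) = true |- _ => apply Nat.leb_le in H
  | H : (_ <? _) = true |- _ => apply Nat.ltb_lt in H
  | H : has_eval _ _ _ _ = true |- _ => apply has_eval_In in H
  | H : has_code _ _ = true |- _ => apply has_code_In in H as [? H]
  | H : existsb _ _ = true |- _ => apply existsb_exists in H as [? [? H]]
  | H : negb _ = true |- _ => apply negb_true_iff, Nat.eqb_neq in H
  end.

Lemma justified_code_sound X g L :
  (forall it, In it L -> claim X it) -> justified_code g L = true ->
  exists c, encode c = g.
Proof.
  intros HL H. unfold justified_code in H. bool_hyps.
  - rewrite (un_eq g (unl g) 0) by auto.
    destruct (unl g) as [|[|[|[|[|k]]]]]; [exists CZero|exists CSucc|exists CLeft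
      |exists CRight|exists COracle|lia]; reflexivity.
  - destruct (HL _ H1) as [c Hc]. destruct (HL _ H0) as [d Hd].
    rewrite <- (pr_un g), <- (pr_un (unr g)), <- Hc, <- Hd.
    destruct (unl g) as [|[|[|[|[|[|[|[|k]]]]]]]]; try lia;
      [exists (CPair c d)|exists (CComp c d)|exists (CPrec c d)]; reflexivity.
  - destruct (HL _ H0) as [c Hc]. exists (CMu c).
    rewrite <- (pr_un g), H, <- Hc. reflexivity.
Qed.

Lemma justified_eval_sound X orc e n r L :
  answers X orc -> (forall it, In it L -> claim X it) ->
  justified_eval orc e n r L = true ->
  exists c, encode c = e /\ eval X c n r.
Proof.
  intros HX HL H.
  assert (HE : forall f m v, In (S f, (m, v)) L -> exists c, encode c = f /\ eval X c m v)
    by (intros f m v Hin; exact (HL _ Hin)).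
  unfold justified_eval in H. bool_hyps;
    try (rewrite (un_eq e _ _ H H1); subst r; eexists; split;
         [reflexivity|reflexivity]).
  - exists CZero. split; [now rewrite (un_eq e _ _ H H1)|assumption].
  - exists CSucc. split; [now rewrite (un_eq e _ _ H H1)|assumption].
  - exists CLeft. split; [now rewrite (un_eq e _ _ H H1)|assumption].
  - exists CRight. split; [now rewrite (un_eq e _ _ H H1)|assumption].
  - exists COracle. split; [now rewrite (un_eq e _ _ H H1)|]. now apply HX.
  - destruct (HE _ _ _ H1) as (c & Hc & Ec). destruct (HE _ _ _ H0) as (d & Hd & Ed).
    exists (CPair c d). split.
    + simpl. now rewrite Hc, Hd, pr_un, <- H, pr_un.
    + exists (unl r), (unr r). now rewrite pr_un.
  - destruct (HE _ _ _ H2) as (c & Hc & Ec). destruct (HE _ _ _ H0) as (d & Hd & Ed).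
    exists (CComp c d). split.
    + simpl. now rewrite Hc, Hd, pr_un, <- H, pr_un.
    + exists (snd (snd x)). now split.
  - destruct (HE _ _ _ H1) as (c & Hc & Ec). destruct (HL _ H0) as (d & Hd).
    exists (CPrec c d). split.
    + simpl. now rewrite Hc, Hd, pr_un, <- H, pr_un.
    + exists (unl n), (unr n). rewrite pr_un, H2. now split.
  - destruct (HE _ _ _ H0) as (c & Hc & Ec). destruct (HE _ _ _ H3) as (d & Hd & Ed).
    exists c. split; [assumption|].
    (* The item for the preceding argument concerns the same [e], whose tag is 7; the program behind
       it is therefore a [CPrec], and its step program is the one coded in [e]. *)
    rewrite <- Hc in H. destruct c; simpl in H; rewrite unl_pr in H; try discriminate H.
    destruct Ec as (a & k & Epr & Hk). apply pr_inj in Epr as [<- Ek].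
    exists (unl n), (S k). split; [rewrite <- (pr_un n) at 1; f_equal; lia|].
    exists (snd (snd x)). split; [assumption|].
    rewrite <- Ek. rewrite <- Hc in Hd. simpl in Hd. rewrite !unr_pr in Hd.
    apply encode_inj in Hd as <-. assumption.
  - destruct (HE _ _ _ H1) as (c & Hc & Ec). exists (CMu c). split.
    + simpl. now rewrite Hc, <- H, pr_un.
    + split; [assumption|]. intros k Hk. rewrite forallb_forall in H0.
      specialize (H0 k ltac:(apply in_seq; lia)). bool_hyps.
      destruct (HE _ _ _ H0) as (d & Hd & Ed). rewrite <- Hc in Hd.
      apply encode_inj in Hd as ->. eauto.
Qed.

Lemma valid_sound X orc L :
  answers X orc -> valid orc L = true -> forall it, In it L -> claim X it.
Proof.
  intro HX. induction L as [|[e [n r]] L IH]; [contradiction|].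
  rewrite valid_cons. intro H. apply andb_true_iff in H as [HJ HV].
  specialize (IH HV). intros it [<-|Hin]; [|now apply IH].
  unfold justified in HJ. simpl in HJ. destruct e as [|e]; simpl in HJ.
  - eapply justified_code_sound; eauto.
  - rewrite Nat.sub_0_r in HJ. eapply justified_eval_sound; eauto.
Qed.

Lemma has_eval_incl f n r L L' :
  incl L L' -> has_eval f n r L = true -> has_eval f n r L' = true.
Proof. rewrite !has_eval_In. auto. Qed.

Lemma has_code_incl g L L' : incl L L' -> has_code g L = true -> has_code g L' = true.
Proof. rewrite !has_code_In. intros HI [z Hz]. eauto. Qed.

Lemma existsb_incl (P Q : item -> bool) L L' :
  incl L L' -> (forall x, P x = true -> Q x = true) ->
  existsb P L = true -> existsb Q L' = true.
Proof. rewrite !existsb_exists. intros HI HPQ (x & Hx & HP). eauto. Qed.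

Lemma justified_incl orc it L L' :
  incl L L' -> justified orc it L = true -> justified orc it L' = true.
Proof.
  intro HI. pose proof (fun f n r => has_eval_incl f n r L L' HI) as HE.
  pose proof (fun g => has_code_incl g L L' HI) as HC.
  unfold justified. destruct (fst it =? 0).
  - unfold justified_code. rewrite !orb_true_iff, !andb_true_iff. intuition.
  - unfold justified_eval. rewrite !orb_true_iff, !andb_true_iff, !forallb_forall.
    (* The common shape of the clause for [CComp] and of the recursion step: [m] describes how the
       intermediate value enters the next argument. *)
    assert (H1 : forall f n g m k, existsb (fun it => has_eval f n (snd (snd it)) L
      && has_eval g (m (snd (snd it))) k L) L = true ->
      existsb (fun it => has_eval f n (snd (snd it)) L'
      && has_eval g (m (snd (snd it))) k L') L' = true).
    { intros f n g m k. apply existsb_incl; [assumption|]. intro x.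
      rewrite !andb_true_iff. intuition. }
    intros [H|H].
    + left. revert H.
      specialize (H1 (unr (unr (fst it - 1))) (fst (snd it)) (unl (unr (fst it - 1)))
        (fun x => x) (snd (snd it))) as H2.
      specialize (H1 (fst it - 1) (pr (unl (fst (snd it))) (unr (fst (snd it)) - 1))
        (unr (unr (fst it - 1)))
        (fun x => pr (unl (fst (snd it))) (pr (unr (fst (snd it)) - 1) x)) (snd (snd it))).
      simpl in H1, H2. intuition.
    + right. destruct H as [[Ha Hb] Hc]. repeat split; auto.
      intros k Hk. generalize (Hc k Hk). apply existsb_incl; auto.
Qed.

Lemma valid_app orc L L' :
  valid orc L = true -> valid orc L' = true -> valid orc (L ++ L') = true.
Proof.
  induction L as [|it L IH]; [auto|]. simpl. rewrite !valid_cons, !andb_true_iff.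
  intros [HJ HV] HV'. split; [|now apply IH].
  revert HJ. apply justified_incl. intros x Hx. apply in_or_app. now left.
Qed.

Definition certifies orc (L : list item) (e n r : nat) : Prop :=
  valid orc L = true /\ In (S e, (n, r)) L.

(** Serves the base case of a primitive recursion, where the step program leaves no evaluation
    behind. *)
Lemma has_code_complete orc c : exists L, valid orc L = true /\ has_code (encode c) L = true.
Proof.
  assert (K : forall c L, valid orc L = true -> justified_code (encode c) L = true ->
    exists L, valid orc L = true /\ has_code (encode c) L = true).
  { intros d L HV HJ. exists ((0, (encode d, 0)) :: L). rewrite valid_cons, HV.
    unfold justified. simpl. rewrite HJ, Nat.eqb_refl. now split. }
  induction c; try (apply (K _ []); [reflexivity|]; unfold justified_code; cbn [encode];
    rewrite unl_pr, unr_pr; reflexivity).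
  1-3: destruct IHc1 as (L1 & V1 & H1); destruct IHc2 as (L2 & V2 & H2);
    apply (K _ (L1 ++ L2)); [now apply valid_app|];
    assert (G1 : has_code (encode c1) (L1 ++ L2) = true)
      by (revert H1; apply has_code_incl; intros x Hx; apply in_or_app; now left);
    assert (G2 : has_code (encode c2) (L1 ++ L2) = true)
      by (revert H2; apply has_code_incl; intros x Hx; apply in_or_app; now right);
    unfold justified_code; cbn [encode]; rewrite !unl_pr, !unr_pr, !unl_pr, G1, G2; reflexivity.
  destruct IHc as (L & V & H). apply (K _ L); [assumption|].
  unfold justified_code. cbn [encode]. rewrite !unl_pr, !unr_pr, H. reflexivity.
Qed.

Lemma certifies_cons orc L e n r :
  valid orc L = true -> justified_eval orc e n r L = true ->
  exists L, certifies orc L e n r.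
Proof.
  intros HV HJ. exists ((S e, (n, r)) :: L). split; [|now left].
  rewrite valid_cons, HV. unfold justified. simpl. now rewrite Nat.sub_0_r, HJ.
Qed.

Lemma certifies_app_l orc L L' e n r :
  certifies orc L e n r -> has_eval e n r (L ++ L') = true.
Proof. intros [_ H]. apply has_eval_In, in_or_app. now left. Qed.

Lemma certifies_app_r orc L L' e n r :
  certifies orc L' e n r -> has_eval e n r (L ++ L') = true.
Proof. intros [_ H]. apply has_eval_In, in_or_app. now right. Qed.

Lemma existsb_of_has_eval (P : item -> bool) e n r L :
  has_eval e n r L = true -> P (S e, (n, r)) = true -> existsb P L = true.
Proof. rewrite has_eval_In, existsb_exists. eauto. Qed.

(** Induction on the program. Certificates of the subcomputations are concatenated, which preserves
    validity because justification is monotone in the list. *)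
Lemma eval_certified X orc c n r :
  answers X orc -> eval X c n r -> exists L, certifies orc L (encode c) n r.
Proof.
  intro HX. revert n r.
  Local Ltac je := unfold justified_eval; cbn [encode]; rewrite ?unl_pr, ?unr_pr, ?unl_pr, ?unr_pr; simpl.
  induction c as [| | | | |f IHf g IHg|f IHf g IHg|f IHf g IHg|f IHf]; intros n r.
  - intros ->. apply (certifies_cons _ []); [reflexivity|]. now je.
  - intros ->. apply (certifies_cons _ []); [reflexivity|]. je. now rewrite Nat.eqb_refl.
  - intros ->. apply (certifies_cons _ []); [reflexivity|]. je.
    unfold unl. now rewrite Nat.eqb_refl.
  - intros ->. apply (certifies_cons _ []); [reflexivity|]. je.
    unfold unr. now rewrite Nat.eqb_refl.
  - intro H. apply HX in H. apply (certifies_cons _ []); [reflexivity|]. je. now rewrite H.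
  - intros (a & b & Ha & Hb & ->). destruct (IHf _ _ Ha) as [L HL]. destruct (IHg _ _ Hb) as [L' HL'].
    apply (certifies_cons _ (L ++ L')); [apply valid_app; [apply HL|apply HL']|].
    je. rewrite (certifies_app_l _ _ L' _ _ _ HL), (certifies_app_r _ L _ _ _ _ HL').
    reflexivity.
  - intros (m & Hm & Hr). destruct (IHf _ _ Hr) as [L HL]. destruct (IHg _ _ Hm) as [L' HL'].
    apply (certifies_cons _ (L ++ L')); [apply valid_app; [apply HL|apply HL']|].
    je. rewrite (existsb_of_has_eval _ _ _ _ _ (certifies_app_r _ L _ _ _ _ HL')); [reflexivity|].
    simpl. now rewrite (certifies_app_l _ _ L' _ _ _ HL), (certifies_app_r _ L _ _ _ _ HL').
  - intros (a & k & -> & Hk). revert r Hk. induction k as [|k IHk]; intros r Hk.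
    + destruct (IHf _ _ Hk) as [L HL]. destruct (has_code_complete orc g) as (L' & V' & H').
      apply (certifies_cons _ (L ++ L')); [apply valid_app; [apply HL|assumption]|].
      assert (G : has_code (encode g) (L ++ L') = true)
        by (revert H'; apply has_code_incl; intros x Hx; apply in_or_app; now right).
      je. rewrite (certifies_app_l _ _ L' _ _ _ HL), G. reflexivity.
    + destruct Hk as (i & Hi & Hr). destruct (IHk _ Hi) as [L HL]. destruct (IHg _ _ Hr) as [L' HL'].
      apply (certifies_cons _ (L ++ L')); [apply valid_app; [apply HL|apply HL']|].
      pose proof (certifies_app_l _ _ L' _ _ _ HL) as G. simpl in G.
      je. rewrite Nat.sub_0_r, (existsb_of_has_eval _ _ _ _ _ G); [now rewrite ?orb_true_r|].
      simpl. now rewrite G, (certifies_app_r _ L _ _ _ _ HL').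
  - intros [H0 H1].
    (* One list has to certify the positive values at all arguments below [r]; it is collected one
       argument at a time. *)
    assert (K : forall j, j <= r -> exists L, valid orc L = true /\
      forall k, k < j -> existsb (fun it =>
           has_eval (encode f) (pr n k) (S (snd (snd it) - 1)) L) L = true).
    { induction j as [|j IHj]; intro Hj; [exists []; split; [reflexivity|lia]|].
      destruct IHj as (L & HV & HL); [lia|]. destruct (H1 j) as [v Hv]; [lia|].
      destruct (IHf _ _ Hv) as [L' HL'].
      exists (L ++ L'). split; [apply valid_app; [assumption|apply HL']|].
      intros k Hk. destruct (Nat.eq_dec k j) as [->|].
      - pose proof (certifies_app_r _ L _ _ _ _ HL') as G.
        rewrite (existsb_of_has_eval _ _ _ _ _ G); [reflexivity|]. simpl.
        now rewrite Nat.sub_0_r.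
      - generalize (HL k ltac:(lia)). apply existsb_incl; [apply incl_appl, incl_refl|].
        intro x. apply has_eval_incl, incl_appl, incl_refl. }
    destruct (K r (le_n r)) as (L & HV & HL). destruct (IHf _ _ H0) as [L' HL'].
    apply (certifies_cons _ (L' ++ L)); [apply valid_app; [apply HL'|assumption]|].
    je. rewrite (certifies_app_l _ _ L _ _ _ HL'). simpl.
    apply forallb_forall. intros k Hk. apply in_seq in Hk.
    generalize (HL k ltac:(lia)). apply existsb_incl; [apply incl_appr, incl_refl|].
    intro x. apply has_eval_incl, incl_appr, incl_refl.
Qed.

(** The use principle: a certificate consults the oracle only at the finitely many pairs that occur
    in its items. *)
Lemma valid_ext orc orc' L :
  (forall it, In it L -> orc (fst (snd it)) (snd (snd it)) = orc' (fst (snd it)) (snd (snd it))) ->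
  valid orc L = valid orc' L.
Proof.
  induction L as [|it L IH]; intro H; [reflexivity|].
  rewrite !valid_cons, IH by (intros x Hx; apply H; now right). f_equal.
  unfold justified, justified_eval. now rewrite (H it (or_introl eq_refl)).
Qed.

Lemma enc_items_onto n : exists L : list item, enc L = n.
Proof.
  induction n as [n IH] using lt_wf_ind. destruct n as [|n]; [now exists []|].
  destruct (IH (unr n)) as [L HL].
  { pose proof (pr_le_r (unl n) (unr n)). rewrite pr_un in H. lia. }
  exists ((unl (unl n), (unl (unr (unl n)), unr (unr (unl n)))) :: L).
  change (S (pr (pr (unl (unl n)) (pr (unl (unr (unl n))) (unr (unr (unl n))))) (enc L)) = S n).
  now rewrite HL, !pr_un.
Qed.

Definition items_of (n : nat) : list item :=
  proj1_sig (constructive_indefinite_description _ (enc_items_onto n)).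

Lemma enc_items_of n : enc (items_of n) = n.
Proof. exact (proj2_sig (constructive_indefinite_description _ (enc_items_onto n))). Qed.

Lemma enc_items_inj (L L' : list item) : enc L = enc L' -> L = L'.
Proof.
  revert L'. induction L as [|[a [b c]] L IH]; intros [|[a' [b' c']] L'] H; try discriminate H;
    [reflexivity|].
  injection H as H. apply pr_inj in H as [H1 H2]. apply pr_inj in H1 as [Ha H1].
  apply pr_inj in H1 as [Hb Hc]. change (a = a') in Ha. change (b = b') in Hb. change (c = c') in Hc.
  now rewrite Ha, Hb, Hc, (IH L' H2).
Qed.

Lemma items_of_enc L : items_of (enc L) = L.
Proof. apply enc_items_inj, enc_items_of. Qed.

(** [items_of] is obtained by choice, but on codes it is the identity, so a program for [f] already
    computes the composite. *)
Lemma comp_items_of {A : Type} `{Enc A} (f : A -> nat) :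
  comp f -> comp (fun a => items_of (f a)).
Proof.
  intros [c Hc]. exists c. intro a. rewrite enc_items_of. apply Hc.
Qed.

Lemma comp_has_eval {A : Type} `{Enc A} (f n r : A -> nat) (L : A -> list item) :
  comp f -> comp n -> comp r -> comp L ->
  comp (fun a => has_eval (f a) (n a) (r a) (L a)).
Proof.
  intros Hf Hn Hr HL. unfold has_eval. comp1; comp_tac.
  - apply (comp_comp f); [assumption|comp_tac].
  - apply (comp_comp n); [assumption|comp_tac].
  - apply (comp_comp r); [assumption|comp_tac].
Qed.

Lemma comp_has_code {A : Type} `{Enc A} (g : A -> nat) (L : A -> list item) :
  comp g -> comp L -> comp (fun a => has_code (g a) (L a)).
Proof.
  intros Hg HL. unfold has_code. comp1; comp_tac.
  apply (comp_comp g); [assumption|comp_tac].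
Qed.

Ltac comp_user ::=
  lazymatch goal with
  | |- comp (fun a => items_of (@?f a)) => apply (comp_items_of f)
  | |- comp (fun a => has_eval (@?f a) (@?n a) (@?r a) (@?L a)) =>
      apply (comp_has_eval f n r L)
  | |- comp (fun a => has_code (@?g a) (@?L a)) => apply (comp_has_code g L)
  end.

Lemma comp_valid {A : Type} `{Enc A} (orc : A -> nat -> nat -> bool) (L : A -> list item) :
  comp (fun p : A * (nat * nat) => orc (fst p) (fst (snd p)) (snd (snd p))) -> comp L ->
  comp (fun a => valid (orc a) (L a)).
Proof.
  intros Ho HL. unfold valid. apply comp_snd.
  apply (comp_fold_right (fun a it acc => (it :: fst acc, justified (orc a) it (fst acc) && snd acc)));
    [|assumption|apply comp_const].
  unfold justified, justified_code, justified_eval. comp_tac.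
  apply (comp_comp (fun p : A * (nat * nat) => orc (fst p) (fst (snd p)) (snd (snd p)))
    (fun p : A * (item * (list item * bool)) =>
       (fst p, (fst (snd (fst (snd p))), snd (snd (fst (snd p))))))); [assumption|comp_tac].
Qed.

(** The test [r =? 0] gives the answers of the empty oracle. The item sought has [e] both as program
    and as input, the diagonal of [jump]. *)
Definition halts_in (w e : nat) : bool :=
  valid (fun _ r => r =? 0) (items_of w)
  && existsb (fun it => (fst it =? S e) && (fst (snd it) =? e)) (items_of w).

Lemma zero'_halts_in e : zero' e <-> exists w, halts_in w e = true.
Proof.
  assert (HX : answers empty_oracle (fun _ r => r =? 0)).
  { intros n r. rewrite Nat.eqb_eq. unfold empty_oracle. tauto. }
  unfold zero', jump, halts_in. split.
  - intros (c & <- & v & Hv). destruct (eval_certified _ _ _ _ _ HX Hv) as (L & HV & Hin).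
    exists (enc L). rewrite items_of_enc, HV. apply existsb_exists.
    eexists. split; [exact Hin|]. simpl. now rewrite Nat.eqb_refl.
  - intros [w Hw]. apply andb_true_iff in Hw as [HV Hw].
    apply existsb_exists in Hw as ([x [y z]] & Hin & Hw). simpl in Hw. bool_hyps. subst x y.
    destruct (valid_sound _ _ _ HX HV _ Hin) as (c & Hc & Ec). eauto.
Qed.

Definition zero'_at (s e : nat) : bool := existsb (fun w => halts_in w e) (seq 0 s).

Lemma zero'_at_limit e :
  eventually (fun s => zero'_at s e = true <-> zero' e).
Proof.
  destruct (classic (zero' e)) as [H|H].
  - destruct (proj1 (zero'_halts_in e) H) as [w Hw]. exists (S w). intros s Hs.
    split; [auto|]. intros _. apply existsb_exists. exists w. split; [apply in_seq; lia|assumption].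
  - exists 0. intros s _. split; [|contradiction]. intro Hs.
    apply existsb_exists in Hs as (w & _ & Hw). apply zero'_halts_in. eauto.
Qed.

Definition answer (b : bool) (r : nat) : bool := if b then r =? 1 else r =? 0.

(** The guess at stage [s] is read off from the least certificate below [s] that ends in output 0 or
    1 and is valid for the stage [s] approximation of the oracle. By the use principle the validity
    of each certificate settles, and a truly valid one exists, so the least certificate settles by
    [search_limit]; soundness makes its output correct. *)
Lemma limit_lemma (P : nat -> Prop) :
  computable_in zero' P ->
  exists a : nat -> nat -> bool,
    comp (fun p : nat * nat => a (fst p) (snd p))
    /\ forall n, eventually (fun s => a s n = true <-> P n).
Proof.
  intros [c Hc].
  pose (orc s n r := answer (zero'_at s n) r).
  pose (tru n r := answer (if excluded_middle_informative (zero' n) then true else false) r).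
  assert (Htru : answers zero' tru).
  { intros n r. unfold tru, answer. destruct (excluded_middle_informative (zero' n));
      rewrite Nat.eqb_eq; tauto. }
  assert (Hlim : forall L, eventually (fun s => valid (orc s) L = valid tru L)).
  { intro L.
    assert (H : eventually (fun s => forall it, In it L ->
      (zero'_at s (fst (snd it)) = true <-> zero' (fst (snd it))))).
    { apply eventually_all_in. intros it _. apply zero'_at_limit. }
    revert H. apply eventually_mono. intros s Hs. apply valid_ext. intros it Hit.
    specialize (Hs it Hit). unfold orc, tru. f_equal.
    destruct (excluded_middle_informative (zero' (fst (snd it)))) as [H|H].
    - tauto.
    - apply not_true_is_false. tauto. }
  pose (test o n m := valid o (items_of m)
    && (has_eval (encode c) n 0 (items_of m) || has_eval (encode c) n 1 (items_of m))).
  exists (fun s n => has_eval (encode c) n 1 (items_of (search (test (orc s) n) s))). split.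
  - comp_tac. unfold test. comp_tac.
    apply (comp_valid (fun p => orc (fst (fst p))) (fun p => items_of (snd p))); [|comp_tac].
    unfold orc, answer, zero'_at, halts_in. comp_tac.
    apply (comp_valid (fun _ _ r => r =? 0) (fun p => items_of (snd p))); comp_tac.
  - intro n.
    destruct (search_limit (fun s => test (orc s) n) (test tru n)) as (m & Hm & Hev).
    + intro m. generalize (Hlim (items_of m)). apply eventually_mono.
      intros s Hs. unfold test. now rewrite Hs.
    + destruct (classic (P n)) as [HP|HP]; apply (Hc n) in HP;
        destruct (eval_certified _ _ _ _ _ Htru HP) as (L & HV & Hin);
        apply has_eval_In in Hin; exists (enc L); unfold test;
        rewrite items_of_enc, HV, Hin; now rewrite ?orb_true_r.
    + revert Hev. apply eventually_mono. intros s ->.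
      unfold test in Hm. apply andb_true_iff in Hm as [HV Hm].
      assert (HS : forall r, has_eval (encode c) n r (items_of m) = true -> eval zero' c n r).
      { intros r Hr. apply has_eval_In in Hr.
        destruct (valid_sound _ _ _ Htru HV _ Hr) as (d & Hd & Ed).
        now apply encode_inj in Hd as ->. }
      split.
      * intro H1. apply NNPP. intro HP. apply (Hc n) in HP.
        discriminate (eval_functional _ _ _ _ _ HP (HS _ H1)).
      * intro HP. apply (Hc n) in HP. apply orb_true_iff in Hm as [Hm|Hm]; [|assumption].
        discriminate (eval_functional _ _ _ _ _ HP (HS _ Hm)).
Qed.

(** * The construction of the copy *)

Definition dDom (x : nat) : nat := pr 0 (pr x x).
Definition dS (x y z : nat) : nat := pr 1 (pr x (pr y z)).
Definition dMem (x y : nat) : nat := pr 2 (pr x y).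

Lemma both_diagram_dom D x : both_diagram D (dDom x) <-> bdom D x.
Proof.
  split.
  - intros [[(a & Ha & E)|(a & b & c & _ & _ & _ & _ & E)]|(a & b & _ & _ & _ & E)];
      apply pr_inj in E as [E1 E2]; try discriminate E1.
    apply pr_inj in E2 as [-> _]. exact Ha.
  - intro H. left. left. now exists x.
Qed.

Lemma both_diagram_S D x y z : bdom D x -> bdom D y -> bdom D z ->
  (both_diagram D (dS x y z) <-> bS D x y z).
Proof.
  intros Hx Hy Hz. split.
  - intros [[(a & Ha & E)|(a & b & c & _ & _ & _ & H & E)]|(a & b & _ & _ & _ & E)];
      apply pr_inj in E as [E1 E2]; try discriminate E1.
    apply pr_inj in E2 as [-> E2]. apply pr_inj in E2 as [-> ->]. exact H.
  - intro H. left. right. exists x, y, z. repeat split; assumption.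
Qed.

Lemma both_diagram_mem D x y : bdom D x -> bdom D y ->
  (both_diagram D (dMem x y) <-> bmem D x y).
Proof.
  intros Hx Hy. split.
  - intros [[(a & Ha & E)|(a & b & c & _ & _ & _ & H & E)]|(a & b & _ & _ & H & E)];
      apply pr_inj in E as [E1 E2]; try discriminate E1.
    apply pr_inj in E2 as [-> ->]. exact H.
  - intro H. right. exists x, y. repeat split; assumption.
Qed.

Definition triple : Type := nat * (nat * nat).

(* The copy is given by the list of the triples at which S fails. *)
Definition cS (T : list triple) (i j k : nat) : bool :=
  negb (existsb (fun t => (fst t =? i) && (fst (snd t) =? j) && (snd (snd t) =? k)) T).

Lemma cS_false T i j k : cS T i j k = false <-> In (i, (j, k)) T.
Proof.
  unfold cS. rewrite negb_false_iff, existsb_exists. split.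
  - intros ([x [y z]] & Hin & H). simpl in H.
    rewrite !andb_true_iff, !Nat.eqb_eq in H. now destruct H as [[-> ->] ->].
  - intro H. eexists. split; [exact H|]. simpl. now rewrite !Nat.eqb_refl.
Qed.

Lemma cS_true T i j k : cS T i j k = true <-> ~ In (i, (j, k)) T.
Proof. rewrite <- cS_false. now destruct (cS T i j k). Qed.

(* [p] is the graph of a finite partial map from the copy, whose elements so
   far are those below [N], to a structure with diagram [d]. *)
Definition good (d : nat -> bool) (N : nat) (T : list triple) (p : list (nat * nat)) : bool :=
  forallb (fun u => (fst u <? N) && d (dDom (snd u)) && forallb (fun v =>
      Bool.eqb (fst u =? fst v) (snd u =? snd v)
      && implb (d (dMem (snd u) (snd v))) (forallb (fun c => cS T (fst u) (fst v) c) (seq 0 N))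
      && forallb (fun w => Bool.eqb (d (dS (snd u) (snd v) (snd w)))
                             (cS T (fst u) (fst v) (fst w))) p) p) p.

Lemma good_spec d N T p :
  good d N T p = true <->
  forall u, In u p -> fst u < N /\ d (dDom (snd u)) = true /\ forall v, In v p ->
    (fst u = fst v <-> snd u = snd v)
    /\ (d (dMem (snd u) (snd v)) = true -> forall c, c < N -> cS T (fst u) (fst v) c = true)
    /\ forall w, In w p -> d (dS (snd u) (snd v) (snd w)) = cS T (fst u) (fst v) (fst w).
Proof.
  assert (E : forall a b c e, Bool.eqb (a =? b) (c =? e) = true <-> (a = b <-> c = e)).
  { intros a b c e. rewrite eqb_true_iff.
    destruct (Nat.eqb_spec a b), (Nat.eqb_spec c e); intuition congruence. }
  unfold good. rewrite forallb_forall. split.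
  - intros H u Hu. specialize (H u Hu). rewrite !andb_true_iff, Nat.ltb_lt, forallb_forall in H.
    destruct H as [[H1 H2] H]. split; [assumption|]. split; [assumption|].
    intros v Hv. specialize (H v Hv).
    rewrite !andb_true_iff, E, implb_true_iff, !forallb_forall in H.
    destruct H as [[H3 H4] H5]. split; [assumption|]. split.
    + intros Hm c Hc. apply H4; [assumption|]. apply in_seq. lia.
    + intros w Hw. now apply eqb_true_iff, H5.
  - intros H u Hu. destruct (H u Hu) as (H1 & H2 & H3).
    rewrite !andb_true_iff, Nat.ltb_lt, forallb_forall. split; [now split|].
    intros v Hv. destruct (H3 v Hv) as (H4 & H5 & H6).
    rewrite !andb_true_iff, E, implb_true_iff, !forallb_forall.
    split; [split; [assumption|]|].
    + intros Hm c Hc. apply in_seq in Hc. apply H5; [assumption|lia].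
    + intros w Hw. now apply eqb_true_iff, H6.
Qed.

Definition in_dom (i : nat) (p : list (nat * nat)) : bool := existsb (fun u => fst u =? i) p.
Definition in_ran (x : nat) (p : list (nat * nat)) : bool := existsb (fun u => snd u =? x) p.

Lemma in_dom_spec i p : in_dom i p = true <-> exists x, In (i, x) p.
Proof.
  unfold in_dom. rewrite existsb_exists. split.
  - intros ([j x] & H & E). apply Nat.eqb_eq in E as <-. eauto.
  - intros [x H]. exists (i, x). split; [assumption|apply Nat.eqb_refl].
Qed.

Lemma in_ran_spec x p : in_ran x p = true <-> exists i, In (i, x) p.
Proof.
  unfold in_ran. rewrite existsb_exists. split.
  - intros ([i y] & H & E). apply Nat.eqb_eq in E as <-. eauto.
  - intros [i H]. exists (i, x). split; [assumption|apply Nat.eqb_refl].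
Qed.

(** Only triples through the new point [s] are collected, so that nothing already decided about the
    copy is ever revised. *)
Definition new_false (d : nat -> bool) (s : nat) (p : list (nat * nat)) : list triple :=
  flat_map (fun u => flat_map (fun v => flat_map (fun w =>
    if ((fst u =? s) || (fst v =? s) || (fst w =? s)) && negb (d (dS (snd u) (snd v) (snd w)))
    then [(fst u, (fst v, fst w))] else []) p) p) p.

Lemma In_new_false d s p i j k :
  In (i, (j, k)) (new_false d s p) <->
  exists x y z, In (i, x) p /\ In (j, y) p /\ In (k, z) p
    /\ (i = s \/ j = s \/ k = s) /\ d (dS x y z) = false.
Proof.
  unfold new_false. rewrite in_flat_map. split.
  - intros ([i' x] & Hu & H). apply in_flat_map in H as ([j' y] & Hv & H).
    apply in_flat_map in H as ([k' z] & Hw & H). simpl in H.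
    destruct (((i' =? s) || (j' =? s) || (k' =? s)) && negb (d (dS x y z))) eqn:E;
      [|contradiction].
    destruct H as [[= <- <- <-]|[]].
    rewrite andb_true_iff, !orb_true_iff, !Nat.eqb_eq, negb_true_iff in E.
    exists x, y, z. tauto.
  - intros (x & y & z & Hu & Hv & Hw & Hs & Hd).
    exists (i, x). split; [assumption|]. apply in_flat_map. exists (j, y). split; [assumption|].
    apply in_flat_map. exists (k, z). split; [assumption|]. simpl.
    replace (((i =? s) || (j =? s) || (k =? s)) && negb (d (dS x y z))) with true; [now left|].
    symmetry. rewrite andb_true_iff, !orb_true_iff, !Nat.eqb_eq, negb_true_iff. tauto.
Qed.

(* A running computation [(true, (p, T))] extends the partial map [p]; a
   stopped one is [(false, (p, T))] with [T] describing the next stage. *)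
Definition state : Type := bool * (list (nat * nat) * list triple).

(** [search] returns its bound [s] on failure. The run then stops with [T] unchanged, so that S
    holds at every triple through the new point [s]. *)
Definition require_dom (d : nat -> bool) (s : nat) (T : list triple) (e : nat) (st : state) : state :=
  let p := fst (snd st) in
  let x := search (fun x => good d s T ((e, x) :: p)) s in
  if negb (fst st) || in_dom e p then st
  else (x <? s, (if x <? s then (e, x) :: p else p, T)).

(** When no preimage is found, [s] is offered as one; [p] itself is left alone, as the next stage
    finds [s] by its own search. The final test guards against an inconsistent guess: if the
    enlarged map is not good, the new point satisfies S everywhere. *)
Definition require_ran (d : nat -> bool) (s : nat) (T : list triple) (e : nat) (st : state) : state :=
  let p := fst (snd st) in
  let i := search (fun i => good d s T ((i, e) :: p)) s in
  let T' := new_false d s ((s, e) :: p) ++ T in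
  if negb (fst st) || negb (d (dDom e)) || in_ran e p then st
  else if i <? s then (true, ((i, e) :: p, T))
  else (false, (p, if good d (S s) T' ((s, e) :: p) then T' else T)).

Definition run (d : nat -> bool) (s : nat) (T : list triple) (k : nat) : state :=
  nat_rect (fun _ => state) (true, ([], T))
    (fun e st => require_ran d s T e (require_dom d s T e st)) k.

Definition stage (d : nat -> bool) (s : nat) (T : list triple) : list triple :=
  snd (snd (run d s T s)).

Definition history (a : nat -> nat -> bool) (n : nat) : list triple :=
  nat_rect (fun _ => list triple) [] (fun s T => stage (a s) s T) n.

(** * Computability of the construction *)

Lemma comp_diagram {A B : Type} `{Enc A} `{Enc B} (d : A -> nat -> bool)
  (f : B -> A) (n : B -> nat) :
  comp (fun p : A * nat => d (fst p) (snd p)) -> comp f -> comp n ->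
  comp (fun b => d (f b) (n b)).
Proof.
  intros Hd Hf Hn.
  apply (comp_comp (fun p : A * nat => d (fst p) (snd p)) (fun b => (f b, n b)));
    [assumption|comp_tac].
Qed.

Ltac comp_user ::=
  lazymatch goal with
  | _ : comp (fun p => ?d (fst p) (snd p)) |- comp (fun a => ?d (@?f a) (@?n a)) =>
      apply (comp_diagram d f n)
  | _ : comp ?g |- comp (fun a => ?g (@?f a)) => apply (comp_comp g f)
  end.

Lemma comp_good {A : Type} `{Enc A} (d : A -> nat -> bool) (s : A -> nat)
  (T : A -> list triple) (p : A -> list (nat * nat)) :
  comp (fun q : A * nat => d (fst q) (snd q)) -> comp s -> comp T -> comp p ->
  comp (fun a => good (d a) (s a) (T a) (p a)).
Proof. intros Hd Hs HT Hp. unfold good, cS, dDom, dMem, dS. comp_tac. Qed.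

Lemma comp_new_false {A : Type} `{Enc A} (d : A -> nat -> bool) (s : A -> nat)
  (p : A -> list (nat * nat)) :
  comp (fun q : A * nat => d (fst q) (snd q)) -> comp s -> comp p ->
  comp (fun a => new_false (d a) (s a) (p a)).
Proof. intros Hd Hs Hp. unfold new_false, dS. comp_tac. Qed.

Ltac comp_user ::=
  lazymatch goal with
  | |- comp (fun a => good (@?d a) (@?s a) (@?T a) (@?p a)) => apply (comp_good d s T p)
  | |- comp (fun a => new_false (@?d a) (@?s a) (@?p a)) => apply (comp_new_false d s p)
  | _ : comp (fun p => ?d (fst p) (snd p)) |- comp (fun a => ?d (@?f a) (@?n a)) =>
      apply (comp_diagram d f n)
  | _ : comp ?g |- comp (fun a => ?g (@?f a)) => apply (comp_comp g f)
  end.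

Lemma comp_require_dom {A : Type} `{Enc A} (d : A -> nat -> bool) (s : A -> nat)
  (T : A -> list triple) (e : A -> nat) (st : A -> state) :
  comp (fun q : A * nat => d (fst q) (snd q)) -> comp s -> comp T -> comp e -> comp st ->
  comp (fun a => require_dom (d a) (s a) (T a) (e a) (st a)).
Proof. intros Hd Hs HT He Hst. unfold require_dom, in_dom. cbv zeta. comp_tac. Qed.

Lemma comp_require_ran {A : Type} `{Enc A} (d : A -> nat -> bool) (s : A -> nat)
  (T : A -> list triple) (e : A -> nat) (st : A -> state) :
  comp (fun q : A * nat => d (fst q) (snd q)) -> comp s -> comp T -> comp e -> comp st ->
  comp (fun a => require_ran (d a) (s a) (T a) (e a) (st a)).
Proof. intros Hd Hs HT He Hst. unfold require_ran, in_ran, dDom. cbv zeta. comp_tac. Qed.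

Lemma comp_history (a : nat -> nat -> bool) :
  comp (fun p : nat * nat => a (fst p) (snd p)) -> comp (history a).
Proof.
  intro Ha. unfold history.
  apply (comp_natrec (fun _ => []) (fun _ s T => stage (a s) s T)); [comp_tac| |comp_tac].
  unfold stage, run. do 2 apply comp_snd.
  apply (comp_natrec (fun p : nat * (nat * list triple) => (true, ([], snd (snd p))))
    (fun p e st => require_ran (a (fst (snd p))) (fst (snd p)) (snd (snd p)) e
       (require_dom (a (fst (snd p))) (fst (snd p)) (snd (snd p)) e st))
    (fun p => fst (snd p))); [comp_tac| |comp_tac].
  apply (comp_require_ran
    (fun q : (nat * (nat * list triple)) * (nat * state) => a (fst (snd (fst q))))
    (fun q => fst (snd (fst q))) (fun q => snd (snd (fst q))) (fun q => fst (snd q))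
    (fun q => require_dom (a (fst (snd (fst q)))) (fst (snd (fst q))) (snd (snd (fst q)))
       (fst (snd q)) (snd (snd q)))); comp_tac.
  apply (comp_require_dom
    (fun q : (nat * (nat * list triple)) * (nat * state) => a (fst (snd (fst q))))
    (fun q => fst (snd (fst q))) (fun q => snd (snd (fst q))) (fun q => fst (snd q))
    (fun q => snd (snd q))); comp_tac.
Qed.

(** ** Invariants *)

Lemma good_incl d N T p p' : incl p p' -> good d N T p' = true -> good d N T p = true.
Proof.
  rewrite !good_spec. intros HI H u Hu. destruct (H u (HI _ Hu)) as (H1 & H2 & H3).
  split; [assumption|]. split; [assumption|]. intros v Hv.
  destruct (H3 v (HI _ Hv)) as (H4 & H5 & H6). repeat split; auto; now apply H4.
Qed.

Definition bounded_triples (s : nat) (T : list triple) : Prop :=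
  forall i j k, In (i, (j, k)) T -> i < s /\ j < s /\ k < s.

Lemma bounded_triples_S s T : bounded_triples s T -> bounded_triples (S s) T.
Proof. intros H i j k Hin. destruct (H _ _ _ Hin) as (? & ? & ?). lia. Qed.

Lemma good_S d s T p :
  bounded_triples s T -> good d s T p = true -> good d (S s) T p = true.
Proof.
  intro HB. rewrite !good_spec. intros H u Hu. destruct (H u Hu) as (H1 & H2 & H3).
  split; [lia|]. split; [assumption|]. intros v Hv. destruct (H3 v Hv) as (H4 & H5 & H6).
  split; [assumption|]. split; [|assumption]. intros Hm c Hc.
  destruct (Nat.eq_dec c s) as [->|]; [|apply H5; [assumption|lia]].
  apply cS_true. intro Hin. destruct (HB _ _ _ Hin) as (_ & _ & ?). lia.
Qed.

(* What a later state [st] of a computation that has reached [p] satisfies. *)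
Definition continues (d : nat -> bool) (s : nat) (T : list triple)
  (p : list (nat * nat)) (st : state) : Prop :=
  if fst st
  then incl p (fst (snd st)) /\ snd (snd st) = T /\ good d s T (fst (snd st)) = true
  else good d (S s) (snd (snd st)) p = true.

Lemma require_dom_continues d s T p e st :
  bounded_triples s T -> continues d s T p st -> continues d s T p (require_dom d s T e st).
Proof.
  intros HB Hst. unfold require_dom. destruct st as [[] [p' T']]; simpl; [|assumption].
  destruct (in_dom e p'); simpl; [assumption|]. destruct Hst as (HI & HT & HG). simpl in *.
  destruct (search_spec (fun x => good d s T ((e, x) :: p')) s) as (_ & _ & HS).
  destruct (Nat.ltb_spec (search (fun x => good d s T ((e, x) :: p')) s) s) as [Hlt|Hge].
  - repeat split; simpl; auto. now apply incl_tl.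
  - unfold continues. simpl. apply good_S; [assumption|]. eapply good_incl; eassumption.
Qed.

Lemma require_ran_continues d s T p e st :
  bounded_triples s T -> continues d s T p st -> continues d s T p (require_ran d s T e st).
Proof.
  intros HB Hst. unfold require_ran. destruct st as [[] [p' T']]; simpl; [|assumption].
  destruct (negb (d (dDom e)) || in_ran e p'); simpl; [assumption|].
  destruct Hst as (HI & HT & HG). simpl in *.
  destruct (search_spec (fun i => good d s T ((i, e) :: p')) s) as (_ & _ & HS).
  destruct (Nat.ltb_spec (search (fun i => good d s T ((i, e) :: p')) s) s) as [Hlt|Hge].
  - repeat split; simpl; auto. now apply incl_tl.
  - unfold continues. simpl. destruct (good d (S s) _ ((s, e) :: p')) eqn:E.
    + eapply good_incl; [|exact E]. now apply incl_tl.
    + apply good_S; [assumption|]. eapply good_incl; eassumption.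
Qed.

Lemma run_continues_from d s T k p T' m :
  bounded_triples s T -> run d s T k = (true, (p, T')) -> k <= m ->
  continues d s T p (run d s T m).
Proof.
  intros HB. revert p T'.
  (* [K] presupposes that the map reached is good. Applied to the empty map at [k = 0], it yields
     exactly this for every map that is reached. *)
  assert (K : forall k p T', run d s T k = (true, (p, T')) -> good d s T p = true /\ T' = T ->
    forall m, k <= m -> continues d s T p (run d s T m)).
  { intros k' p T' Hk [HG ->] m' Hm. induction Hm as [|m' Hm IH].
    - rewrite Hk. repeat split; [apply incl_refl|assumption].
    - change (run d s T (S m')) with (require_ran d s T m' (require_dom d s T m' (run d s T m'))).
      now apply require_ran_continues, require_dom_continues. }
  intros p T' Hk Hm. apply (K k p T' Hk); [|assumption].
  assert (H : continues d s T [] (run d s T k)).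
  { apply (K 0 [] T eq_refl); [now split|lia]. }
  rewrite Hk in H. destruct H as (_ & HT & HG). now split.
Qed.

Lemma run_good d s T k p T' :
  bounded_triples s T -> run d s T k = (true, (p, T')) -> good d s T p = true /\ T' = T.
Proof.
  intros HB Hk. pose proof (run_continues_from _ _ _ _ _ _ _ HB Hk (le_n k)) as H.
  rewrite Hk in H. destruct H as (_ & HT & HG). now split.
Qed.

(** A failing requirement either leaves [T] as it is or installs a type that was tested together
    with the current map. This keeps a preimage alive from one stage to the next. *)
Lemma stage_good d s T k p T' :
  bounded_triples s T -> k <= s -> run d s T k = (true, (p, T')) ->
  good d (S s) (stage d s T) p = true.
Proof.
  intros HB Hks Hk. pose proof (run_continues_from _ _ _ _ _ _ _ HB Hk Hks) as H.
  unfold stage, continues in *. destruct (run d s T s) as [[] [p' T'']]; [|assumption].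
  destruct H as (HI & HT & HG). simpl in *. rewrite HT. apply good_S; [assumption|].
  eapply good_incl; eassumption.
Qed.

Definition extends_by (s : nat) (T T' : list triple) : Prop :=
  incl T T' /\ bounded_triples (S s) T'
  /\ forall i j k, In (i, (j, k)) T' -> In (i, (j, k)) T \/ i = s \/ j = s \/ k = s.

Lemma run_extends d s T k :
  bounded_triples s T -> extends_by s T (snd (snd (run d s T k))).
Proof.
  intro HB. assert (H0 : extends_by s T T).
  { split; [apply incl_refl|]. split; [now apply bounded_triples_S|]. auto. }
  induction k as [|k IH]; [exact H0|].
  change (run d s T (S k)) with (require_ran d s T k (require_dom d s T k (run d s T k))).
  destruct (run d s T k) as [b [p T1]]. simpl in IH.
  assert (IH' : extends_by s T (snd (snd (require_dom d s T k (b, (p, T1)))))).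
  { unfold require_dom. destruct (_ || _); simpl; assumption. }
  destruct (require_dom d s T k (b, (p, T1))) as [b' [p' T2]]. simpl in IH'.
  unfold require_ran. destruct (_ || _); simpl; [assumption|].
  destruct (_ <? _); simpl; [assumption|].
  destruct (good d (S s) _ ((s, k) :: p')) eqn:E; [|assumption].
  rewrite good_spec in E. split; [apply incl_appr, incl_refl|]. split.
  - intros i j l Hin. apply in_app_or in Hin as [Hin|Hin].
    + apply In_new_false in Hin as (x & y & z & Hx & Hy & Hz & _).
      apply E in Hx as [Hx _]. apply E in Hy as [Hy _]. apply E in Hz as [Hz _]. now repeat split.
    + now apply (bounded_triples_S _ _ HB).
  - intros i j l Hin. apply in_app_or in Hin as [Hin|Hin]; [right|now left].
    now apply In_new_false in Hin as (x & y & z & _ & _ & _ & Hs & _).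
Qed.

Section Limit.
Variable a : nat -> nat -> bool.
Let T := history a.

Lemma history_bounded s : bounded_triples s (T s).
Proof.
  induction s as [|s IH]; [intros i j k []|]. apply (run_extends (a s) s (T s) s IH).
Qed.

Lemma cS_history_S s i j k :
  i < s -> j < s -> k < s -> cS (T (S s)) i j k = cS (T s) i j k.
Proof.
  intros Hi Hj Hk.
  destruct (run_extends (a s) s (T s) s (history_bounded s)) as (H1 & _ & H2).
  apply eq_true_iff_eq. rewrite !cS_true. apply not_iff_compat. split; intro H.
  - apply H2 in H as [H|H]; [assumption|lia].
  - now apply H1.
Qed.

(** A triple is decided for good once its three points are present; stage [S (i + j + k)] is a
    computable bound for that. *)
Definition limS (i j k : nat) : bool := cS (T (S (i + j + k))) i j k.

Lemma cS_history s i j k : i < s -> j < s -> k < s -> cS (T s) i j k = limS i j k.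
Proof.
  intros Hi Hj Hk. unfold limS.
  assert (K : forall m n, m <= n -> i < m -> j < m -> k < m -> cS (T n) i j k = cS (T m) i j k).
  { intros m n Hmn ? ? ?. induction Hmn as [|n Hmn IH]; [reflexivity|].
    rewrite cS_history_S by lia. exact IH. }
  destruct (Nat.le_ge_cases s (S (i + j + k))); [symmetry|]; apply K; lia.
Qed.

(** The condition on memberships ranges over all points of the copy, so a larger copy can only
    destroy goodness. The converse fails: the new point may falsify S at two indices whose values
    are in membership. *)
Lemma good_antitone d s p :
  (forall u, In u p -> fst u < s) ->
  good d (S s) (T (S s)) p = true -> good d s (T s) p = true.
Proof.
  intro Hlt. rewrite !good_spec. intros H u Hu. destruct (H u Hu) as (H1 & H2 & H3).
  split; [auto|]. split; [assumption|]. intros v Hv. destruct (H3 v Hv) as (H4 & H5 & H6).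
  split; [assumption|]. split.
  - intros Hm c Hc. rewrite <- cS_history_S by auto. auto.
  - intros w Hw. rewrite <- cS_history_S by auto. auto.
Qed.

End Limit.

(** ** Convergence *)

Definition mem_implies_S (D : both_structure) : Prop :=
  forall x y z, bdom D x -> bdom D y -> bdom D z -> bmem D x y -> bS D x y z.

Definition or_new {A : Type} (w : A) (o : option A) : A := match o with Some x => x | None => w end.

(* [None] stands for the new point of a one-point type over the list [l]. *)
Definition extension_property (D : both_structure) : Prop :=
  forall (l : list nat) (tau : option nat -> option nat -> option nat -> Prop),
    (forall x, In x l -> bdom D x) ->
    (forall x y, In x l -> In y l -> bmem D x y -> tau (Some x) (Some y) None) ->
    exists w, bdom D w /\ ~ In w l
      /\ (forall x, In x (w :: l) -> ~ bmem D x w /\ ~ bmem D w x)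
      /\ forall x y z,
           (forall v, Some v = x \/ Some v = y \/ Some v = z -> In v l) ->
           x = None \/ y = None \/ z = None ->
           (bS D (or_new w x) (or_new w y) (or_new w z) <-> tau x y z).

Definition agree (d d' : nat -> bool) (l : list nat) : Prop :=
  forall x, In x l -> d (dDom x) = d' (dDom x)
  /\ forall y, In y l -> d (dMem x y) = d' (dMem x y)
  /\ forall z, In z l -> d (dS x y z) = d' (dS x y z).

Lemma agree_sym d d' l : agree d d' l -> agree d' d l.
Proof.
  intros H x Hx. destruct (H x Hx) as [H1 H2]. split; [auto|].
  intros y Hy. destruct (H2 y Hy) as [H3 H4]. split; [auto|].
  intros z Hz. symmetry. auto.
Qed.

Lemma agree_trans d d' d'' l : agree d d' l -> agree d' d'' l -> agree d d'' l.
Proof.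
  intros H G x Hx. destruct (H x Hx) as [H1 H2]. destruct (G x Hx) as [G1 G2].
  split; [congruence|].
  intros y Hy. destruct (H2 y Hy) as [H3 H4]. destruct (G2 y Hy) as [G3 G4].
  split; [congruence|]. intros z Hz. rewrite H4, G4; auto.
Qed.

Lemma agree_incl d d' l l' : incl l l' -> agree d d' l' -> agree d d' l.
Proof.
  intros HI H x Hx. destruct (H x (HI _ Hx)) as [H1 H2]. split; [assumption|].
  intros y Hy. destruct (H2 y (HI _ Hy)) as [H3 H4]. split; [assumption|]. auto.
Qed.

Lemma good_agree d d' N T p :
  agree d d' (map snd p) -> good d N T p = true -> good d' N T p = true.
Proof.
  intro HA. rewrite !good_spec. intros H u Hu. destruct (H u Hu) as (H1 & H2 & H3).
  destruct (HA _ (in_map snd _ _ Hu)) as [A1 A2].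
  split; [assumption|]. split; [congruence|]. intros v Hv. destruct (H3 v Hv) as (H4 & H5 & H6).
  destruct (A2 _ (in_map snd _ _ Hv)) as [A3 A4].
  split; [assumption|]. split; [rewrite <- A3; assumption|].
  intros w Hw. rewrite <- A4 by now apply in_map. auto.
Qed.

(* Adding to the copy the element [s] with the type of [e]. *)
Lemma new_false_good d s T p e :
  bounded_triples s T -> good d s T p = true -> d (dDom e) = true -> in_ran e p = false ->
  (forall x y z, In x (e :: map snd p) -> In y (e :: map snd p) -> In z (e :: map snd p) ->
     d (dMem x y) = true -> d (dS x y z) = true) ->
  good d (S s) (new_false d s ((s, e) :: p) ++ T) ((s, e) :: p) = true.
Proof.
  intros HB HG He Hr HM. rewrite good_spec in *. apply not_true_iff_false in Hr.
  rewrite in_ran_spec in Hr.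
  assert (Hp : forall u, In u ((s, e) :: p) ->
    u = (s, e) \/ (In u p /\ fst u < s /\ snd u <> e)).
  { intros u [<-|Hu]; [now left|]. right. split; [assumption|]. split; [now apply HG|].
    intros <-. apply Hr. exists (fst u). now destruct u. }
  assert (Hsnd : forall u, In u ((s, e) :: p) -> In (snd u) (e :: map snd p)).
  { intros u Hu. exact (in_map snd _ _ Hu). }
  assert (Hinj : forall u v, In u ((s, e) :: p) -> In v ((s, e) :: p) ->
    (fst u = fst v <-> snd u = snd v)).
  { intros u v Hu Hv. destruct (Hp u Hu) as [->|(Hu1 & Hu2 & Hu3)],
      (Hp v Hv) as [->|(Hv1 & Hv2 & Hv3)]; simpl.
    - tauto.
    - split; [lia|congruence].
    - split; [lia|congruence].
    - destruct (HG u Hu1) as (_ & _ & H). now apply H. }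
  (* [new_false] records indices only; since the map is single-valued, they determine the values
     behind them. *)
  assert (Hnew : forall u v w, In u ((s, e) :: p) -> In v ((s, e) :: p) -> In w ((s, e) :: p) ->
    In (fst u, (fst v, fst w)) (new_false d s ((s, e) :: p)) ->
    d (dS (snd u) (snd v) (snd w)) = false).
  { intros u v w Hu Hv Hw H. apply In_new_false in H as (x & y & z & Hx & Hy & Hz & _ & Hd).
    assert (E1 : snd u = x) by exact (proj1 (Hinj u (fst u, x) Hu Hx) eq_refl).
    assert (E2 : snd v = y) by exact (proj1 (Hinj v (fst v, y) Hv Hy) eq_refl).
    assert (E3 : snd w = z) by exact (proj1 (Hinj w (fst w, z) Hw Hz) eq_refl).
    now rewrite E1, E2, E3. }
  intros u Hu. split; [destruct (Hp u Hu) as [->|(_ & ? & _)]; simpl; lia|].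
  split; [destruct (Hp u Hu) as [->|(Hu1 & _)]; [assumption|now apply HG]|].
  intros v Hv. split; [now apply Hinj|]. split.
  (* A triple listed as new has all its indices in the domain of the map, so [c] has a value [z],
     and [HM] contradicts the failure of S there. Old triples avoid [s] and are governed by the
     goodness of [p]. *)
  - intros Hm c Hc. apply cS_true. intro H. apply in_app_or in H as [H|H].
    + apply In_new_false in H as (x & y & z & Hx & Hy & Hz & _ & Hd).
      assert (E1 : snd u = x) by exact (proj1 (Hinj u (fst u, x) Hu Hx) eq_refl).
      assert (E2 : snd v = y) by exact (proj1 (Hinj v (fst v, y) Hv Hy) eq_refl).
      rewrite <- E1, <- E2, HM in Hd; [discriminate|now apply Hsnd|now apply Hsnd| |assumption].
      exact (Hsnd _ Hz).
    + destruct (HB _ _ _ H) as (B1 & B2 & B3).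
      destruct (Hp u Hu) as [->|(Hu1 & _)]; [simpl in B1; lia|].
      destruct (Hp v Hv) as [->|(Hv1 & _)]; [simpl in B2; lia|].
      destruct (HG u Hu1) as (_ & _ & G). destruct (G v Hv1) as (_ & G2 & _).
      now apply (proj1 (cS_true _ _ _ _) (G2 Hm c B3)).
  - intros w Hw. destruct (d (dS (snd u) (snd v) (snd w))) eqn:Ed; symmetry.
    + apply cS_true. intro H. apply in_app_or in H as [H|H].
      * rewrite (Hnew u v w) in Ed by assumption. discriminate.
      * destruct (HB _ _ _ H) as (B1 & B2 & B3).
        destruct (Hp u Hu) as [->|(Hu1 & _)]; [simpl in B1; lia|].
        destruct (Hp v Hv) as [->|(Hv1 & _)]; [simpl in B2; lia|].
        destruct (Hp w Hw) as [->|(Hw1 & _)]; [simpl in B3; lia|].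
        destruct (HG u Hu1) as (_ & _ & G). destruct (G v Hv1) as (_ & _ & G3).
        rewrite (G3 w Hw1) in Ed. now apply (proj1 (cS_true _ _ _ _) Ed).
    + apply cS_false, in_or_app.
      destruct (Hp u Hu) as [Eu|(Hu1 & Hu2 & _)]; [left|];
        [|destruct (Hp v Hv) as [Ev|(Hv1 & Hv2 & _)]; [left|];
          [|destruct (Hp w Hw) as [Ew|(Hw1 & Hw2 & _)]; [left|right]]].
      1-3: apply In_new_false; exists (snd u), (snd v), (snd w);
        rewrite <- !surjective_pairing; repeat split; try assumption.
      * left. now rewrite Eu.
      * right. left. now rewrite Ev.
      * right. right. now rewrite Ew.
      * destruct (HG u Hu1) as (_ & _ & G). destruct (G v Hv1) as (_ & _ & G3).
        apply cS_false. rewrite <- (G3 w Hw1). assumption.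
Qed.

Section Convergence.
Variable D : both_structure.
Variable a : nat -> nat -> bool.
Hypothesis a_limit : forall n, eventually (fun s => a s n = true <-> both_diagram D n).
Hypothesis D_mem_S : mem_implies_S D.
Hypothesis D_ext : extension_property D.

Let T := history a.
Let C := limS a.

Definition truth (n : nat) : bool :=
  if excluded_middle_informative (both_diagram D n) then true else false.

Lemma truth_spec n : truth n = true <-> both_diagram D n.
Proof. unfold truth. now destruct (excluded_middle_informative (both_diagram D n)). Qed.

Lemma eventually_agree l : eventually (fun s => agree (a s) truth l).
Proof.
  assert (L : forall n, eventually (fun s => a s n = truth n)).
  { intro n. generalize (a_limit n). apply eventually_mono. intros s Hs.
    apply eq_true_iff_eq. now rewrite truth_spec. }
  unfold agree. apply eventually_all_in. intros x _. apply eventually_and; [apply L|].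
  apply eventually_all_in. intros y _. apply eventually_and; [apply L|].
  apply eventually_all_in. intros z _. apply L.
Qed.

(** The limit form of [good]: the guess is replaced by D, and [c] ranges over the whole copy,
    including points that are added later. *)
Definition partial_iso (p : list (nat * nat)) : Prop :=
  forall u, In u p -> bdom D (snd u) /\ forall v, In v p ->
    (fst u = fst v <-> snd u = snd v)
    /\ (bmem D (snd u) (snd v) -> forall c, C (fst u) (fst v) c = true)
    /\ forall w, In w p -> (bS D (snd u) (snd v) (snd w) <-> C (fst u) (fst v) (fst w) = true).

Lemma fst_below (p : list (nat * nat)) :
  eventually (fun s => forall u, In u p -> fst u < s).
Proof. apply eventually_all_in. intros u _. exists (S (fst u)). lia. Qed.

Lemma eventually_good p :
  partial_iso p -> eventually (fun s => good truth s (T s) p = true).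
Proof.
  intro H. generalize (fst_below p). apply eventually_mono. intros s Hs.
  apply good_spec. intros u Hu. destruct (H u Hu) as [H1 H2].
  split; [auto|]. split; [now apply truth_spec, both_diagram_dom|].
  intros v Hv. destruct (H2 v Hv) as (H3 & H4 & H5). destruct (H v Hv) as [H6 _].
  split; [assumption|]. split.
  - rewrite truth_spec, both_diagram_mem by assumption. intros Hm c Hc.
    unfold T. rewrite cS_history by auto. now apply H4.
  - intros w Hw. destruct (H w Hw) as [H7 _]. apply eq_true_iff_eq.
    rewrite truth_spec, both_diagram_S by assumption.
    unfold T. rewrite cS_history by auto. now apply H5.
Qed.

(** Goodness at stage [s] speaks of [c < s] only; arbitrarily late stages are what gives the
    condition for all [c]. *)
Lemma good_partial_iso p :
  (forall n, exists s, n <= s /\ good truth s (T s) p = true) -> partial_iso p.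
Proof.
  intro H. assert (Hb : forall u, In u p -> bdom D (snd u)).
  { intros u Hu. destruct (H 0) as (s & _ & Hs). rewrite good_spec in Hs.
    now apply both_diagram_dom, truth_spec, Hs. }
  intros u Hu. split; [auto|]. intros v Hv. split; [|split].
  - destruct (H 0) as (s & _ & Hs). rewrite good_spec in Hs. now apply Hs.
  - intros Hm c. destruct (H (S c)) as (s & Hc & Hs). rewrite good_spec in Hs.
    unfold C. rewrite <- (cS_history a s); [|now apply Hs|now apply Hs|lia].
    destruct (Hs u Hu) as (_ & _ & H3). apply H3; [assumption| |lia].
    apply truth_spec, both_diagram_mem; auto.
  - intros w Hw. destruct (H 0) as (s & Hc & Hs). rewrite good_spec in Hs.
    unfold C. rewrite <- (cS_history a s); [|now apply Hs..].
    destruct (Hs u Hu) as (_ & _ & H3). destruct (H3 v Hv) as (_ & _ & H4).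
    fold T. rewrite <- (H4 w Hw), truth_spec, both_diagram_S; auto. tauto.
Qed.

Definition settles (f : nat -> state) (p : list (nat * nat)) : Prop :=
  eventually (fun s => f s = (true, (p, T s))).

Definition state_at (k s : nat) : state := run (a s) s (T s) k.
Definition mid_state_at (k s : nat) : state := require_dom (a s) s (T s) k (state_at k s).

Lemma settled_partial_iso k p : settles (state_at k) p -> partial_iso p.
Proof.
  intro H. destruct (eventually_and _ _ H (eventually_agree (map snd p))) as [n Hn].
  apply good_partial_iso. intro m. exists (n + m). split; [lia|].
  destruct (Hn (n + m)) as [Hs HA]; [lia|].
  apply (good_agree _ _ _ _ _ HA). eapply run_good; [apply history_bounded|exact Hs].
Qed.

Lemma eventually_decided (f : nat -> bool) :
  eventually (fun s => f (S s) = true -> f s = true) -> exists b, eventually (fun s => f s = b).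
Proof.
  intros [n Hn]. destruct (classic (exists m, n <= m /\ f m = false)) as [(m & Hm & Hf)|Hno].
  - exists false, m. intros s Hs. induction Hs as [|s Hs IH]; [assumption|].
    apply not_true_is_false. intro H. apply Hn in H; [congruence|lia].
  - exists true, n. intros s Hs. apply not_false_is_true. intro H. apply Hno. eauto.
Qed.

(** With [truth] in place of the guess, goodness can only be lost once all indices of [p] are
    present, so it is eventually constant. On the finitely many values of [p] the guesses finally
    agree with [truth]. *)
Lemma good_decided p : exists b, eventually (fun s => good (a s) s (T s) p = b).
Proof.
  destruct (eventually_decided (fun s => good truth s (T s) p)) as [b Hb].
  - generalize (fst_below p). apply eventually_mono. intros s Hs. now apply good_antitone.
  - exists b. generalize (eventually_and _ _ Hb (eventually_agree (map snd p))).
    apply eventually_mono. intros s [<- HA].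
    apply eq_true_iff_eq. split; apply good_agree; [assumption|now apply agree_sym].
Qed.

(** The type to be realized is that of [e] over the domain of [p], transferred to the values of [p].
    Its compatibility with membership is the clause of [partial_iso] on all [c], taken at [c = e].
    That clause survives the extension because [w] is in no membership with the values of [p] or
    with itself. *)
Lemma partial_iso_extend_dom p e :
  partial_iso p -> in_dom e p = false -> exists x, partial_iso ((e, x) :: p).
Proof.
  intros Hp He. apply not_true_iff_false in He. rewrite in_dom_spec in He.
  (* [ix] inverts [p] and sends the new point to [e]; the default 0 is met only outside the range of
     [p]. *)
  pose (ix o := match o with
    | None => e
    | Some x => match find (fun u => snd u =? x) p with Some u => fst u | None => 0 end
    end).
  assert (Hix : forall u, In u p -> ix (Some (snd u)) = fst u).
  { intros u Hu. simpl. destruct (find (fun v => snd v =? snd u) p) as [v|] eqn:E.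
    - apply find_some in E as [Hv E]. apply Nat.eqb_eq in E. now apply (Hp v Hv).
    - apply find_none with (x := u) in E; [|assumption]. now rewrite Nat.eqb_refl in E. }
  destruct (D_ext (map snd p) (fun x y z => C (ix x) (ix y) (ix z) = true))
    as (w & Hw & Hnew & Hm & HS).
  - intros x Hx. apply in_map_iff in Hx as (u & <- & Hu). now apply Hp.
  - intros x y Hx Hy Hxy. apply in_map_iff in Hx as (u & <- & Hu).
    apply in_map_iff in Hy as (v & <- & Hv). rewrite !Hix by assumption.
    destruct (Hp u Hu) as [_ H]. now apply H.
  - exists w.
    assert (Ho : forall u, In u ((e, w) :: p) -> exists o, or_new w o = snd u /\ ix o = fst u
      /\ (forall x, Some x = o -> In x (map snd p)) /\ (o = None \/ In u p)).
    { intros u [<-|Hu]; [exists None|exists (Some (snd u))].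
      - repeat split; [discriminate|now left].
      - repeat split; [now apply Hix| |now right]. intros x [= ->]. now apply in_map. }
    assert (Hne : forall u, In u p -> fst u <> e /\ snd u <> w).
    { intros u Hu. split; intros <-.
      - apply He. exists (snd u). now destruct u.
      - now apply Hnew, in_map. }
    intros u Hu. split; [destruct Hu as [<-|Hu]; [assumption|now apply Hp]|].
    intros v Hv. split; [|split].
    + destruct Hu as [<-|Hu], Hv as [<-|Hv]; simpl.
      * tauto.
      * destruct (Hne v Hv). split; congruence.
      * destruct (Hne u Hu). split; congruence.
      * now apply (Hp u Hu).
    + intros Huv. destruct Hv as [<-|Hv].
      { destruct (Hm (snd u) (in_map snd _ _ Hu)) as [N _]. now apply N in Huv. }
      destruct Hu as [<-|Hu].
      { destruct (Hm (snd v) (or_intror (in_map snd _ _ Hv))) as [_ N]. now apply N in Huv. }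
      destruct (Hp u Hu) as [_ H]. now apply H.
    + intros t Ht. destruct (classic (In u p /\ In v p /\ In t p)) as [(Pu & Pv & Pt)|Hno].
      { destruct (Hp u Pu) as [_ H]. now apply H. }
      destruct (Ho u Hu) as (ou & Eu & Fu & Iu & Nu). destruct (Ho v Hv) as (ov & Ev & Fv & Iv & Nv).
      destruct (Ho t Ht) as (ot & Et & Ft & It & Nt).
      rewrite <- Eu, <- Ev, <- Et, <- Fu, <- Fv, <- Ft.
      apply HS; [intros x [Hx|[Hx|Hx]]; auto|tauto].
Qed.

(** [Q] is the limit of the tests and singles out those [x] that continue [p] to a partial
    isomorphism. The extension property provides one, so [search_limit] makes the least of them the
    final choice. *)
Lemma require_dom_settles k p :
  settles (state_at k) p ->
  exists p', settles (mid_state_at k) p' /\ partial_iso p' /\ in_dom k p' = true.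
Proof.
  intro H. pose proof (settled_partial_iso _ _ H) as Hp.
  destruct (in_dom k p) eqn:Ek.
  - exists p. split; [|now split]. revert H. apply eventually_mono. intros s Hs.
    unfold mid_state_at, require_dom. rewrite Hs. simpl. now rewrite Ek.
  - assert (HQ : forall x, exists b, eventually (fun s => good (a s) s (T s) ((k, x) :: p) = b))
      by (intro x; apply good_decided).
    pose (Q x := proj1_sig (constructive_indefinite_description _ (HQ x))).
    assert (HQ' : forall x, eventually (fun s => good (a s) s (T s) ((k, x) :: p) = Q x))
      by (intro x; exact (proj2_sig (constructive_indefinite_description _ (HQ x)))).
    assert (Hgood : forall x, Q x = true <-> partial_iso ((k, x) :: p)).
    { intro x. pose proof (eventually_and _ _ (HQ' x) (eventually_agree (map snd ((k, x) :: p))))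
        as [n Hn]. split; intro Hx.
      - apply good_partial_iso. intro m. exists (n + m). split; [lia|].
        destruct (Hn (n + m)) as [H1 HA]; [lia|]. apply (good_agree _ _ _ _ _ HA). congruence.
      - destruct (eventually_good _ Hx) as [m Hm]. destruct (Hn (n + m)) as [<- HA]; [lia|].
        apply (good_agree _ _ _ _ _ (agree_sym _ _ _ HA)). apply Hm. lia. }
    destruct (partial_iso_extend_dom p k Hp Ek) as [x0 Hx0].
    destruct (search_limit (fun s x => good (a s) s (T s) ((k, x) :: p)) Q HQ')
      as (x & Hx & Hs); [exists x0; now apply Hgood|].
    exists ((k, x) :: p). split; [|split; [now apply Hgood|]].
    + assert (Hlt : eventually (fun s => x < s)) by (exists (S x); lia).
      generalize (eventually_and _ _ H (eventually_and _ _ Hs Hlt)).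
      apply eventually_mono. intros s (H1 & H2 & H3).
      unfold mid_state_at, require_dom. rewrite H1. simpl. rewrite Ek, H2.
      apply Nat.ltb_lt in H3. now rewrite H3.
    + apply in_dom_spec. exists x. now left.
Qed.

Lemma run_stopped d s U k m :
  fst (run d s U k) = false -> k <= m -> run d s U m = run d s U k.
Proof.
  intros Hk Hm. induction Hm as [|m Hm IH]; [reflexivity|].
  change (run d s U (S m)) with (require_ran d s U m (require_dom d s U m (run d s U m))).
  rewrite IH. destruct (run d s U k) as [[] st]; [discriminate|reflexivity].
Qed.

(** For [k] in D, once the guess is right on [k] and the values of [p], either a preimage is found
    or the stage makes its new point into one. Afterwards the least preimage is fixed: [stage_good]
    preserves it, and [good_antitone] keeps smaller candidates from becoming good. *)
Lemma require_ran_settles k p :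
  settles (mid_state_at k) p -> partial_iso p ->
  exists p', settles (state_at (S k)) p' /\ incl p p' /\ (bdom D k -> in_ran k p' = true).
Proof.
  intros H Hp.
  assert (HS : forall s, state_at (S k) s = require_ran (a s) s (T s) k (mid_state_at k s))
    by reflexivity.
  pose proof (eventually_agree (k :: map snd p)) as HA.
  destruct (classic (bdom D k)) as [Hk|Hk]; [destruct (in_ran k p) eqn:Er|].
  - exists p. split; [|split; [apply incl_refl|auto]]. revert H. apply eventually_mono.
    intros s Hs. rewrite HS, Hs. unfold require_ran. simpl. now rewrite Er, orb_true_r.
  - destruct (eventually_and _ _ H (eventually_and _ _ HA (eventually_and _ _
      (eventually_good p Hp) (ex_intro _ (S k) (fun s Hs => Hs) : eventually (fun s => k < s)))))
      as [n Hn].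
    assert (Hdk : forall s, n <= s -> a s (dDom k) = true).
    { intros s Hs. destruct (Hn s Hs) as (_ & A1 & _). destruct (A1 k (or_introl eq_refl)) as [-> _].
      now apply truth_spec, both_diagram_dom. }
    assert (HA2 : forall s i, n <= s -> agree (a s) (a (S s)) (map snd ((i, k) :: p))).
    { intros s i Hs. destruct (Hn s Hs) as (_ & A1 & _). destruct (Hn (S s)) as (_ & A2 & _); [lia|].
      exact (agree_trans _ _ _ _ A1 (agree_sym _ _ _ A2)). }
    assert (Hstep : forall s, n <= s -> let i := search (fun i => good (a s) s (T s) ((i, k) :: p)) s in
      i < s -> state_at (S k) s = (true, ((i, k) :: p, T s))).
    { intros s Hs i Hi. rewrite HS. destruct (Hn s Hs) as [-> _]. unfold require_ran. simpl.
      rewrite Er, (Hdk s Hs). simpl. fold i. apply Nat.ltb_lt in Hi. now rewrite Hi. }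
    assert (Hex : exists s i, n <= s /\ i < s /\ good (a s) s (T s) ((i, k) :: p) = true).
    { destruct (search_spec (fun i => good (a n) n (T n) ((i, k) :: p)) n) as (S1 & _ & S3).
      destruct (le_lt_eq_dec _ _ S1) as [Hlt|Heq]; [exists n; eauto|].
      exists (S n), n. split; [lia|]. split; [lia|].
      destruct (Hn n (le_n n)) as (H1 & A1 & H2 & H3).
      (* The guess at stage [n] is right on [k] and the values of [p], hence satisfies there that
         membership implies S; so the final test in [require_ran] succeeds. *)
      assert (G : good (a n) (S n) (new_false (a n) n ((n, k) :: p) ++ T n) ((n, k) :: p) = true).
      { apply new_false_good; [apply history_bounded| |auto|assumption|].
        - apply (good_agree truth); [|assumption]. apply agree_sym.
          revert A1. apply agree_incl. now apply incl_tl, incl_refl.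
        - assert (HD : forall x, In x (k :: map snd p) -> bdom D x).
          { intros x [<-|Hx]; [assumption|]. apply in_map_iff in Hx as (u & <- & Hu). now apply Hp. }
          intros x y z Hx Hy Hz. destruct (A1 x Hx) as [_ B1]. destruct (B1 y Hy) as [B2 B3].
          rewrite B2, (B3 z Hz), !truth_spec, both_diagram_mem, both_diagram_S by auto. auto. }
      apply (good_agree (a n)); [now apply HA2|].
      assert (Hst : run (a n) n (T n) (S k)
        = (false, (p, new_false (a n) n ((n, k) :: p) ++ T n))).
      { change (state_at (S k) n = (false, (p, new_false (a n) n ((n, k) :: p) ++ T n))).
        rewrite HS, H1. unfold require_ran. simpl fst. simpl snd. rewrite Er, (Hdk n (le_n n)), Heq, G.
        simpl. now rewrite Nat.ltb_irrefl. }
      (* Since [k < n], requirement [k] is treated within stage [n]; the run stops there and keeps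
         the new triples to the end of the stage. *)
      replace (T (S n)) with (new_false (a n) n ((n, k) :: p) ++ T n); [assumption|].
      change (T (S n)) with (snd (snd (run (a n) n (T n) n))).
      rewrite (run_stopped _ _ _ (S k) n); [now rewrite Hst|now rewrite Hst|lia]. }
    destruct Hex as (s0 & i0 & Hs0 & Hi0 & Hg0).
    set (srch s := search (fun i => good (a s) s (T s) ((i, k) :: p)) s) in *.
    (* The search bound grows with [s], but the least solution is already below [s0]; the induction
       shows that it survives each stage and that nothing smaller appears. *)
    assert (Hfix : forall s, s0 <= s -> srch s < s0 /\ srch s = srch s0).
    { intros s Hs. induction Hs as [|s Hs [IH1 IH2]].
      - split; [|reflexivity].
        destruct (search_spec (fun i => good (a s0) s0 (T s0) ((i, k) :: p)) s0) as (S1 & S2 & _).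
        fold (srch s0) in *. destruct (Nat.le_gt_cases s0 (srch s0)) as [Hge|]; [|assumption].
        rewrite S2 in Hg0; [discriminate|lia].
      - assert (E : srch (S s) = srch s); [|now rewrite E].
        pose proof (Hstep s ltac:(lia) ltac:(fold (srch s); lia)) as Hrun. fold (srch s) in Hrun.
        apply search_eq; [lia| |].
        + apply (good_agree (a s)); [apply HA2; lia|].
          destruct (Hn s) as (_ & _ & _ & Hks); [lia|].
          exact (stage_good _ _ _ (S k) _ _ (history_bounded a s) Hks Hrun).
        + intros j Hj. apply not_true_is_false. intro Hg.
          apply (good_agree _ _ _ _ _ (agree_sym _ _ _ (HA2 s j ltac:(lia)))) in Hg.
          apply good_antitone in Hg.
          * destruct (search_spec (fun i => good (a s) s (T s) ((i, k) :: p)) s) as (_ & S2 & _).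
            fold T in Hg. rewrite (S2 j Hj) in Hg. discriminate.
          * intros u [<-|Hu]; [simpl; lia|].
            destruct (Hn s) as (_ & _ & G & _); [lia|]. rewrite good_spec in G. now apply G. }
    exists ((srch s0, k) :: p). split; [|split; [now apply incl_tl, incl_refl|]].
    + exists s0. intros s Hs. destruct (Hfix s Hs) as [F1 F2]. rewrite <- F2.
      apply Hstep; [lia|]. fold (srch s). lia.
    + intros _. apply in_ran_spec. eexists. now left.
  - exists p. split; [|split; [apply incl_refl|contradiction]].
    generalize (eventually_and _ _ H HA). apply eventually_mono.
    intros s [Hs A1]. rewrite HS, Hs. unfold require_ran. simpl.
    destruct (A1 k (or_introl eq_refl)) as [-> _].
    replace (truth (dDom k)) with false; [reflexivity|]. symmetry.
    apply not_true_is_false. now rewrite truth_spec, both_diagram_dom.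
Qed.

Lemma state_at_settles k : exists p, settles (state_at k) p.
Proof.
  induction k as [|k [p Hp]]; [exists []; exists 0; reflexivity|].
  destruct (require_dom_settles k p Hp) as (p' & Hp' & HI & _).
  destruct (require_ran_settles k p' Hp' HI) as (p'' & Hp'' & _). eauto.
Qed.

Lemma settles_incl k m p p' :
  k <= m -> settles (state_at k) p -> settles (state_at m) p' -> incl p p'.
Proof.
  intros Hkm Hp Hp'. destruct (eventually_and _ _ Hp Hp') as [n Hn].
  destruct (Hn n (le_n n)) as [H1 H2].
  pose proof (run_continues_from _ _ _ _ _ _ m (history_bounded a n) H1 Hkm) as H.
  unfold state_at in H2. unfold continues in H. fold T in H. rewrite H2 in H. apply H.
Qed.

Lemma settled_requirements k :
  exists p, settles (state_at (S k)) p /\ in_dom k p = true /\ (bdom D k -> in_ran k p = true).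
Proof.
  destruct (state_at_settles k) as [p Hp].
  destruct (require_dom_settles k p Hp) as (p' & Hp' & HI & Hd).
  destruct (require_ran_settles k p' Hp' HI) as (p'' & Hp'' & Hincl & Hr).
  exists p''. split; [assumption|]. split; [|assumption].
  apply in_dom_spec in Hd as [x Hx]. apply in_dom_spec. eauto.
Qed.

Definition limit_copy : S_structure :=
  SStructure (fun _ => True) (fun i j k => C i j k = true) (ex_intro _ 0 I).

(** The settled maps form a chain by [settles_incl], and each is a partial isomorphism. Their union
    is total by the domain requirements and onto by the range requirements. *)
Lemma limit_copy_isomorphic : isomorphic limit_copy (reduct_S D).
Proof.
  pose (F i x := exists k p, settles (state_at k) p /\ In (i, x) p).
  assert (HF : forall i, exists x, F i x).
  { intro i. destruct (settled_requirements i) as (p & Hp & Hd & _).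
    apply in_dom_spec in Hd as [x Hx]. exists x, (S i), p. now split. }
  pose (f i := proj1_sig (constructive_indefinite_description _ (HF i))).
  assert (Hf : forall i, F i (f i))
    by (intro i; exact (proj2_sig (constructive_indefinite_description _ (HF i)))).
  assert (Hdir : forall i j k x y z, F i x -> F j y -> F k z ->
    exists p, partial_iso p /\ In (i, x) p /\ In (j, y) p /\ In (k, z) p).
  { intros i j k x y z (l & p & Hp & Hi) (m & p' & Hp' & Hj) (n & p'' & Hp'' & Hk).
    destruct (state_at_settles (l + m + n)) as [r Hr]. exists r.
    split; [exact (settled_partial_iso _ _ Hr)|]. repeat split.
    - apply (settles_incl l (l + m + n) p r); [lia|assumption..].
    - apply (settles_incl m (l + m + n) p' r); [lia|assumption..].
    - apply (settles_incl n (l + m + n) p'' r); [lia|assumption..]. }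
  exists f. split; [|split; [|split]].
  - intros i _. destruct (Hf i) as (k & p & Hp & Hi).
    exact (proj1 (settled_partial_iso _ _ Hp _ Hi)).
  - intros i j _ _ E. destruct (Hdir i j j _ _ _ (Hf i) (Hf j) (Hf j)) as (p & Hp & Hi & Hj & _).
    destruct (Hp _ Hi) as [_ H]. now apply (H _ Hj).
  - intros x Hx. destruct (settled_requirements x) as (p & Hp & _ & Hr).
    specialize (Hr Hx). apply in_ran_spec in Hr as [i Hi]. exists i. split; [exact I|].
    assert (Fi : F i x) by (exists (S x), p; now split).
    destruct (Hdir i i i _ _ _ (Hf i) Fi Fi) as (p' & Hp' & H1 & H2 & _).
    destruct (Hp' _ H1) as [_ H]. now apply (H _ H2).
  - intros i j k _ _ _.
    destruct (Hdir i j k _ _ _ (Hf i) (Hf j) (Hf k)) as (p & Hp & H1 & H2 & H3).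
    destruct (Hp _ H1) as [_ H]. destruct (H _ H2) as (_ & _ & H').
    symmetry. exact (H' _ H3).
Qed.

End Convergence.

Lemma limit_copy_computable a :
  comp (fun p : nat * nat => a (fst p) (snd p)) -> computable_S_structure empty_oracle (limit_copy a).
Proof.
  intro Ha. pose proof (comp_history a Ha) as Hh. split.
  - destruct (comp_const (A := nat) 1) as [c Hc]. exists c. intro n. split; [intros _; apply Hc|].
    intro H. now contradiction H.
  - assert (Hb : comp (fun n : nat => ((unl n =? 0) && (unl (unr n) =? unr (unr n)))
      || ((unl n =? 1) && limS a (unl (unr n)) (unl (unr (unr n))) (unr (unr (unr n)))))).
    { unfold limS, cS. comp_tac. }
    destruct Hb as [c Hc]. exists c. intro n. specialize (Hc n).
    assert (E : ((unl n =? 0) && (unl (unr n) =? unr (unr n)))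
      || ((unl n =? 1) && limS a (unl (unr n)) (unl (unr (unr n))) (unr (unr (unr n)))) = true
      <-> S_diagram (limit_copy a) n).
    { rewrite orb_true_iff, !andb_true_iff, !Nat.eqb_eq. split.
      - intros [[H1 H2]|[H1 H2]]; [left|right].
        + exists (unl (unr n)). split; [exact I|]. rewrite H2 at 2. now rewrite pr_un, <- H1, pr_un.
        + exists (unl (unr n)), (unl (unr (unr n))), (unr (unr (unr n))).
          do 4 (split; [easy|]). now rewrite !pr_un, <- H1, pr_un.
      - intros [(x & _ & ->)|(x & y & z & _ & _ & _ & H & ->)]; [left|right];
          now rewrite ?unl_pr, ?unr_pr, ?unl_pr, ?unr_pr, ?unl_pr, ?unr_pr. }
    rewrite <- E. split; intro H.
    + now rewrite H in Hc.
    + apply not_true_is_false in H. now rewrite H in Hc.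
Qed.

Lemma computable_copy (D : both_structure) :
  computable_both_structure zero' D -> mem_implies_S D -> extension_property D ->
  exists C, computable_S_structure empty_oracle C /\ isomorphic C (reduct_S D).
Proof.
  intros [_ HD] HM HE. destruct (limit_lemma _ HD) as (a & Ha & Hlim).
  exists (limit_copy a). split; [now apply limit_copy_computable|].
  now apply limit_copy_isomorphic.
Qed.

(** * Models as types, and definable classes *)

(** With a type as domain, the set theory below runs without side conditions on membership in the
    domain; [sat_msat] gives the link to [sat]. *)
Fixpoint msat {M : Type} (E : M -> M -> Prop) (S3 : M -> M -> M -> Prop)
  (r : nat -> M) (p : form) : Prop :=
  match p with
  | Bot => False
  | Eq i j => r i = r j
  | Mem i j => E (r i) (r j)
  | SP i j k => S3 (r i) (r j) (r k)
  | Imp p q => msat E S3 r p -> msat E S3 r q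
  | And p q => msat E S3 r p /\ msat E S3 r q
  | Or p q => msat E S3 r p \/ msat E S3 r q
  | All p => forall a, msat E S3 (scons a r) p
  | Ex p => exists a, msat E S3 (scons a r) p
  end.

Section Satisfaction.
Context {M : Type} (E : M -> M -> Prop) (S3 : M -> M -> M -> Prop).
Local Notation msat := (msat E S3).

Lemma msat_ren p : forall f r r', (forall i, r' i = r (f i)) ->
  (msat r (ren f p) <-> msat r' p).
Proof.
  induction p; intros f r r' H; simpl; rewrite ?H; try tauto.
  1-3: rewrite (IHp1 f r r' H), (IHp2 f r r' H); tauto.
  all: assert (K : forall a i, scons a r' i
         = scons a r (scons 0 (fun i => S (f i)) i)) by (intros a [|i]; simpl; auto).
  - split; intros Ha a; apply (IHp _ _ _ (K a)), Ha.
  - split; intros [a Ha]; exists a; apply (IHp _ _ _ (K a)), Ha.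
Qed.

Lemma msat_ren_comp f p r : msat r (ren f p) <-> msat (fun i => r (f i)) p.
Proof. now apply msat_ren. Qed.

Lemma ren_id p : forall f, (forall i, f i = i) -> ren f p = p.
Proof.
  assert (K : forall f, (forall i, f i = i) -> forall i, scons 0 (fun i => S (f i)) i = i).
  { intros f H [|i]; simpl; auto. }
  induction p; intros f H; simpl; rewrite ?H; f_equal; auto.
Qed.

Lemma msat_ext p r r' : (forall i, r' i = r i) -> (msat r p <-> msat r' p).
Proof. intro H. rewrite <- (msat_ren p (fun i => i) r r' H). now rewrite ren_id. Qed.

Definition app_env (l : list M) (r : nat -> M) (i : nat) : M :=
  match nth_error l i with Some m => m | None => r (i - length l) end.

Lemma app_env_l l r i m : nth_error l i = Some m -> app_env l r i = m.
Proof. unfold app_env. now intros ->. Qed.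

Lemma app_env_lt l l' r r' i : i < length l -> app_env l r i = app_env (l ++ l') r' i.
Proof.
  intro H. unfold app_env. rewrite nth_error_app1 by assumption.
  destruct (nth_error l i) eqn:En; [reflexivity|]. apply nth_error_None in En. lia.
Qed.

Lemma app_env_ge l r i : app_env l r (length l + i) = r i.
Proof.
  unfold app_env. rewrite (proj2 (nth_error_None l (length l + i))) by lia. f_equal. lia.
Qed.

Lemma app_env_app l l' r i : app_env (l ++ l') r (length l + i) = app_env l' r i.
Proof.
  unfold app_env. rewrite nth_error_app2, length_app by lia.
  replace (length l + i - length l) with i by lia.
  destruct (nth_error l' i); [reflexivity|]. f_equal. lia.
Qed.

Lemma S_free_ren p : forall f, S_free p -> S_free (ren f p).
Proof. induction p; simpl; intuition. Qed.

(* [P] is definable, with parameters, by a formula without S. *)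
Definition definable (P : (nat -> M) -> Prop) : Prop :=
  exists p l, S_free p /\ forall r, msat (app_env l r) p <-> P r.

Lemma definable_iff P Q : (forall r, P r <-> Q r) -> definable P -> definable Q.
Proof.
  intros H (p & l & Hp & HP). exists p, l. split; [assumption|].
  intro r. now rewrite HP.
Qed.

(** The parameter lists are concatenated: the free variables of the first formula move up past the
    second list, and all indices of the second formula move up past the first list. *)
Lemma definable_merge P Q : definable P -> definable Q ->
  exists p q l, S_free p /\ S_free q
    /\ (forall r, msat (app_env l r) p <-> P r) /\ (forall r, msat (app_env l r) q <-> Q r).
Proof.
  intros (p & l & Hp & HP) (q & l' & Hq & HQ).
  exists (ren (fun i => if i <? length l then i else i + length l') p),
    (ren (fun i => length l + i) q), (l ++ l').
  repeat split; try now apply S_free_ren.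
  1,2: rewrite <- HP; apply msat_ren; intro i; destruct (Nat.ltb_spec i (length l));
    [now apply app_env_lt|];
    replace i with (length l + (i - length l)) at 1 by lia;
    replace (i + length l') with (length (l ++ l') + (i - length l)) by (rewrite length_app; lia);
    now rewrite !app_env_ge.
  1,2: rewrite <- HQ; apply msat_ren; intro i; now rewrite app_env_app.
Qed.

Lemma definable_and P Q : definable P -> definable Q -> definable (fun r => P r /\ Q r).
Proof.
  intros HP HQ. destruct (definable_merge P Q HP HQ) as (p & q & l & Fp & Fq & Hp & Hq).
  exists (And p q), l. split; [now split|]. intro r. simpl. now rewrite Hp, Hq.
Qed.

Lemma definable_or P Q : definable P -> definable Q -> definable (fun r => P r \/ Q r).
Proof.
  intros HP HQ. destruct (definable_merge P Q HP HQ) as (p & q & l & Fp & Fq & Hp & Hq).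
  exists (Or p q), l. split; [now split|]. intro r. simpl. now rewrite Hp, Hq.
Qed.

Lemma definable_imp P Q : definable P -> definable Q -> definable (fun r => P r -> Q r).
Proof.
  intros HP HQ. destruct (definable_merge P Q HP HQ) as (p & q & l & Fp & Fq & Hp & Hq).
  exists (Imp p q), l. split; [now split|]. intro r. simpl. now rewrite Hp, Hq.
Qed.

Lemma definable_False : definable (fun _ => False).
Proof. exists Bot, []. split; [exact I|]. reflexivity. Qed.

Lemma definable_not P : definable P -> definable (fun r => ~ P r).
Proof. intro H. exact (definable_imp _ _ H definable_False). Qed.

Lemma definable_equiv P Q : definable P -> definable Q -> definable (fun r => P r <-> Q r).
Proof. intros HP HQ. apply definable_and; now apply definable_imp. Qed.

(** The variable to be bound sits behind the parameters, at index [length l], while a quantifier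
    binds index 0. The renaming rotates it to the front past the parameters; indices beyond it do
    not move. *)
Lemma definable_bind (B : (nat -> M) -> M -> Prop) :
  definable (fun r => B (fun i => r (S i)) (r 0)) ->
  exists p l, S_free p /\ forall r a, msat (scons a (app_env l r)) p <-> B r a.
Proof.
  intros (p & l & Fp & Hp).
  exists (ren (fun i => if i <? length l then S i else if i =? length l then 0 else i) p), l.
  split; [now apply S_free_ren|]. intros r a.
  rewrite (msat_ren p _ _ (app_env l (scons a r))).
  - rewrite Hp. reflexivity.
  - intro i. destruct (Nat.ltb_spec i (length l)).
    + simpl. rewrite <- (app_nil_r l) at 2. now apply app_env_lt.
    + replace i with (length l + (i - length l)) at 1 by lia. rewrite app_env_ge.
      destruct (Nat.eqb_spec i (length l)) as [->|Hne].
      * now rewrite Nat.sub_diag.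
      * replace i with (S (length l + (i - length l - 1))) at 2 by lia.
        simpl. rewrite app_env_ge. replace (i - length l) with (S (i - length l - 1)) at 1 by lia.
        reflexivity.
Qed.

Lemma definable_all (B : (nat -> M) -> M -> Prop) :
  definable (fun r => B (fun i => r (S i)) (r 0)) -> definable (fun r => forall x, B r x).
Proof.
  intro H. destruct (definable_bind B H) as (p & l & Fp & Hp). exists (All p), l.
  split; [assumption|]. intro r. simpl. split; intros G x; apply Hp, G.
Qed.

Lemma definable_ex (B : (nat -> M) -> M -> Prop) :
  definable (fun r => B (fun i => r (S i)) (r 0)) -> definable (fun r => exists x, B r x).
Proof.
  intro H. destruct (definable_bind B H) as (p & l & Fp & Hp). exists (Ex p), l.
  split; [assumption|]. intro r. simpl. split; intros [x G]; exists x; now apply Hp.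
Qed.

(** The language has no function symbols, so a term counts as definable through its graph;
    substituting it costs an existential quantifier. *)
Definition definable_term (t : (nat -> M) -> M) : Prop :=
  definable (fun r => r 0 = t (fun i => r (S i))).

Lemma definable_term_var n : definable_term (fun r => r n).
Proof.
  exists (Eq 0 (S n)), []. split; [exact I|]. intro r. unfold app_env. destruct n; reflexivity.
Qed.

Lemma definable_term_const m : definable_term (fun _ => m).
Proof. exists (Eq 1 0), [m]. split; [exact I|]. intro r. reflexivity. Qed.

Lemma definable_subst (t : (nat -> M) -> M) (P : (nat -> M) -> M -> Prop) :
  definable_term t -> definable (fun r => P (fun i => r (S i)) (r 0)) -> definable (fun r => P r (t r)).
Proof.
  intros Ht HP. apply (definable_iff (fun r => exists x, x = t r /\ P r x)).
  - intro r. split; [intros (x & -> & H); assumption|eauto].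
  - apply definable_ex, definable_and; assumption.
Qed.

Lemma definable_lift (P : (nat -> M) -> Prop) (f : nat -> nat) :
  definable P -> definable (fun r => P (fun i => r (f i))).
Proof.
  intros (p & l & Fp & Hp).
  exists (ren (fun i => if i <? length l then i else length l + f (i - length l)) p), l.
  split; [now apply S_free_ren|]. intro r. rewrite <- Hp. apply msat_ren.
  intro i. destruct (Nat.ltb_spec i (length l)).
  - rewrite <- (app_nil_r l) at 2. now apply app_env_lt.
  - replace i with (length l + (i - length l)) at 1 by lia. now rewrite !app_env_ge.
Qed.

Lemma definable_term_lift (t : (nat -> M) -> M) (f : nat -> nat) :
  definable_term t -> definable_term (fun r => t (fun i => r (f i))).
Proof.
  intro H. apply (definable_lift _ (fun i => match i with 0 => 0 | S i => S (f i) end) H).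
Qed.

Lemma definable_pred1 (P : M -> Prop) t :
  definable (fun r => P (r 0)) -> definable_term t -> definable (fun r => P (t r)).
Proof.
  intros HP Ht. apply (definable_subst t (fun r x => P x)); assumption.
Qed.

Lemma definable_pred2 (P : M -> M -> Prop) t u :
  definable (fun r => P (r 0) (r 1)) -> definable_term t -> definable_term u -> definable (fun r => P (t r) (u r)).
Proof.
  intros HP Ht Hu. apply (definable_subst t (fun r x => P x (u r))); [assumption|].
  apply (definable_subst (fun r => u (fun i => r (S i))) (fun r y => P (r 0) y)).
  - now apply (definable_term_lift u S).
  - apply (definable_lift _ (fun i => match i with 0 => 1 | _ => 0 end) HP).
Qed.

Lemma definable_pred3 (P : M -> M -> M -> Prop) t u v :
  definable (fun r => P (r 0) (r 1) (r 2)) -> definable_term t -> definable_term u -> definable_term v ->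
  definable (fun r => P (t r) (u r) (v r)).
Proof.
  intros HP Ht Hu Hv. apply (definable_subst t (fun r x => P x (u r) (v r))); [assumption|].
  apply (definable_subst (fun r => u (fun i => r (S i))) (fun r y => P (r 0) y (v (fun i => r (S i))))).
  - now apply (definable_term_lift u S).
  - apply (definable_subst (fun r => v (fun i => r (S (S i)))) (fun r z => P (r 1) (r 0) z)).
    + now apply (definable_term_lift v (fun i => S (S i))).
    + apply (definable_lift _ (fun i => match i with 0 => 2 | 1 => 1 | _ => 0 end) HP).
Qed.

Lemma definable_term_fun1 (F : M -> M) t :
  definable (fun r => r 0 = F (r 1)) -> definable_term t -> definable_term (fun r => F (t r)).
Proof.
  intros HF Ht. apply (definable_pred2 (fun y x => y = F x) (fun r => r 0) (fun r => t (fun i => r (S i))));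
    [assumption|apply definable_term_var|now apply (definable_term_lift t S)].
Qed.

Lemma definable_term_fun2 (F : M -> M -> M) t u :
  definable (fun r => r 0 = F (r 1) (r 2)) -> definable_term t -> definable_term u -> definable_term (fun r => F (t r) (u r)).
Proof.
  intros HF Ht Hu. apply (definable_pred3 (fun y x z => y = F x z) (fun r => r 0)
    (fun r => t (fun i => r (S i))) (fun r => u (fun i => r (S i))));
    [assumption|apply definable_term_var|now apply (definable_term_lift t S)|now apply (definable_term_lift u S)].
Qed.

Lemma definable_mem t u : definable_term t -> definable_term u -> definable (fun r => E (t r) (u r)).
Proof.
  apply (definable_pred2 E). exists (Mem 0 1), []. split; [exact I|]. reflexivity.
Qed.

Lemma definable_eq t u : definable_term t -> definable_term u -> definable (fun r => t r = u r).
Proof.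
  apply (definable_pred2 eq). exists (Eq 0 1), []. split; [exact I|]. reflexivity.
Qed.

(** * Closed formulas and universal closures *)

Fixpoint boundedb (n : nat) (p : form) : bool :=
  match p with
  | Bot => true
  | Eq i j | Mem i j => (i <? n) && (j <? n)
  | SP i j k => (i <? n) && (j <? n) && (k <? n)
  | Imp p q | And p q | Or p q => boundedb n p && boundedb n q
  | All p | Ex p => boundedb (S n) p
  end.

Lemma boundedb_bounded p : forall n, boundedb n p = true -> bounded n p.
Proof.
  induction p; intros n; simpl; rewrite ?andb_true_iff, ?Nat.ltb_lt; intuition.
Qed.

Lemma bounded_ren p : forall n f, (forall i, f i < n) -> bounded n (ren f p).
Proof.
  induction p; intros n f H; simpl; auto.
  all: apply IHp; intros [|i]; simpl; [lia|]; specialize (H i); lia.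
Qed.

Lemma bounded_ren_bounded p : forall n m f, bounded n p -> (forall i, i < n -> f i < m) ->
  bounded m (ren f p).
Proof.
  induction p; intros n m f; simpl; intros HB H; intuition eauto.
  all: apply (IHp (S n)); [assumption|]; intros [|i] Hi; simpl; [lia|];
    specialize (H i ltac:(lia)); lia.
Qed.

Lemma sentence_close n p : bounded n (p n) -> sentence (close n p).
Proof.
  unfold sentence, close. generalize (p n) as q. clear p. intro q.
  replace n with (0 + n) at 1 by lia. generalize 0 as m.
  induction n as [|n IH]; intros m; simpl.
  - now rewrite Nat.add_0_r.
  - intro H. apply IH. now replace (S m + n) with (m + S n) by lia.
Qed.

(** Variable 0 is bound outermost and so has the largest de Bruijn index among the parameters; hence
    the reversal of [l]. *)
Lemma msat_close n p r l :
  length l = n -> msat r (close n p) -> msat (app_env (rev l) r) (p n).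
Proof.
  unfold close. generalize (p n) as q. clear p. intro q. revert r l.
  induction n as [|n IH]; intros r [|m l] Hl H; try discriminate Hl.
  - revert H. apply msat_ext. intro i. unfold app_env. simpl. destruct i; reflexivity.
  - specialize (IH (scons m r) l ltac:(simpl in Hl; lia) (H m)).
    revert IH. apply msat_ext. intro i. simpl.
    destruct (Nat.lt_ge_cases i (length (rev l))) as [Hi|Hi].
    + now apply app_env_lt.
    + replace i with (length (rev l) + (i - length (rev l))) by lia.
      rewrite app_env_app, app_env_ge. unfold app_env.
      destruct (i - length (rev l)) as [|k]; [reflexivity|]. simpl. now rewrite nth_error_nil, Nat.sub_0_r.
Qed.

Lemma app_env_rev_idx l r i m :
  nth_error l i = Some m -> app_env (rev l) r (idx (length l) i) = m.
Proof.
  intro H. apply app_env_l.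
  assert (i < length l) by (apply nth_error_Some; congruence). unfold idx.
  rewrite nth_error_rev by lia.
  destruct (Nat.ltb_spec (length l - S i) (length l)); [|lia].
  rewrite <- H. f_equal. lia.
Qed.

Lemma idx_0 d : idx (S d) d = 0.
Proof. unfold idx. lia. Qed.

Lemma idx_S d i : i < d -> idx (S d) i = S (idx d i).
Proof. unfold idx. lia. Qed.

End Satisfaction.

(** * The axioms, read in a model *)

Ltac idx_tac := repeat first [rewrite idx_0 | rewrite idx_S by lia].
Tactic Notation "idx_tac" "in" hyp(H) :=
  repeat first [rewrite idx_0 in H | rewrite idx_S in H by lia].

Section ZFInModel.
Context {M : Type} (E : M -> M -> Prop) (S3 : M -> M -> M -> Prop) (m0 : M).
Hypothesis HM : forall p, T_both p -> forall r, msat E S3 r p.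

Lemma axiom_holds p : ZF_inf_TC p -> sentence p -> forall r, msat E S3 r p.
Proof. intros H Hs. apply HM. split; [assumption|]. apply prv_ax. now left. Qed.

Ltac closed_axiom ax :=
  let H := fresh in
  pose proof (axiom_holds _ ax ltac:(cbn; unfold idx; lia) (fun _ => m0)) as H; exact H.

Lemma m_ext x y : (forall z, E z x <-> E z y) -> x = y.
Proof. revert x y. closed_axiom ax_extensionality. Qed.

Lemma m_found x : ~ (forall z, ~ E z x) -> exists y, E y x /\ ~ exists z, E z x /\ E z y.
Proof. revert x. closed_axiom ax_foundation. Qed.

Lemma m_empty : exists x, forall z, ~ E z x.
Proof. closed_axiom ax_empty. Qed.

Lemma m_pair x y : exists p, forall z, E z p <-> z = x \/ z = y.
Proof. revert x y. closed_axiom ax_pairing. Qed.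

Lemma m_union x : exists u, forall z, E z u <-> exists y, E y x /\ E z y.
Proof. revert x. closed_axiom ax_union. Qed.

Lemma m_power x : exists u, forall z, E z u <-> forall y, E y z -> E y x.
Proof. revert x. closed_axiom ax_power. Qed.

Lemma m_tc x :
  exists y, (forall z, E z y -> forall t, E t z -> E t y) /\ forall z, E z x -> E z y.
Proof. revert x. closed_axiom ax_transitive_closure. Qed.

Lemma bounded_inst p n d (s : nat -> var) :
  bounded n p -> (forall i, i < n -> s i < d) -> bounded d (inst p s d).
Proof.
  intros Hp Hs. apply (bounded_ren_bounded _ n); [assumption|].
  intros i Hi. specialize (Hs i Hi). unfold idx. lia.
Qed.

Lemma idx_lt d i : i < d -> idx d i < d.
Proof. unfold idx. lia. Qed.

Lemma m_sep (P : M -> Prop) : definable E S3 (fun r => P (r 0)) ->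
  forall u, exists v, forall x, E x v <-> E x u /\ P x.
Proof.
  intros (p & l & Fp & Hp) u. set (n := length l).
  (* The schema wants the element at index 0 and the parameters behind it. All indices beyond the
     parameters are merged with the element; this bounds the formula and is harmless, as [P] looks
     at [r 0] alone. *)
  set (g i := if i <? n then S i else 0).
  assert (Hg : forall i, g i < 1 + n).
  { intro i. unfold g. destruct (Nat.ltb_spec i n); lia. }
  pose proof (axiom_holds _ (ax_separation n (ren g p) (S_free_ren _ _ Fp) (bounded_ren _ _ _ Hg))) as H.
  match type of H with sentence (close n ?f) -> _ => set (phi := f) in * end.
  assert (Hs : sentence (close n phi)).
  { apply sentence_close. cbn -[idx].
    assert (bounded (S (S (S n)))
      (inst (ren g p) (scons (S (S n)) (fun i => i)) (S (S (S n))))).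
    { apply (bounded_inst _ (1 + n)); [now apply bounded_ren|].
      intros [|i] Hi; simpl; lia. }
    repeat split; try (apply idx_lt; lia); assumption. }
  pose proof (msat_close E S3 n phi _ l eq_refl (H Hs (fun _ => m0))) as K.
  destruct (K u) as [v Hv]. exists v. intro x. specialize (Hv x).
  cbn -[idx] in Hv. idx_tac in Hv. cbn -[idx] in Hv.
  unfold inst in Hv. rewrite <- (Hp (fun _ => x)).
  rewrite !msat_ren_comp in Hv.
  match type of Hv with context [msat E S3 ?r p] =>
    assert (Hr : msat E S3 r p <-> msat E S3 (app_env l (fun _ => x)) p) end;
    [|now rewrite Hr in Hv].
  apply msat_ext.
  intro i. cbv beta. unfold g. destruct (Nat.ltb_spec i n) as [Hi|Hi]; cbn -[idx].
  - idx_tac. cbn -[idx]. destruct (nth_error l i) as [m|] eqn:En.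
    + rewrite (app_env_l _ _ _ _ En). symmetry. now apply app_env_rev_idx.
    + apply nth_error_None in En. unfold n in Hi. lia.
  - rewrite idx_0. unfold app_env. now rewrite (proj2 (nth_error_None l i)) by assumption.
Qed.

Lemma m_repl (P : M -> M -> Prop) : definable E S3 (fun r => P (r 0) (r 1)) ->
  forall u, (forall x y z, E x u -> P x y -> P x z -> y = z) ->
  exists v, forall y, E y v <-> exists x, E x u /\ P x y.
Proof.
  intros (p & l & Fp & Hp) u Hu. set (n := length l).
  (* Argument at index 0, value at index 1, parameters behind them; every larger index is merged
     with the value. *)
  set (g i := if i <? n then S (S i) else if i =? n then 0 else 1).
  assert (Hg : forall i, g i < 2 + n).
  { intro i. unfold g. destruct (Nat.ltb_spec i n), (Nat.eqb_spec i n); lia. }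
  pose proof (axiom_holds _ (ax_replacement n (ren g p) (S_free_ren _ _ Fp) (bounded_ren _ _ _ Hg))) as H.
  cbv zeta in H.
  match type of H with sentence (close n ?f) -> _ => set (phi := f) in * end.
  assert (Hs : sentence (close n phi)).
  { apply sentence_close. cbn -[idx].
    assert (HB : forall d x y, x < d -> y < d -> n < d ->
      bounded d (inst (ren g p) (scons x (scons y (fun i => i))) d)).
    { intros d x y Hx Hy Hd. apply (bounded_inst _ (2 + n)); [now apply bounded_ren|].
      intros [|[|i]] Hi; simpl; lia. }
    repeat split; try (apply idx_lt; lia); apply HB; lia. }
  pose proof (msat_close E S3 n phi _ l eq_refl (H Hs (fun _ => m0))) as K.
  assert (HP : forall d r x y, n <= d ->
    (forall i m, nth_error l i = Some m -> r (idx d i) = m) -> forall a b,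
    r (idx d x) = a -> r (idx d y) = b ->
    (msat E S3 r (inst (ren g p) (scons x (scons y (fun i => i))) d) <-> P a b)).
  { intros d r x y Hd Hr a b Ha Hb.
    pose (env i := match i with 0 => a | _ => b end).
    change (P a b) with (P (env 0) (env 1)). rewrite <- (Hp env).
    unfold inst. rewrite !msat_ren_comp.
    apply msat_ext. intro i. unfold g. destruct (Nat.ltb_spec i n) as [Hi|Hi]; cbn -[idx].
    - destruct (nth_error l i) as [m|] eqn:En.
      + rewrite (app_env_l _ _ _ _ En). symmetry. now apply Hr.
      + apply nth_error_None in En. unfold n in Hi. lia.
    - unfold app_env. rewrite (proj2 (nth_error_None l i)) by assumption.
      fold n. destruct (Nat.eqb_spec i n) as [->|Hne].
      + rewrite Nat.sub_diag. simpl. now rewrite Ha.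
      + replace (i - n) with (S (i - n - 1)) by lia. simpl. now rewrite Hb. }
  assert (Hl : forall i m, nth_error l i = Some m -> app_env (rev l) (fun _ => m0) (idx n i) = m)
    by (intros; now apply app_env_rev_idx).
  assert (Hil : forall i m, nth_error l i = Some m -> i < n).
  { intros i m Hi. apply nth_error_Some. congruence. }
  destruct (K u) as [v Hv].
  - intros x y z. cbn -[idx]. idx_tac. cbn -[idx]. intros Hx Hy Hz.
    apply (Hu x); [assumption| |].
    + revert Hy. apply HP; [lia| | |].
      * intros i m Hi. pose proof (Hil _ _ Hi). idx_tac. now apply Hl.
      * idx_tac. reflexivity.
      * idx_tac. reflexivity.
    + revert Hz. apply HP; [lia| | |].
      * intros i m Hi. pose proof (Hil _ _ Hi). idx_tac. now apply Hl.
      * idx_tac. reflexivity.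
      * idx_tac. reflexivity.
  - exists v. intro y. specialize (Hv y). cbn -[idx] in Hv.
    idx_tac in Hv. cbn -[idx] in Hv. etransitivity; [exact Hv|].
    assert (HPx : forall x, msat E S3 (scons x (scons y (scons v (scons u (app_env (rev l) (fun _ => m0))))))
      (inst (ren g p) (scons (S (S (S n))) (scons (S (S n)) (fun i => i))) (S (S (S (S n))))) <-> P x y).
    { intro x. apply HP; [lia| | |].
      - intros i m Hi. pose proof (Hil _ _ Hi). idx_tac. now apply Hl.
      - idx_tac. reflexivity.
      - idx_tac. reflexivity. }
    split; intros [x [Hx HPxy]]; exists x; (split; [exact Hx|now apply HPx]).
Qed.

End ZFInModel.

(** * The vocabulary, read in a model *)

Section Vocabulary.
Context {M : Type} (E : M -> M -> Prop).

(** From here to the end of the section the formulas of the vocabulary are repeated connective for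
    connective, so that [msat] of a formula is convertible to its counterpart. *)
Definition mEmpty x := forall z, ~ E z x.
Definition mSub x y := forall z, E z x -> E z y.
Definition mTransitive x := forall y, E y x -> mSub y x.
Definition mOrd x := mTransitive x /\ forall y, E y x -> mTransitive y.
Definition mSucc x y := forall z, E z y <-> E z x \/ z = x.
Definition mLimit x := mOrd x /\ ~ mEmpty x /\ ~ exists y, mSucc y x.
Definition mUpair p a b := forall z, E z p <-> z = a \/ z = b.
Definition mOpair p a b := exists u v, mUpair u a a /\ mUpair v a b /\ mUpair p u v.
Definition mTriple t a b c := exists p, mOpair p a b /\ mOpair t p c.
Definition mApp f a b := exists p, mOpair p a b /\ E p f.
Definition mHolds R a b c := exists t, mTriple t a b c /\ E t R.
Definition mFun f d :=
  (forall p, E p f -> exists x y, E x d /\ mOpair p x y)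
  /\ forall x, E x d -> exists y, mApp f x y /\ forall z, mApp f x z -> z = y.

Definition mClause (step : M -> M -> M -> Prop) f b v :=
  (mEmpty b /\ mEmpty v)
  \/ (exists c u, mSucc c b /\ mApp f c u /\ step c u v)
  \/ (mLimit b /\ forall z, E z v <-> exists c u, E c b /\ mApp f c u /\ E z u).

Definition mRec (step : M -> M -> M -> Prop) a y :=
  mOrd a /\ exists d f, mSucc a d /\ mFun f d /\ mApp f a y
    /\ forall b v, E b d -> mApp f b v -> mClause step f b v.

Fixpoint mPlus (k : nat) (u v : M) :=
  match k with 0 => v = u | S k => exists w, mSucc u w /\ mPlus k w v end.

Definition mQ_step (_ u v : M) := mPlus q u v.
Definition mV_step (_ u v : M) := forall z, E z v <-> mSub z u.
Definition mQR := mRec mQ_step.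
Definition mVR := mRec mV_step.

Definition mGood k U R A SA :=
  mSub A U
  /\ (forall t, E t SA -> exists a b c,
        (E a A \/ a = k) /\ (E b A \/ b = k) /\ (E c A \/ c = k) /\ mTriple t a b c)
  /\ (forall a b c, E a A -> E b A -> E c A -> (mHolds SA a b c <-> mHolds R a b c))
  /\ (forall a b, E a A -> E b A -> E a b -> mHolds SA a b k).

Definition mW w k A SA := exists p, mOpair p A SA /\ mOpair w k p.

Definition mCovers k U R A SA w a b c :=
  mGood k U R A SA /\ mW w k A SA
  /\ (E a A \/ a = w) /\ (E b A \/ b = w) /\ (E c A \/ c = w).

Definition mRepl (w k x x' : M) := (x = w /\ x' = k) \/ (x <> w /\ x' = x).

Definition mSnext k U R a b c :=
  ((E a U /\ E b U /\ E c U) /\ mHolds R a b c)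
  \/ (~ (E a U /\ E b U /\ E c U) /\ exists A SA w, mCovers k U R A SA w a b c
        /\ exists a' b' c', mRepl w k a a' /\ mRepl w k b b' /\ mRepl w k c c' /\ mHolds SA a' b' c')
  \/ (~ (E a U /\ E b U /\ E c U) /\ ~ exists A SA w, mCovers k U R A SA w a b c).

Definition mR_step g Q Q' :=
  exists k U g' k' U', mQR g k /\ mVR k U /\ mSucc g g' /\ mQR g' k' /\ mVR k' U'
    /\ forall t, E t Q' <-> exists a b c, E a U' /\ E b U' /\ E c U'
         /\ mTriple t a b c /\ mSnext k U Q a b c.

Definition mRR := mRec mR_step.
End Vocabulary.

(** * Pairs, unions and successors as definable functions *)

Section SetTheory.
Context {M : Type} (E : M -> M -> Prop) (S3 : M -> M -> M -> Prop) (m0 : M).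
Hypothesis HM : forall p, T_both p -> forall r, msat E S3 r p.

Notation Empty := (mEmpty E). Notation Sub := (mSub E). Notation Transitive := (mTransitive E).
Notation Ord := (mOrd E). Notation Succ := (mSucc E). Notation Limit := (mLimit E).
Notation Upair := (mUpair E). Notation Opair := (mOpair E). Notation Triple := (mTriple E).
Notation App := (mApp E). Notation Holds := (mHolds E). Notation Fun := (mFun E).
Notation Clause := (mClause E). Notation Rec := (mRec E). Notation QR := (mQR E).
Notation VR := (mVR E). Notation RR := (mRR E).
Notation Dfn := (definable E S3). Notation DfnT := (definable_term E S3).

Let ext := m_ext E S3 m0 HM.

Lemma S3_definition a b c : S3 a b c <->
  exists al k U R, QR al k /\ VR k U /\ E a U /\ E b U /\ E c U /\ RR al R /\ Holds R a b c.
Proof.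
  revert a b c.
  refine (HM S_definition _ (fun _ => m0)). split; [|apply prv_ax; now right].
  apply boundedb_bounded; vm_compute; reflexivity.
Qed.

Ltac dfn_fun := fail.
Ltac dfn_unfold :=
  progress cbv beta iota delta [mEmpty mSub mTransitive mOrd mSucc mLimit mUpair mOpair
    mTriple mApp mHolds mFun mClause mRec mPlus mQ_step mV_step mQR mVR mGood mW mCovers mRepl
    mSnext mR_step mRR q].
Ltac dfn1 :=
  lazymatch goal with
  | |- definable _ _ (fun r => @?P r /\ @?Q r) => apply (definable_and E S3 P Q)
  | |- definable _ _ (fun r => @?P r \/ @?Q r) => apply (definable_or E S3 P Q)
  | |- definable _ _ (fun r => @?P r <-> @?Q r) => apply (definable_equiv E S3 P Q)
  | |- definable _ _ (fun r => ~ @?P r) => apply (definable_not E S3 P)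
  | |- definable _ _ (fun r => exists x, @?B r x) => apply (definable_ex E S3 B)
  | |- definable _ _ (fun r => @?P r -> @?Q r) => apply (definable_imp E S3 P Q)
  | |- definable _ _ (fun r => forall x, @?B r x) => apply (definable_all E S3 B)
  | |- definable _ _ (fun r => E (@?t r) (@?u r)) => apply (definable_mem E S3 t u)
  | |- definable _ _ (fun r => @?t r = @?u r) => apply (definable_eq E S3 t u)
  | |- definable_term _ _ (fun r => r ?n) => apply (definable_term_var E S3 n)
  | |- definable_term _ _ (fun _ => ?c) => apply (definable_term_const E S3 c)
  | |- _ => first [assumption | dfn_fun | dfn_unfold]
  end; cbv beta.
Ltac dfn := repeat dfn1.

(** Choosing witnesses turns the existence axioms into functions. They remain usable in definable
    terms because the defining property of each determines its graph. *)
Definition eps (P : M -> Prop) : M := epsilon (inhabits m0) P.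

Lemma eps_spec P : (exists x, P x) -> P (eps P).
Proof. apply epsilon_spec. Qed.

Definition upair a b := eps (fun p => Upair p a b).
Definition union x := eps (fun u => forall z, E z u <-> exists y, E y x /\ E z y).
Definition adj x y := union (upair x (upair y y)).
Definition succ x := adj x x.
Definition opair a b := upair (upair a a) (upair a b).
Definition tri a b c := opair (opair a b) c.

Lemma in_upair z a b : E z (upair a b) <-> z = a \/ z = b.
Proof. revert z. exact (eps_spec _ (m_pair E S3 m0 HM a b)). Qed.

Lemma in_union z x : E z (union x) <-> exists y, E y x /\ E z y.
Proof. revert z. exact (eps_spec _ (m_union E S3 m0 HM x)). Qed.

Lemma in_adj z x y : E z (adj x y) <-> E z x \/ z = y.
Proof.
  unfold adj. rewrite in_union. split.
  - intros (t & Ht & Hz). apply in_upair in Ht as [->| ->]; [now left|].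
    apply in_upair in Hz. tauto.
  - intros [H| ->]; [exists x|exists (upair y y)]; rewrite !in_upair; auto.
Qed.

Lemma in_succ z x : E z (succ x) <-> E z x \/ z = x.
Proof. apply in_adj. Qed.

Lemma Upair_iff p a b : Upair p a b <-> p = upair a b.
Proof.
  split; [|intros ->; intro; apply in_upair].
  intro H. apply ext. intro z. now rewrite in_upair, (H z).
Qed.

Lemma Succ_iff x y : Succ x y <-> y = succ x.
Proof.
  split; [|intros ->; intro; apply in_succ].
  intro H. apply ext. intro z. now rewrite in_succ, (H z).
Qed.

Lemma Opair_iff p a b : Opair p a b <-> p = opair a b.
Proof.
  unfold mOpair. split.
  - intros (u & v & Hu & Hv & Hp). rewrite Upair_iff in *. now subst.
  - intros ->. exists (upair a a), (upair a b). now rewrite !Upair_iff.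
Qed.

Lemma Triple_iff t a b c : Triple t a b c <-> t = tri a b c.
Proof.
  unfold mTriple. split.
  - intros (p & Hp & Ht). rewrite Opair_iff in *. now subst.
  - intros ->. exists (opair a b). now rewrite !Opair_iff.
Qed.

Lemma App_iff f a b : App f a b <-> E (opair a b) f.
Proof.
  unfold mApp. split.
  - intros (p & Hp & Hf). rewrite Opair_iff in Hp. now subst.
  - intros H. exists (opair a b). now rewrite Opair_iff.
Qed.

Lemma Holds_iff R a b c : Holds R a b c <-> E (tri a b c) R.
Proof.
  unfold mHolds. split.
  - intros (p & Hp & Hf). rewrite Triple_iff in Hp. now subst.
  - intros H. exists (tri a b c). now rewrite Triple_iff.
Qed.

Lemma upair_inj a b a' b' : upair a b = upair a' b' -> (a = a' /\ b = b') \/ (a = b' /\ b = a').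
Proof.
  intro H. assert (K : forall z, (z = a \/ z = b) <-> (z = a' \/ z = b'))
    by (intro z; now rewrite <- !in_upair, H).
  destruct (proj1 (K a) (or_introl eq_refl)), (proj1 (K b) (or_intror eq_refl)); auto;
    destruct (proj2 (K a') (or_introl eq_refl)), (proj2 (K b') (or_intror eq_refl)); subst; auto.
Qed.

Lemma opair_inj a b a' b' : opair a b = opair a' b' -> a = a' /\ b = b'.
Proof.
  intro H. apply upair_inj in H as [[H1 H2]|[H1 H2]];
    apply upair_inj in H1; apply upair_inj in H2; intuition congruence.
Qed.

Lemma tri_inj a b c a' b' c' : tri a b c = tri a' b' c' -> a = a' /\ b = b' /\ c = c'.
Proof.
  intro H. apply opair_inj in H as [H ->]. apply opair_inj in H as [-> ->]. auto.
Qed.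

Lemma definable_term_upair t u : DfnT t -> DfnT u -> DfnT (fun r => upair (t r) (u r)).
Proof.
  apply definable_term_fun2. apply (definable_iff E S3 (fun r => Upair (r 0) (r 1) (r 2))).
  - intro r. apply Upair_iff.
  - dfn.
Qed.

Lemma definable_term_union t : DfnT t -> DfnT (fun r => union (t r)).
Proof.
  apply definable_term_fun1.
  apply (definable_iff E S3 (fun r => forall z, E z (r 0) <-> exists y, E y (r 1) /\ E z y)).
  - intro r. split; [|intros -> z; apply in_union].
    intro H. apply ext. intro z. now rewrite H, in_union.
  - dfn.
Qed.

Ltac dfn_fun ::=
  lazymatch goal with
  | |- definable_term _ _ (fun r => upair (@?t r) (@?u r)) => apply (definable_term_upair t u)
  | |- definable_term _ _ (fun r => union (@?t r)) => apply (definable_term_union t)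
  | H : definable _ _ (fun r => ?P (r 0)) |- definable _ _ (fun r => ?P (@?t r)) =>
      apply (definable_pred1 E S3 P t H)
  | H : definable _ _ (fun r => ?P (r 0) (r 1)) |- definable _ _ (fun r => ?P (@?t r) (@?u r)) =>
      apply (definable_pred2 E S3 P t u H)
  | H : definable _ _ (fun r => ?P (r 0) (r 1) (r 2))
    |- definable _ _ (fun r => ?P (@?t r) (@?u r) (@?v r)) => apply (definable_pred3 E S3 P t u v H)
  | |- _ => progress cbv beta delta [opair tri adj succ]
  end.

(** ** Foundation and ordinals *)

Lemma sep (P : M -> Prop) : Dfn (fun r => P (r 0)) ->
  forall u, exists v, forall x, E x v <-> E x u /\ P x.
Proof. exact (m_sep E S3 m0 HM P). Qed.

(** Foundation, applied to the subset of [u] that separation cuts out; this is where definability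
    enters. *)
Lemma E_min (P : M -> Prop) u x : Dfn (fun r => P (r 0)) -> E x u -> P x ->
  exists y, E y u /\ P y /\ forall z, E z u -> E z y -> ~ P z.
Proof.
  intros HP Hx Px. destruct (sep P HP u) as [v Hv].
  destruct (m_found E S3 m0 HM v) as (y & Hy & Hmin).
  - intro H. apply (H x). now apply Hv.
  - apply Hv in Hy as [Hy Py]. exists y. split; [assumption|]. split; [assumption|].
    intros z Hz Hzy Pz. apply Hmin. exists z. split; [now apply Hv|assumption].
Qed.

Lemma E_asym x y : E x y -> ~ E y x.
Proof.
  intros Hxy Hyx.
  destruct (E_min (fun _ => True) (upair x y) x) as (z & Hz & _ & Hmin).
  - exists (Imp Bot Bot), []. split; [easy|]. intro r. simpl. tauto.
  - apply in_upair. now left.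
  - exact I.
  - apply in_upair in Hz as [->| ->].
    + apply (Hmin y); auto. apply in_upair. now right.
    + apply (Hmin x); auto. apply in_upair. now left.
Qed.

Lemma E_irrefl x : ~ E x x.
Proof. intro H. exact (E_asym x x H H). Qed.

Lemma succ_inj x y : succ x = succ y -> x = y.
Proof.
  intro H. assert (K : forall z, (E z x \/ z = x) <-> (E z y \/ z = y))
    by (intro z; now rewrite <- !in_succ, H).
  destruct (proj1 (K x) (or_intror eq_refl)) as [H1|H1]; [|assumption].
  destruct (proj2 (K y) (or_intror eq_refl)) as [H2|H2]; [|now symmetry].
  now apply E_asym in H1.
Qed.

Lemma Ord_in a b : Ord a -> E b a -> Ord b.
Proof.
  intros [Ha Ha'] Hb. split; [now apply Ha'|].
  intros c Hc. apply Ha'. exact (Ha b Hb c Hc).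
Qed.

Lemma Ord_trans a b c : Ord a -> E b a -> E c b -> E c a.
Proof. intros [Ha _] Hb Hc. exact (Ha b Hb c Hc). Qed.

Lemma Ord_succ a : Ord a -> Ord (succ a).
Proof.
  intros [Ha Ha']. split.
  - intros b Hb c Hc. apply in_succ. left. apply in_succ in Hb as [Hb|Hb]; [exact (Ha b Hb c Hc)|].
    now subst b.
  - intros b Hb. apply in_succ in Hb as [Hb|Hb]; [auto|now subst b].
Qed.

Lemma succ_in_self a : E a (succ a).
Proof. apply in_succ. now right. Qed.

(** The model may have descending sequences of ordinals that are no sets of the model, so only
    definable properties admit induction. The least counterexample is sought in [succ a], which
    contains [a]. *)
Lemma ord_ind (P : M -> Prop) : Dfn (fun r => P (r 0)) ->
  (forall a, Ord a -> (forall b, E b a -> P b) -> P a) -> forall a, Ord a -> P a.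
Proof.
  intros HP IH a Ha. apply NNPP. intro Hn.
  destruct (E_min (fun x => ~ P x) (succ a) a) as (y & Hy & Py & Hmin).
  - now apply definable_not.
  - apply succ_in_self.
  - assumption.
  - apply Py, IH; [exact (Ord_in _ _ (Ord_succ a Ha) Hy)|]. intros b Hb. apply NNPP.
    apply Hmin; [|assumption]. exact (Ord_trans _ _ _ (Ord_succ a Ha) Hy Hb).
Qed.

Ltac ord_induction :=
  lazymatch goal with |- forall a, mOrd E a -> @?P a => apply (ord_ind P); [dfn|] end.

Lemma Ord_trichotomy a b : Ord a -> Ord b -> E a b \/ a = b \/ E b a.
Proof.
  intros Ha. revert b. revert a Ha. ord_induction.
  intros a Ha IHa. ord_induction. intros b Hb IHb.
  apply NNPP. intro Hn. apply Hn. right. left. apply ext. intro z. split; intro Hz.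
  - destruct (IHa z Hz b Hb) as [H|[H|H]]; [assumption|subst z|]; exfalso; apply Hn; right; right.
    + assumption.
    + exact (Ord_trans _ _ _ Ha Hz H).
  - destruct (IHb z Hz) as [H|[H|H]]; [|subst z|assumption]; exfalso; apply Hn; left.
    + exact (Ord_trans _ _ _ Hb Hz H).
    + assumption.
Qed.

Lemma Ord_sub a b : Ord a -> Ord b -> Sub a b -> E a b \/ a = b.
Proof.
  intros Ha Hb Hs. destruct (Ord_trichotomy a b Ha Hb) as [H|[H|H]]; auto.
  exfalso. exact (E_irrefl b (Hs b H)).
Qed.

Lemma Ord_cases a : Ord a -> Empty a \/ (exists c, a = succ c) \/ Limit a.
Proof.
  intro Ha. destruct (classic (Empty a)) as [H|H]; [now left|right].
  destruct (classic (exists c, a = succ c)) as [H'|H']; [now left|right].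
  split; [assumption|]. split; [assumption|]. intros [c Hc]. apply H'. exists c. now apply Succ_iff.
Qed.

Lemma Limit_not_succ c : ~ Limit (succ c).
Proof. intros (_ & _ & H). apply H. exists c. now apply Succ_iff. Qed.

Lemma succ_not_Empty c : ~ Empty (succ c).
Proof. intro H. exact (H c (succ_in_self c)). Qed.

Lemma Limit_succ a b : Limit a -> E b a -> E (succ b) a.
Proof.
  intros (Ha & _ & Hs) Hb.
  destruct (Ord_sub (succ b) a) as [H|H]; [now apply Ord_succ, (Ord_in a)|assumption| |assumption|].
  - intros z Hz. apply in_succ in Hz as [Hz|Hz]; [exact (Ord_trans _ _ _ Ha Hb Hz)|now subst z].
  - exfalso. apply Hs. exists b. apply Succ_iff. now symmetry.
Qed.

Lemma Ord_union s : (forall x, E x s -> Ord x) -> Ord (union s).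
Proof.
  intro H. split.
  - intros y Hy z Hz. apply in_union in Hy as (x & Hx & Hy). apply in_union. exists x.
    split; [assumption|]. exact (Ord_trans _ _ _ (H x Hx) Hy Hz).
  - intros y Hy. apply in_union in Hy as (x & Hx & Hy). exact (proj1 (Ord_in _ _ (H x Hx) Hy)).
Qed.

(** ** Transfinite recursion *)

Section Recursion.
Variable step : M -> M -> M -> Prop.
Hypothesis step_dfn : Dfn (fun r => step (r 0) (r 1) (r 2)).
Hypothesis step_functional : forall g u v v', step g u v -> step g u v' -> v = v'.
Hypothesis step_total : forall g u, Ord g -> exists v, step g u v.

Definition clause f b v :=
  (Empty b /\ Empty v)
  \/ (exists c u, b = succ c /\ E (opair c u) f /\ step c u v)
  \/ (Limit b /\ forall z, E z v <-> exists c u, E c b /\ E (opair c u) f /\ E z u).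

Definition attempt f d :=
  (forall p, E p f -> exists x y, E x d /\ p = opair x y)
  /\ (forall x, E x d -> exists y, E (opair x y) f /\ forall z, E (opair x z) f -> z = y)
  /\ forall b v, E b d -> E (opair b v) f -> clause f b v.

Lemma Rec_iff a y :
  Rec step a y <-> Ord a /\ exists f, attempt f (succ a) /\ E (opair a y) f.
Proof.
  unfold mRec, attempt, clause, mFun, mClause.
  setoid_rewrite Succ_iff. setoid_rewrite App_iff. setoid_rewrite Opair_iff.
  split.
  - intros (Ha & d & f & -> & [H1 H2] & H3 & H4). split; [assumption|]. now exists f.
  - intros (Ha & f & (H1 & H2 & H4) & H3). split; [assumption|]. now exists (succ a), f.
Qed.

(** The clauses for zero, successors and limits exclude one another, so both functions obey the same
    clause at [b], and it computes the value from earlier ones. *)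
Lemma attempt_agree f d f' d' : attempt f d -> attempt f' d' -> Transitive d -> Transitive d' ->
  forall b, Ord b -> E b d -> E b d' ->
  forall v v', E (opair b v) f -> E (opair b v') f' -> v = v'.
Proof.
  intros (F1 & F2 & F3) (G1 & G2 & G3) Hd Hd'.
  apply (ord_ind (fun b => E b d -> E b d' ->
    forall v v', E (opair b v) f -> E (opair b v') f' -> v = v')); [dfn|].
  intros b Hb IH Hbd Hbd' v v' Hv Hv'.
  assert (Hdn : forall c, E c b -> E c d) by (intros c Hc; exact (Hd b Hbd c Hc)).
  assert (Hdn' : forall c, E c b -> E c d') by (intros c Hc; exact (Hd' b Hbd' c Hc)).
  destruct (F3 b v Hbd Hv) as [[C1 C2]|[(c & u & -> & Hu & Hs)|[C1 C2]]];
    destruct (G3 _ v' Hbd' Hv') as [[K1 K2]|[(c' & u' & Ec & Hu' & Hs')|[K1 K2]]].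
  - apply ext. intro z. split; intro Hz; exfalso; [exact (C2 z Hz)|exact (K2 z Hz)].
  - subst b. destruct (succ_not_Empty _ C1).
  - destruct K1 as (_ & K1 & _). contradiction.
  - destruct (succ_not_Empty _ K1).
  - apply succ_inj in Ec as <-.
    rewrite <- (IH c (succ_in_self c) (Hdn c (succ_in_self c)) (Hdn' c (succ_in_self c)) u u' Hu Hu') in Hs'.
    exact (step_functional _ _ _ _ Hs Hs').
  - destruct (Limit_not_succ _ K1).
  - destruct C1 as (_ & C1 & _). contradiction.
  - subst b. destruct (Limit_not_succ _ C1).
  - apply ext. intro z. rewrite C2, K2. split.
    + intros (c & u & Hc & Hu & Hz). destruct (G2 c (Hdn' c Hc)) as (u' & Hu' & _).
      exists c, u'. rewrite (IH c Hc (Hdn c Hc) (Hdn' c Hc) u u' Hu Hu') in Hz. auto.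
    + intros (c & u & Hc & Hu & Hz). destruct (F2 c (Hdn c Hc)) as (u' & Hu' & _).
      exists c, u'. rewrite <- (IH c Hc (Hdn c Hc) (Hdn' c Hc) u' u Hu' Hu) in Hz. auto.
Qed.

Lemma Rec_functional a y y' : Rec step a y -> Rec step a y' -> y = y'.
Proof.
  rewrite !Rec_iff. intros (Ha & f & Hf & Hy) (_ & f' & Hf' & Hy').
  pose proof (proj1 (Ord_succ a Ha)) as Ht.
  exact (attempt_agree _ _ _ _ Hf Hf' Ht Ht a Ha (succ_in_self a) (succ_in_self a) y y' Hy Hy').
Qed.

(** The restriction of [f] to [succ b] is again an attempt, because the clause at [c] refers only to
    values below [c]. *)
Lemma attempt_Rec a f b v : Ord a -> attempt f (succ a) -> E b (succ a) -> E (opair b v) f ->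
  Rec step b v.
Proof.
  intros Ha (F1 & F2 & F3) Hb Hv. pose proof (Ord_in _ _ (Ord_succ a Ha) Hb) as Ob.
  apply Rec_iff. split; [assumption|].
  assert (Hsub : forall x, E x (succ b) -> E x (succ a)).
  { intros x Hx. apply in_succ in Hx as [Hx| ->]; [|assumption].
    exact (Ord_trans _ _ _ (Ord_succ a Ha) Hb Hx). }
  destruct (sep (fun p => exists x y, E x (succ b) /\ p = opair x y) ltac:(dfn) f) as [g Hg].
  assert (Hg' : forall x y, E (opair x y) g <-> E (opair x y) f /\ E x (succ b)).
  { intros x y. rewrite Hg. split; intros [H1 H2]; (split; [assumption|]).
    - destruct H2 as (x' & y' & Hx' & H2). now apply opair_inj in H2 as [-> _].
    - now exists x, y. }
  exists g. split; [split; [|split]|].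
  - intros p Hp. now apply Hg in Hp as [_ Hp].
  - intros x Hx. destruct (F2 x (Hsub x Hx)) as (y & Hy & Hy'). exists y. split; [now apply Hg'|].
    intros z Hz. apply Hy'. now apply Hg' in Hz.
  - intros c w Hc Hw. apply Hg' in Hw as [Hw _].
    destruct (F3 c w (Hsub c Hc) Hw) as [H|[(e & u & -> & Hu & Hs)|[C1 C2]]]; [now left|right; left|].
    + exists e, u. split; [reflexivity|]. split; [|assumption]. apply Hg'. split; [assumption|].
      exact (Ord_trans _ _ _ (Ord_succ b Ob) Hc (succ_in_self e)).
    + right. right. split; [assumption|]. intro z. rewrite C2.
      assert (Hec : forall e, E e c -> E e (succ b))
        by (intros e He; exact (Ord_trans _ _ _ (Ord_succ b Ob) Hc He)).
      split; intros (e & u & He & Hu & Hz); exists e, u; specialize (Hec e He);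
        rewrite Hg' in *; tauto.
  - apply Hg'. split; [assumption|apply succ_in_self].
Qed.

Lemma Rec_Empty a y : Rec step a y -> Empty a -> Empty y.
Proof.
  rewrite Rec_iff. intros (Ha & f & (F1 & F2 & F3) & Hy) H0.
  destruct (F3 a y (succ_in_self a) Hy) as [[_ H]|[(c & _ & -> & _)|[(_ & H & _) _]]];
    [assumption|now apply succ_not_Empty in H0|contradiction].
Qed.

Lemma Rec_succ a y : Rec step (succ a) y -> exists u, Rec step a u /\ step a u y.
Proof.
  rewrite Rec_iff. intros (Ha & f & Hf & Hy). pose proof Hf as (F1 & F2 & F3).
  destruct (F3 _ y (succ_in_self _) Hy) as [[H _]|[(c & u & Ec & Hu & Hs)|[H _]]].
  - now apply succ_not_Empty in H.
  - apply succ_inj in Ec as <-. exists u. split; [|assumption].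
    apply (attempt_Rec (succ a) f); try assumption. apply in_succ. left. apply succ_in_self.
  - now apply Limit_not_succ in H.
Qed.

Lemma Rec_Limit a y : Rec step a y -> Limit a ->
  forall z, E z y <-> exists c u, E c a /\ Rec step c u /\ E z u.
Proof.
  rewrite Rec_iff. intros (Ha & f & Hf & Hy) HL. pose proof Hf as (F1 & F2 & F3).
  destruct (F3 a y (succ_in_self a) Hy) as [[H _]|[(c & _ & -> & _)|[_ H]]];
    [now destruct HL as (_ & HL & _)|now apply Limit_not_succ in HL|].
  intro z. rewrite H. split; intros (c & u & Hc & Hu & Hz); exists c, u;
    (split; [assumption|]); (split; [|assumption]);
    assert (Hca : E c (succ a)) by (apply in_succ; now left).
  - now apply (attempt_Rec a f).
  - destruct (F2 c Hca) as (u' & Hu' & _).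
    rewrite (Rec_functional c u u' Hu); [assumption|]. now apply (attempt_Rec a f).
Qed.

(** Replacement collects the values below [a] into a function [g]; the value [v] that the clause at
    [a] prescribes is added as one more pair. *)
Lemma Rec_total a : Ord a -> exists y, Rec step a y.
Proof.
  revert a. ord_induction. intros a Ha IH.
  destruct (m_repl E S3 m0 HM (fun b p => exists y, Rec step b y /\ p = opair b y) ltac:(dfn) a)
    as [g Hg].
  { intros b p p' _ (y & Hy & ->) (y' & Hy' & ->). now rewrite (Rec_functional b y y'). }
  assert (Hv : exists v, (Empty a /\ Empty v)
    \/ (exists c u, a = succ c /\ Rec step c u /\ step c u v)
    \/ (Limit a /\ forall z, E z v <-> exists c u, E c a /\ Rec step c u /\ E z u)).
  { destruct (Ord_cases a Ha) as [H|[[c ->]|H]].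
    (* Here [a] is empty and itself serves as the empty value. *)
    - exists a. now left.
    - destruct (IH c (succ_in_self c)) as [u Hu].
      destruct (step_total c u) as [v Hv]; [exact (Ord_in _ _ Ha (succ_in_self c))|].
      exists v. right. left. now exists c, u.
    - destruct (m_repl E S3 m0 HM (Rec step) ltac:(dfn) a) as [s Hs].
      { intros b y y' _. apply Rec_functional. }
      exists (union s). right. right. split; [assumption|]. intro z. rewrite in_union. split.
      + intros (u & Hu & Hz). apply Hs in Hu as (c & Hc & Hu). now exists c, u.
      + intros (c & u & Hc & Hu & Hz). exists u. split; [|assumption]. apply Hs. now exists c. }
  destruct Hv as [v Hv]. exists v. apply Rec_iff. split; [assumption|].
  set (f := adj g (opair a v)).
  assert (Hf : forall b w, E (opair b w) f <-> (E b a /\ Rec step b w) \/ (b = a /\ w = v)).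
  { intros b w. unfold f. rewrite in_adj, Hg. split.
    - intros [(c & Hc & y & Hy & Ey)|H]; [left|right; now apply opair_inj].
      apply opair_inj in Ey as [-> ->]. now split.
    - intros [[Hb Hw]|[-> ->]]; [left|now right]. exists b. split; [assumption|]. now exists w. }
  assert (Hlt : forall c, E c a -> c <> a).
  { intros c Hc ->. exact (E_irrefl a Hc). }
  exists f. split; [split; [|split]|].
  - intros p Hp. apply in_adj in Hp as [Hp| ->].
    + apply Hg in Hp as (b & Hb & y & _ & ->). exists b, y. split; [|reflexivity].
      apply in_succ. now left.
    + exists a, v. split; [apply succ_in_self|reflexivity].
  - intros b Hb. apply in_succ in Hb as [Hb| ->].
    + destruct (IH b Hb) as [y Hy]. exists y. split; [apply Hf; now left|].
      intros z Hz. apply Hf in Hz as [[_ Hz]|[-> _]]; [|now apply E_irrefl in Hb].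
      exact (Rec_functional b z y Hz Hy).
    + exists v. split; [apply Hf; now right|].
      intros z Hz. apply Hf in Hz as [[Hz _]|[_ Hz]]; [now apply E_irrefl in Hz|assumption].
  - intros b w Hb Hw. apply Hf in Hw as [[Hb' Hw]|[-> ->]].
    + destruct (Ord_cases b (Ord_in _ _ Ha Hb')) as [H|[[c ->]|H]].
      * left. split; [assumption|]. exact (Rec_Empty b w Hw H).
      * right. left. apply Rec_succ in Hw as (u & Hu & Hs). exists c, u.
        split; [reflexivity|]. split; [|assumption]. apply Hf. left. split; [|assumption].
        exact (Ord_trans _ _ _ Ha Hb' (succ_in_self c)).
      * right. right. split; [assumption|]. intro z. rewrite (Rec_Limit b w Hw H).
        split; intros (c & u & Hc & Hu & Hz); exists c, u; (split; [assumption|]);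
          (split; [|assumption]); pose proof (Ord_trans _ _ _ Ha Hb' Hc) as Hca.
        -- apply Hf. now left.
        -- apply Hf in Hu as [[_ Hu]|[-> _]]; [assumption|now apply E_irrefl in Hca].
    + destruct Hv as [H|[(c & u & -> & Hu & Hs)|[H1 H2]]]; [now left|right; left|].
      * exists c, u. split; [reflexivity|]. split; [|assumption]. apply Hf. left.
        split; [apply succ_in_self|assumption].
      * right. right. split; [assumption|]. intro z. rewrite H2.
        split; intros (c & u & Hc & Hu & Hz); exists c, u; (split; [assumption|]);
          (split; [|assumption]).
        -- apply Hf. now left.
        -- apply Hf in Hu as [[_ Hu]|[-> _]]; [assumption|now apply E_irrefl in Hc].
  - apply Hf. now right.
Qed.

(** The default off the ordinals makes [rec] a total function with a definable graph. *)
Definition rec (a : M) : M := eps (fun y => (Ord a /\ Rec step a y) \/ (~ Ord a /\ y = m0)).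

Lemma rec_spec a y : y = rec a <-> (Ord a /\ Rec step a y) \/ (~ Ord a /\ y = m0).
Proof.
  assert (H : (Ord a /\ Rec step a (rec a)) \/ (~ Ord a /\ rec a = m0)).
  { apply (eps_spec (fun y => (Ord a /\ Rec step a y) \/ (~ Ord a /\ y = m0))).
    destruct (classic (Ord a)) as [Ha|Ha]; [|now exists m0; right].
    destruct (Rec_total a Ha) as [x Hx]. exists x. now left. }
  split; [now intros ->|]. intros [[Ha Hy]|[Ha ->]]; destruct H as [[H H']|[H H']]; try contradiction.
  - exact (Rec_functional a y _ Hy H').
  - now symmetry.
Qed.

Lemma Rec_rec a y : Rec step a y <-> Ord a /\ y = rec a.
Proof.
  split.
  - intro H. pose proof (proj1 (proj1 (Rec_iff a y) H)) as Ha. split; [assumption|].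
    apply rec_spec. now left.
  - intros [Ha H]. apply rec_spec in H as [[_ H]|[H _]]; [assumption|contradiction].
Qed.

Lemma definable_term_rec t : DfnT t -> DfnT (fun r => rec (t r)).
Proof.
  apply definable_term_fun1.
  apply (definable_iff E S3 (fun r => (Ord (r 1) /\ Rec step (r 1) (r 0)) \/ (~ Ord (r 1) /\ r 0 = m0))).
  - intro r. symmetry. apply rec_spec.
  - dfn.
Qed.

Lemma rec_Empty a : Ord a -> Empty a -> Empty (rec a).
Proof. intros Ha H0. apply (Rec_Empty a); [now apply Rec_rec|assumption]. Qed.

Lemma rec_succ a : Ord a -> step a (rec a) (rec (succ a)).
Proof.
  intro Ha. destruct (Rec_succ a (rec (succ a))) as (u & Hu & Hs).
  - apply Rec_rec. split; [now apply Ord_succ|reflexivity].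
  - apply Rec_rec in Hu as [_ ->]. assumption.
Qed.

Lemma rec_Limit a z : Limit a -> (E z (rec a) <-> exists c, E c a /\ E z (rec c)).
Proof.
  intro HL. pose proof (proj1 HL) as Ha. rewrite (Rec_Limit a (rec a)); [|now apply Rec_rec|assumption].
  split.
  - intros (c & u & Hc & Hu & Hz). apply Rec_rec in Hu as [_ ->]. now exists c.
  - intros (c & Hc & Hz). exists c, (rec c). rewrite Rec_rec.
    pose proof (Ord_in a c Ha Hc). auto.
Qed.

End Recursion.

(** ** The ordinals qa and the cumulative hierarchy *)

Lemma Plus_functional k u v v' : mPlus E k u v -> mPlus E k u v' -> v = v'.
Proof.
  revert u. induction k as [|k IH]; intro u; simpl; [congruence|].
  intros (w & Hw & H) (w' & Hw' & H'). apply Succ_iff in Hw, Hw'. subst. eauto.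
Qed.

Fixpoint succs (k : nat) (u : M) : M :=
  match k with 0 => u | S k => succs k (succ u) end.

Lemma Plus_iff k u v : mPlus E k u v <-> v = succs k u.
Proof.
  revert u. induction k as [|k IH]; intro u; simpl; [reflexivity|].
  split.
  - intros (w & Hw & H). apply Succ_iff in Hw as ->. now apply IH.
  - intro H. exists (succ u). split; [now apply Succ_iff|now apply IH].
Qed.

Lemma Q_step_dfn : Dfn (fun r => mQ_step E (r 0) (r 1) (r 2)).
Proof. dfn. Qed.

Lemma Q_step_functional g u v v' : mQ_step E g u v -> mQ_step E g u v' -> v = v'.
Proof. apply Plus_functional. Qed.

Lemma Q_step_total g u : Ord g -> exists v, mQ_step E g u v.
Proof. intros _. exists (succs q u). now apply Plus_iff. Qed.

Lemma V_step_dfn : Dfn (fun r => mV_step E (r 0) (r 1) (r 2)).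
Proof. dfn. Qed.

Lemma V_step_functional g u v v' : mV_step E g u v -> mV_step E g u v' -> v = v'.
Proof. intros H H'. apply ext. intro z. now rewrite (H z), (H' z). Qed.

Lemma V_step_total g u : Ord g -> exists v, mV_step E g u v.
Proof. intros _. destruct (m_power E S3 m0 HM u) as [v Hv]. now exists v. Qed.

Definition Qf := rec (mQ_step E).
Definition Vf := rec (mV_step E).

Lemma QR_iff a k : QR a k <-> Ord a /\ k = Qf a.
Proof. exact (Rec_rec _ Q_step_dfn Q_step_functional Q_step_total a k). Qed.

Lemma VR_iff a U : VR a U <-> Ord a /\ U = Vf a.
Proof. exact (Rec_rec _ V_step_dfn V_step_functional V_step_total a U). Qed.

Lemma definable_term_Qf t : DfnT t -> DfnT (fun r => Qf (t r)).
Proof. exact (definable_term_rec _ Q_step_dfn Q_step_functional Q_step_total t). Qed.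

Lemma definable_term_Vf t : DfnT t -> DfnT (fun r => Vf (t r)).
Proof. exact (definable_term_rec _ V_step_dfn V_step_functional V_step_total t). Qed.

Lemma Qf_Empty a : Ord a -> Empty a -> Empty (Qf a).
Proof. exact (rec_Empty _ Q_step_dfn Q_step_functional Q_step_total a). Qed.

Lemma Qf_succ a : Ord a -> Qf (succ a) = succs q (Qf a).
Proof.
  intro Ha. apply Plus_iff. exact (rec_succ _ Q_step_dfn Q_step_functional Q_step_total a Ha).
Qed.

Lemma Qf_Limit a z : Limit a -> (E z (Qf a) <-> exists c, E c a /\ E z (Qf c)).
Proof. exact (rec_Limit _ Q_step_dfn Q_step_functional Q_step_total a z). Qed.

Lemma Vf_Empty a : Ord a -> Empty a -> Empty (Vf a).
Proof. exact (rec_Empty _ V_step_dfn V_step_functional V_step_total a). Qed.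

Lemma Vf_succ a z : Ord a -> (E z (Vf (succ a)) <-> Sub z (Vf a)).
Proof. intro Ha. exact (rec_succ _ V_step_dfn V_step_functional V_step_total a Ha z). Qed.

Lemma Vf_Limit a z : Limit a -> (E z (Vf a) <-> exists c, E c a /\ E z (Vf c)).
Proof. exact (rec_Limit _ V_step_dfn V_step_functional V_step_total a z). Qed.

Ltac dfn_fun ::=
  lazymatch goal with
  | |- definable_term _ _ (fun r => upair (@?t r) (@?u r)) => apply (definable_term_upair t u)
  | |- definable_term _ _ (fun r => union (@?t r)) => apply (definable_term_union t)
  | |- definable_term _ _ (fun r => Qf (@?t r)) => apply (definable_term_Qf t)
  | |- definable_term _ _ (fun r => Vf (@?t r)) => apply (definable_term_Vf t)
  | H : definable _ _ (fun r => ?P (r 0)) |- definable _ _ (fun r => ?P (@?t r)) =>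
      apply (definable_pred1 E S3 P t H)
  | |- _ => progress cbv beta delta [opair tri adj succ]
  end.

Lemma Ord_succs k a : Ord a -> Ord (succs k a).
Proof. revert a. induction k as [|k IH]; intros a Ha; simpl; [assumption|]. now apply IH, Ord_succ. Qed.

Lemma in_succs k a x : E x a -> E x (succs k a).
Proof.
  revert a. induction k as [|k IH]; intros a Ha; simpl; [assumption|].
  apply IH, in_succ. now left.
Qed.

Lemma in_succs_self k a : E a (succs (S k) a).
Proof. simpl. apply in_succs, succ_in_self. Qed.

Lemma Ord_Qf a : Ord a -> Ord (Qf a).
Proof.
  revert a. ord_induction. intros a Ha IH.
  destruct (Ord_cases a Ha) as [H|[[c ->]|H]].
  - pose proof (Qf_Empty a Ha H) as H0. split; intros x Hx; destruct (H0 x Hx).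
  - pose proof (succ_in_self c). rewrite Qf_succ by now apply (Ord_in (succ c)). now apply Ord_succs, IH.
  - split.
    + intros x Hx y Hy. apply Qf_Limit in Hx as (c & Hc & Hx); [|assumption].
      apply Qf_Limit; [assumption|]. exists c. split; [assumption|].
      exact (Ord_trans _ _ _ (IH c Hc) Hx Hy).
    + intros x Hx. apply Qf_Limit in Hx as (c & Hc & Hx); [|assumption].
      exact (proj1 (Ord_in _ _ (IH c Hc) Hx)).
Qed.

Lemma Qf_mono a : Ord a -> forall b, E b a -> E (Qf b) (Qf a).
Proof.
  revert a. ord_induction. intros a Ha IH b Hb.
  destruct (Ord_cases a Ha) as [H|[[c ->]|H]].
  - destruct (H b Hb).
  - pose proof (Ord_in _ _ Ha (succ_in_self c)) as Oc. rewrite Qf_succ by assumption.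
    apply in_succ in Hb as [Hb| ->]; [|apply in_succs_self].
    apply in_succs. now apply IH; [apply succ_in_self|].
  - pose proof (Limit_succ a b H Hb) as Hs. apply Qf_Limit; [assumption|].
    exists (succ b). split; [assumption|]. rewrite Qf_succ by now apply (Ord_in a).
    apply in_succs_self.
Qed.

Lemma Qf_sub a : Ord a -> Sub a (Qf a).
Proof.
  revert a. ord_induction. intros a Ha IH b Hb.
  pose proof (Ord_in _ _ Ha Hb) as Ob. pose proof (Qf_mono a Ha b Hb) as Hm.
  destruct (Ord_sub b (Qf b) Ob (Ord_Qf b Ob) (IH b Hb)) as [H|H].
  - exact (Ord_trans _ _ _ (Ord_Qf a Ha) Hm H).
  - now rewrite <- H in Hm.
Qed.

(** Merges the three recursion clauses into one; monotonicity and transitivity of the levels follow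
    from it. *)
Lemma Vf_iff a : Ord a -> forall z, E z (Vf a) <-> exists b, E b a /\ Sub z (Vf b).
Proof.
  revert a. ord_induction. intros a Ha IH z.
  destruct (Ord_cases a Ha) as [H|[[c ->]|H]].
  - split; [intro Hz; destruct (Vf_Empty a Ha H z Hz)|intros (b & Hb & _); destruct (H b Hb)].
  - pose proof (Ord_in _ _ Ha (succ_in_self c)) as Oc. rewrite Vf_succ by assumption. split.
    + intro Hz. exists c. split; [apply succ_in_self|assumption].
    + intros (b & Hb & Hz). apply in_succ in Hb as [Hb| ->]; [|assumption].
      intros y Hy. apply Hz in Hy.
      assert (Hbs : E b (succ c)) by (apply in_succ; now left).
      apply (IH b Hbs) in Hy as (d & Hd & Hy). apply (IH c (succ_in_self c)).
      exists d. split; [|assumption]. exact (Ord_trans _ _ _ Oc Hb Hd).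
  - rewrite Vf_Limit by assumption. split.
    + intros (c & Hc & Hz). apply (IH c Hc) in Hz as (b & Hb & Hz). exists b.
      split; [|assumption]. exact (Ord_trans _ _ _ Ha Hc Hb).
    + intros (b & Hb & Hz). exists (succ b). split; [now apply Limit_succ|].
      apply Vf_succ; [now apply (Ord_in a)|assumption].
Qed.

Lemma Vf_sub a b : Ord a -> Ord b -> Sub a b -> Sub (Vf a) (Vf b).
Proof.
  intros Ha Hb Hs z Hz. apply (Vf_iff a Ha) in Hz as (c & Hc & Hz).
  apply (Vf_iff b Hb). exists c. auto.
Qed.

Lemma Vf_sub_in a b : Ord a -> E b a -> Sub (Vf b) (Vf a).
Proof.
  intros Ha Hb. apply Vf_sub; [now apply (Ord_in a)|assumption|].
  intros x Hx. exact (Ord_trans _ _ _ Ha Hb Hx).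
Qed.

Lemma Vf_transitive a x y : Ord a -> E x (Vf a) -> E y x -> E y (Vf a).
Proof.
  intros Ha Hx Hy. apply (Vf_iff a Ha) in Hx as (b & Hb & Hx).
  exact (Vf_sub_in a b Ha Hb y (Hx y Hy)).
Qed.

Lemma Ord_notin_Vf a : Ord a -> ~ E a (Vf a).
Proof.
  revert a. ord_induction. intros a Ha IH H.
  apply (Vf_iff a Ha) in H as (b & Hb & H). exact (IH b Hb (H b Hb)).
Qed.

Lemma Ord_sub_Vf a : Ord a -> Sub a (Vf a).
Proof.
  revert a. ord_induction. intros a Ha IH b Hb.
  apply (Vf_iff a Ha). exists b. auto.
Qed.

(** Foundation acts inside a set, and the transitive closure axiom supplies one in which to choose a
    minimal counterexample [m]. All elements of [m] then have a level, and the level after the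
    supremum of the least ones contains [m]. *)
Lemma in_some_Vf x : exists a, Ord a /\ E x (Vf a).
Proof.
  apply NNPP. intro Hx. destruct (m_tc E S3 m0 HM (upair x x)) as (t & Ht & Hxt).
  destruct (E_min (fun z => ~ exists a, Ord a /\ E z (Vf a)) t x) as (m & Hm & Hno & Hmin);
    [dfn|apply Hxt, in_upair; now left|assumption|].
  (* Replacement needs a functional relation, hence the least [a] whose level contains [y]. *)
  destruct (m_repl E S3 m0 HM
    (fun y a => Ord a /\ E y (Vf a) /\ forall b, E b a -> ~ E y (Vf b)) ltac:(dfn) m) as [s Hs].
  { intros y a b _ (Ha & Hya & Hmina) (Hb & Hyb & Hminb).
    destruct (Ord_trichotomy a b Ha Hb) as [H|[H|H]]; [|assumption|].
    - destruct (Hminb a H Hya).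
    - destruct (Hmina b H Hyb). }
  assert (Hos : Ord (union s)).
  { apply Ord_union. intros a Ha. apply Hs in Ha as (y & _ & Ha & _). assumption. }
  apply Hno. exists (succ (union s)). split; [now apply Ord_succ|]. apply Vf_succ; [assumption|].
  intros y Hy. specialize (Hmin y (Ht m Hm y Hy) Hy). apply NNPP in Hmin as (a & Ha & Hya).
  destruct (E_min (fun b => E y (Vf b)) (succ a) a) as (b & Hb & Hyb & Hminb);
    [dfn|apply succ_in_self|assumption|].
  pose proof (Ord_in _ _ (Ord_succ a Ha) Hb) as Ob.
  assert (Hbs : E b s).
  { apply Hs. exists y. split; [assumption|]. split; [assumption|]. split; [assumption|].
    intros c Hc. apply Hminb; [|assumption]. exact (Ord_trans _ _ _ (Ord_succ a Ha) Hb Hc). }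
  refine (Vf_sub b (union s) Ob Hos _ y Hyb). intros c Hc. apply in_union. now exists b.
Qed.

Lemma Ord_max a b : Ord a -> Ord b -> exists c, Ord c /\ Sub a c /\ Sub b c.
Proof.
  intros Ha Hb. exists (union (upair a b)). split.
  - apply Ord_union. intros x Hx. apply in_upair in Hx as [->| ->]; assumption.
  - split; intros x Hx; apply in_union; eexists; rewrite in_upair; split;
      try exact Hx; auto.
Qed.

Definition VQ a := Vf (Qf a).

Lemma Qf_sub_sub a b : Ord a -> Ord b -> Sub a b -> Sub (Qf a) (Qf b).
Proof.
  intros Ha Hb Hs. destruct (Ord_sub a b Ha Hb Hs) as [H| ->]; [|easy].
  intros x Hx. exact (Ord_trans _ _ _ (Ord_Qf b Hb) (Qf_mono b Hb a H) Hx).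
Qed.

Lemma VQ_sub a b : Ord a -> Ord b -> Sub a b -> Sub (VQ a) (VQ b).
Proof. intros Ha Hb Hs. apply Vf_sub; auto using Ord_Qf, Qf_sub_sub. Qed.

Lemma VQ_sub_in a b : Ord a -> E b a -> Sub (VQ b) (VQ a).
Proof.
  intros Ha Hb. apply VQ_sub; [now apply (Ord_in a)|assumption|].
  intros x Hx. exact (Ord_trans _ _ _ Ha Hb Hx).
Qed.

Lemma VQ_Limit a x : Limit a -> E x (VQ a) -> exists b, E b a /\ E x (VQ b).
Proof.
  intros HL Hx. pose proof (proj1 HL) as Ha. apply (Vf_iff _ (Ord_Qf a Ha)) in Hx as (c & Hc & Hx).
  apply Qf_Limit in Hc as (b & Hb & Hc); [|assumption]. exists b. split; [assumption|].
  apply (Vf_iff _ (Ord_Qf b (Ord_in a b Ha Hb))). now exists c.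
Qed.

Lemma in_some_VQ l : exists a, Ord a /\ forall x, In x l -> E x (VQ a).
Proof.
  induction l as [|x l (a & Ha & IH)].
  - destruct (in_some_Vf m0) as (a & Ha & _). exists a. split; [assumption|contradiction].
  - destruct (in_some_Vf x) as (b & Hb & Hx). destruct (Ord_max a b Ha Hb) as (c & Hc & Hac & Hbc).
    exists c. split; [assumption|]. intros y [<-|Hy].
    + refine (Vf_sub b (Qf c) Hb (Ord_Qf c Hc) _ x Hx). intros z Hz. apply Qf_sub; auto.
    + exact (VQ_sub a c Ha Hc Hac y (IH y Hy)).
Qed.

(** ** The relations S_a *)

Lemma upair_in_Vf a x y : Ord a -> E x (Vf a) -> E y (Vf a) -> E (upair x y) (Vf (succ a)).
Proof.
  intros Ha Hx Hy. apply Vf_succ; [assumption|]. intros z Hz.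
  apply in_upair in Hz as [->| ->]; assumption.
Qed.

Lemma Vf_sub_succ a : Ord a -> Sub (Vf a) (Vf (succ a)).
Proof. intro Ha. apply Vf_sub_in; [now apply Ord_succ|apply succ_in_self]. Qed.

Lemma opair_in_Vf a x y : Ord a -> E x (Vf a) -> E y (Vf a) -> E (opair x y) (Vf (succs 2 a)).
Proof.
  intros Ha Hx Hy. apply upair_in_Vf; [now apply Ord_succ|now apply upair_in_Vf..].
Qed.

Lemma Vf_sub_succs k a : Ord a -> Sub (Vf a) (Vf (succs k a)).
Proof.
  revert a. induction k as [|k IH]; intros a Ha x Hx; [assumption|].
  apply (IH (succ a) (Ord_succ a Ha)). now apply Vf_sub_succ.
Qed.

Lemma tri_in_Vf a x y z : Ord a -> E x (Vf a) -> E y (Vf a) -> E z (Vf a) ->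
  E (tri x y z) (Vf (succs 4 a)).
Proof.
  intros Ha Hx Hy Hz. apply (opair_in_Vf (succs 2 a)); [now apply Ord_succs|now apply opair_in_Vf|].
  now apply (Vf_sub_succs 2).
Qed.

Lemma R_step_iff g Q Q' : mR_step E g Q Q' <-> Ord g /\
  forall t, E t Q' <-> exists a b c, E a (VQ (succ g)) /\ E b (VQ (succ g)) /\ E c (VQ (succ g))
    /\ t = tri a b c /\ mSnext E (Qf g) (VQ g) Q a b c.
Proof.
  unfold mR_step. setoid_rewrite QR_iff. setoid_rewrite VR_iff. setoid_rewrite Succ_iff.
  setoid_rewrite Triple_iff. split.
  - intros (k & U & g' & k' & U' & (Hg & ->) & (_ & ->) & -> & (_ & ->) & (_ & ->) & H). now split.
  - intros (Hg & H). exists (Qf g), (VQ g), (succ g), (Qf (succ g)), (VQ (succ g)).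
    pose proof (Ord_succ g Hg) as Hg'. pose proof (Ord_Qf g Hg). pose proof (Ord_Qf (succ g) Hg').
    do 5 (split; [now try split|]). exact H.
Qed.

Lemma R_step_dfn : Dfn (fun r => mR_step E (r 0) (r 1) (r 2)).
Proof. dfn. Qed.

Lemma R_step_functional g u v v' : mR_step E g u v -> mR_step E g u v' -> v = v'.
Proof.
  rewrite !R_step_iff. intros [_ H] [_ H']. apply ext. intro t. now rewrite H, H'.
Qed.

Lemma R_step_total g u : Ord g -> exists v, mR_step E g u v.
Proof.
  intro Hg. pose proof (Ord_Qf _ (Ord_succ g Hg)) as HQ.
  (* A triple is two nested Kuratowski pairs, each adding 2 to the rank; the level
     [succs 4 (Qf (succ g))] thus contains every triple concerned. *)
  destruct (sep (fun t => exists a b c, E a (VQ (succ g)) /\ E b (VQ (succ g)) /\ E c (VQ (succ g))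
    /\ t = tri a b c /\ mSnext E (Qf g) (VQ g) u a b c)
    ltac:(unfold VQ; dfn) (Vf (succs 4 (Qf (succ g))))) as [v Hv].
  exists v. apply R_step_iff. split; [assumption|]. intro t. rewrite Hv.
  split; [tauto|]. intro H. split; [|assumption].
  destruct H as (a & b & c & Ha & Hb & Hc & -> & _). now apply tri_in_Vf.
Qed.

Definition Rf := rec (mR_step E).
Definition S_at al a b c := E (tri a b c) (Rf al).

Lemma RR_iff a R : RR a R <-> Ord a /\ R = Rf a.
Proof. exact (Rec_rec _ R_step_dfn R_step_functional R_step_total a R). Qed.

Lemma definable_term_Rf t : DfnT t -> DfnT (fun r => Rf (t r)).
Proof. exact (definable_term_rec _ R_step_dfn R_step_functional R_step_total t). Qed.

Lemma S_at_Empty al a b c : Ord al -> Empty al -> ~ S_at al a b c.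
Proof.
  intros Ha H0. exact (rec_Empty _ R_step_dfn R_step_functional R_step_total al Ha H0 _).
Qed.

Lemma S_at_succ g a b c : Ord g ->
  (S_at (succ g) a b c <-> E a (VQ (succ g)) /\ E b (VQ (succ g)) /\ E c (VQ (succ g))
    /\ mSnext E (Qf g) (VQ g) (Rf g) a b c).
Proof.
  intro Hg. pose proof (rec_succ _ R_step_dfn R_step_functional R_step_total g Hg) as H.
  apply R_step_iff in H as [_ H]. unfold S_at. unfold Rf at 1. rewrite H. split.
  - intros (a' & b' & c' & Ha & Hb & Hc & Et & HS).
    apply tri_inj in Et as (-> & -> & ->). auto.
  - intros (Ha & Hb & Hc & HS). exists a, b, c. auto.
Qed.

Lemma S_at_Limit al a b c : Limit al -> (S_at al a b c <-> exists g, E g al /\ S_at g a b c).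
Proof. exact (rec_Limit _ R_step_dfn R_step_functional R_step_total al (tri a b c)). Qed.

Ltac dfn_fun ::=
  lazymatch goal with
  | |- definable_term _ _ (fun r => upair (@?t r) (@?u r)) => apply (definable_term_upair t u)
  | |- definable_term _ _ (fun r => union (@?t r)) => apply (definable_term_union t)
  | |- definable_term _ _ (fun r => Qf (@?t r)) => apply (definable_term_Qf t)
  | |- definable_term _ _ (fun r => Vf (@?t r)) => apply (definable_term_Vf t)
  | |- definable_term _ _ (fun r => Rf (@?t r)) => apply (definable_term_Rf t)
  | |- _ => progress cbv beta delta [opair tri adj succ VQ S_at]
  end.

Lemma S_at_dom al : Ord al -> forall a b c, S_at al a b c ->
  E a (VQ al) /\ E b (VQ al) /\ E c (VQ al).
Proof.
  revert al. ord_induction. intros al Ha IH a b c HS.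
  destruct (Ord_cases al Ha) as [H|[[g ->]|H]].
  - destruct (S_at_Empty _ _ _ _ Ha H HS).
  - apply S_at_succ in HS; [tauto|]. exact (Ord_in _ _ Ha (succ_in_self g)).
  - apply S_at_Limit in HS as (g & Hg & HS); [|assumption].
    destruct (IH g Hg _ _ _ HS) as (Ia & Ib & Ic). pose proof (VQ_sub_in al g Ha Hg). auto.
Qed.

Lemma S_at_succ_old g a b c : Ord g -> E a (VQ g) -> E b (VQ g) -> E c (VQ g) ->
  (S_at (succ g) a b c <-> S_at g a b c).
Proof.
  intros Hg Ha Hb Hc. rewrite S_at_succ by assumption.
  pose proof (VQ_sub_in (succ g) g (Ord_succ g Hg) (succ_in_self g)) as Hs.
  unfold mSnext. rewrite Holds_iff. unfold S_at. split.
  - intros (_ & _ & _ & [[_ H]|[[H _]|[H _]]]); [assumption|tauto|tauto].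
  - intro H. repeat (split; [now apply Hs|]). tauto.
Qed.

Lemma S_at_coherent be : Ord be -> forall al, E al be ->
  forall a b c, E a (VQ al) -> E b (VQ al) -> E c (VQ al) -> (S_at be a b c <-> S_at al a b c).
Proof.
  revert be. ord_induction. intros be Hbe IH al Hal a b c Ha Hb Hc.
  destruct (Ord_cases be Hbe) as [H|[[g ->]|H]].
  - destruct (H al Hal).
  - pose proof (Ord_in _ _ Hbe (succ_in_self g)) as Hg. apply in_succ in Hal as [Hal| ->].
    + pose proof (VQ_sub_in g al Hg Hal) as Hs.
      rewrite S_at_succ_old by auto. now apply (IH g (succ_in_self g)).
    + now apply S_at_succ_old.
  - rewrite S_at_Limit by assumption. split; [|intro HS; now exists al].
    intros (g & Hg & HS).
    destruct (Ord_trichotomy g al (Ord_in _ _ Hbe Hg) (Ord_in _ _ Hbe Hal)) as [Hga|[->|Hag]].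
    + destruct (S_at_dom g (Ord_in _ _ Hbe Hg) _ _ _ HS) as (Ia & Ib & Ic).
      now apply (IH al Hal g Hga).
    + assumption.
    + now apply (IH g Hg al Hag).
Qed.

Lemma S_at_sub al be a b c : Ord al -> Ord be -> Sub al be ->
  E a (VQ al) -> E b (VQ al) -> E c (VQ al) -> (S_at be a b c <-> S_at al a b c).
Proof.
  intros Ha Hb Hs. destruct (Ord_sub al be Ha Hb Hs) as [H| ->]; [|tauto].
  now apply S_at_coherent.
Qed.

(** The level supplied by the definition of S and the level [al] are compared inside a common larger
    one, where the relations cohere. *)
Lemma S3_at al a b c : Ord al -> E a (VQ al) -> E b (VQ al) -> E c (VQ al) ->
  (S3 a b c <-> S_at al a b c).
Proof.
  intros Hal Ha Hb Hc. rewrite S3_definition.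
  setoid_rewrite QR_iff. setoid_rewrite VR_iff. setoid_rewrite RR_iff. setoid_rewrite Holds_iff.
  split.
  - intros (be & k & U & R & (Hbe & ->) & (_ & ->) & Ia & Ib & Ic & (_ & ->) & HS).
    destruct (Ord_max al be Hal Hbe) as (g & Hg & H1 & H2).
    apply (S_at_sub al g); try assumption. now apply (S_at_sub be g).
  - intro HS. exists al, (Qf al), (VQ al), (Rf al). pose proof (Ord_Qf al Hal).
    do 2 (split; [now split|]). do 3 (split; [assumption|]). now split.
Qed.

(** ** The two properties of S used by the construction *)

Lemma W_iff w k A SA : mW E w k A SA <-> w = opair k (opair A SA).
Proof.
  unfold mW. setoid_rewrite Opair_iff. split; [now intros (p & -> & ->)|intros ->; eauto].
Qed.

(** [k] belongs to [{k}], which belongs to the pair; levels are transitive, and [k] is not in its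
    own level. *)
Lemma w_notin_Vf k A SA : Ord k -> ~ E (opair k (opair A SA)) (Vf k).
Proof.
  intros Hk H. apply (Ord_notin_Vf k Hk).
  apply (Vf_transitive k (upair k k)); [assumption| |apply in_upair; now left].
  apply (Vf_transitive k _ _ Hk H). apply in_upair. now left.
Qed.

(** Both elements of a Kuratowski pair contain its first coordinate. With the ordinal [k] in that
    place, no old set is an element of [w]. *)
Lemma in_w_notin_Vf k A SA x : Ord k -> E x (opair k (opair A SA)) -> ~ E x (Vf k).
Proof.
  intros Hk Hx H. apply (Ord_notin_Vf k Hk). apply (Vf_transitive k x _ Hk H).
  apply in_upair in Hx as [->| ->]; apply in_upair; now left.
Qed.

(** At a successor step, an uncovered new triple satisfies S by definition. In a covered one [a] and
    [b] lie in [A], since [w] neither contains nor belongs to a point of [A]; so [c = w], and the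
    last clause of goodness applies. *)
Lemma S_at_of_mem al : Ord al -> forall a b c,
  E a (VQ al) -> E b (VQ al) -> E c (VQ al) -> E a b -> S_at al a b c.
Proof.
  revert al. ord_induction. intros al Hal IH a b c Ha Hb Hc Hab.
  destruct (Ord_cases al Hal) as [H|[[g ->]|H]].
  - destruct (Vf_Empty _ (Ord_Qf al Hal) (Qf_Empty al Hal H) a Ha).
  - pose proof (Ord_in _ _ Hal (succ_in_self g)) as Hg. pose proof (Ord_Qf g Hg) as Hk.
    apply S_at_succ; [assumption|]. do 3 (split; [assumption|]).
    unfold mSnext. rewrite Holds_iff.
    destruct (classic (E a (VQ g) /\ E b (VQ g) /\ E c (VQ g))) as [Hold|Hold].
    { left. split; [assumption|]. destruct Hold as (Ia & Ib & Ic).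
      now apply (IH g (succ_in_self g)). }
    right.
    destruct (classic (exists A SA w, mCovers E (Qf g) (VQ g) (Rf g) A SA w a b c)) as [Hcov|Hcov];
      [left|right; now split].
    split; [assumption|]. destruct Hcov as (A & SA & w & Hcov). exists A, SA, w.
    split; [assumption|]. destruct Hcov as ((HA & _ & _ & HSA) & Hw & Ca & Cb & Cc).
    apply W_iff in Hw.
    assert (Hwn : ~ E w (VQ g)) by (rewrite Hw; now apply w_notin_Vf).
    assert (HbA : E b A).
    { destruct Cb as [Hb'| ->]; [assumption|]. exfalso. destruct Ca as [Ha'| ->].
      - rewrite Hw in Hab. now apply (in_w_notin_Vf _ _ _ _ Hk Hab), HA.
      - now apply E_irrefl in Hab. }
    assert (HaA : E a A).
    { destruct Ca as [Ha'| ->]; [assumption|]. exfalso. apply Hwn.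
      exact (Vf_transitive _ b w Hk (HA b HbA) Hab). }
    assert (Hcw : c = w).
    { destruct Cc as [Hc'|Hc']; [|assumption]. exfalso. apply Hold. auto. }
    assert (Hne : forall x, E x A -> x <> w) by (intros x Hx ->; apply Hwn; auto).
    exists a, b, (Qf g). unfold mRepl. split; [right; auto|]. split; [right; auto|].
    split; [now left|]. now apply HSA.
  - destruct (VQ_Limit al a H Ha) as (x & Hx & Ia). destruct (VQ_Limit al b H Hb) as (y & Hy & Ib).
    destruct (VQ_Limit al c H Hc) as (z & Hz & Ic).
    (* The three arguments appear at three levels below the limit; the largest of them holds all
       three. *)
    assert (Hmax : forall x y, E x al -> E y al -> exists m, E m al /\ Sub (VQ x) (VQ m) /\ Sub (VQ y) (VQ m)).
    { clear x y Hx Hy Ia Ib. intros x y Hx Hy. pose proof (Ord_in _ _ Hal Hx) as Ox.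
      pose proof (Ord_in _ _ Hal Hy) as Oy.
      destruct (Ord_trichotomy x y Ox Oy) as [Hxy|[->|Hxy]].
      - exists y. split; [assumption|]. split; [now apply VQ_sub_in|easy].
      - exists y. now split.
      - exists x. split; [assumption|]. split; [easy|now apply VQ_sub_in]. }
    destruct (Hmax x y Hx Hy) as (m & Hm & M1 & M2). destruct (Hmax m z Hm Hz) as (n & Hn & N1 & N2).
    apply S_at_Limit; [assumption|]. exists n. split; [assumption|]. apply (IH n Hn); auto.
Qed.

Lemma S3_of_mem a b c : E a b -> S3 a b c.
Proof.
  intro Hab. destruct (in_some_VQ [a; b; c]) as (al & Hal & H).
  assert (Ia : E a (VQ al)) by (apply H; simpl; auto).
  assert (Ib : E b (VQ al)) by (apply H; simpl; auto).
  assert (Ic : E c (VQ al)) by (apply H; simpl; auto).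
  apply (S3_at al); try assumption. now apply S_at_of_mem.
Qed.

(** Adjunction along the external list replaces separation, so [P] may be undefinable; this is what
    admits arbitrary types [tau] below. *)
Lemma finite_set (l : list M) (P : M -> Prop) : exists s, forall x, E x s <-> In x l /\ P x.
Proof.
  induction l as [|y l [s Hs]].
  - destruct (m_empty E S3 m0 HM) as [s Hs]. exists s. intro x. split; [|intros [[] _]].
    intro Hx. destruct (Hs x Hx).
  - destruct (classic (P y)) as [Hy|Hy].
    + exists (adj s y). intro x. rewrite in_adj, Hs. simpl. split.
      * intros [[H1 H2]| ->]; auto.
      * intros [[->|H1] H2]; auto.
    + exists s. intro x. rewrite Hs. simpl. split; [tauto|].
      intros [[->|H1] H2]; [contradiction|now split].
Qed.

(** [A] consists of the points of [l]; [SA] describes [tau] with [k] in the role of the new point,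
    and S on [A]. The hypothesis on [tau] is the last clause of goodness, so the pair is good, and S
    at triples through [w] is read off from [SA]. *)
Lemma S3_extension (l : list M) (tau : option M -> option M -> option M -> Prop) :
  (forall x y, In x l -> In y l -> E x y -> tau (Some x) (Some y) None) ->
  exists w, ~ In w l /\ (forall x, In x (w :: l) -> ~ E x w /\ ~ E w x)
    /\ forall x y z, (forall v, Some v = x \/ Some v = y \/ Some v = z -> In v l) ->
         x = None \/ y = None \/ z = None ->
         (S3 (or_new w x) (or_new w y) (or_new w z) <-> tau x y z).
Proof.
  intro Htau. destruct (in_some_VQ l) as (al & Hal & Hl).
  set (k := Qf al). pose proof (Ord_Qf al Hal) as Hk. fold k in Hk.
  pose proof (Ord_notin_Vf k Hk) as Hkn.
  assert (Hkl : ~ In k l) by (intro H; exact (Hkn (Hl k H))).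
  destruct (finite_set l (fun _ => True)) as [A HA'].
  assert (HA : forall x, E x A <-> In x l) by (intro x; rewrite HA'; tauto).
  set (ok x := forall v, Some v = x -> In v l).
  set (holds x y z := ((x = None \/ y = None \/ z = None) /\ tau x y z)
    \/ (~ (x = None \/ y = None \/ z = None) /\ S_at al (or_new k x) (or_new k y) (or_new k z))).
  (* [finite_set] selects from a list, so all triples over [k] and the points of [l] are listed as
     candidates. *)
  set (tris := map (fun t => tri (fst t) (fst (snd t)) (snd (snd t)))
    (list_prod (k :: l) (list_prod (k :: l) (k :: l)))).
  destruct (finite_set tris (fun t => exists x y z : option M, ok x /\ ok y /\ ok z
    /\ t = tri (or_new k x) (or_new k y) (or_new k z) /\ holds x y z)) as [SA HSA'].
  assert (Hor : forall x : option M, ok x -> In (or_new k x) (k :: l)).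
  { intros [x|] Hx; simpl; auto. }
  (* [k] is not in its own level, hence not in [l]: the placeholder is never confused with a point
     of [l]. *)
  assert (Hinj : forall x y : option M, ok x -> ok y -> or_new k x = or_new k y -> x = y).
  { intros [x|] [y|] Hx Hy; simpl; try congruence; intros ->; exfalso; apply Hkl; auto. }
  assert (HSA : forall x y z, ok x -> ok y -> ok z ->
    (E (tri (or_new k x) (or_new k y) (or_new k z)) SA <-> holds x y z)).
  { intros x y z Hx Hy Hz. rewrite HSA'. split.
    - intros (_ & x' & y' & z' & Hx' & Hy' & Hz' & Et & H).
      apply tri_inj in Et as (E1 & E2 & E3).
      rewrite (Hinj x x'), (Hinj y y'), (Hinj z z'); assumption.
    - intro H. split; [|exists x, y, z; auto].
      apply in_map_iff. exists (or_new k x, (or_new k y, or_new k z)). split; [reflexivity|].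
      repeat apply in_prod; auto. }
  assert (Hsome : forall x, In x l -> ok (Some x)) by (intros x Hx v [= ->]; assumption).
  assert (Hnone : ok None) by (intros v; discriminate).
  set (w := opair k (opair A SA)).
  assert (Hwn : ~ E w (VQ al)) by now apply w_notin_Vf.
  assert (Hgood : mGood E k (VQ al) (Rf al) A SA).
  { split; [intros x Hx; now apply Hl, HA|]. setoid_rewrite Triple_iff. setoid_rewrite Holds_iff.
    split; [|split].
    - intros t Ht. apply HSA' in Ht as (_ & x & y & z & Hx & Hy & Hz & -> & _).
      exists (or_new k x), (or_new k y), (or_new k z). rewrite !HA.
      destruct (Hor x Hx) as [<-|?], (Hor y Hy) as [<-|?], (Hor z Hz) as [<-|?]; auto 6.
    - intros a b c. rewrite !HA. intros Ha Hb Hc.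
      rewrite (HSA (Some a) (Some b) (Some c)) by auto.
      unfold holds, S_at. simpl. intuition congruence.
    - intros a b. rewrite !HA. intros Ha Hb Hab.
      apply (HSA (Some a) (Some b) None); auto. left. auto. }
  pose proof (Ord_succ al Hal) as Hal'.
  (* The count behind q = 10. The points of [l] and [k] lie in the level k + 1, their triples in k +
     5, so [SA] and [A] lie in k + 6. The pair [(A, SA)] adds 2, and the pair with [k] adds another
     2, which gives k + 10. *)
  assert (HVw : E w (VQ (succ al))).
  { unfold VQ. rewrite Qf_succ by assumption. fold k.
    pose proof (fun n => Ord_succs n k Hk) as Hs.
    assert (Hk1 : E k (Vf (succ k))) by (apply Vf_succ; [assumption|now apply Ord_sub_Vf]).
    assert (HA1 : E A (Vf (succs 6 k))).
    { apply (Vf_sub_succs 5 (succ k) (Ord_succ k Hk)).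
      apply Vf_succ; [assumption|]. intros x Hx. now apply Hl, HA. }
    assert (HSA1 : E SA (Vf (succs 6 k))).
    { change (succs 6 k) with (succ (succs 5 k)). apply Vf_succ; [apply Hs|]. intros t Ht.
      apply HSA' in Ht as (_ & x & y & z & Hx & Hy & Hz & -> & _).
      assert (Ho : forall o : option M, ok o -> E (or_new k o) (Vf (succ k))).
      { intros o Ho. destruct (Hor o Ho) as [<-|H]; [assumption|].
        apply Vf_sub_succ; [assumption|]. now apply Hl. }
      apply (tri_in_Vf (succ k)); auto using Ord_succ. }
    apply (opair_in_Vf (succs 8 k)); [apply Hs| |].
    - now apply (Vf_sub_succs 7 (succ k) (Ord_succ k Hk)).
    - apply (opair_in_Vf (succs 6 k)); [apply Hs|assumption|assumption]. }
  exists w. split; [intro H; exact (Hwn (Hl w H))|]. split.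
  { intros x [<-|Hx]; [split; apply E_irrefl|]. split; intro H.
    - exact (in_w_notin_Vf _ _ _ _ Hk H (Hl x Hx)).
    - exact (Hwn (Vf_transitive k x w Hk (Hl x Hx) H)). }
  intros x y z Hxyz Hnew.
  assert (Ox : ok x) by (intros v Hv; apply Hxyz; auto).
  assert (Oy : ok y) by (intros v Hv; apply Hxyz; auto).
  assert (Oz : ok z) by (intros v Hv; apply Hxyz; auto).
  assert (HV : forall o, ok o -> E (or_new w o) (VQ (succ al))).
  { intros [v|] Ho; [|exact HVw]. simpl.
    apply (VQ_sub_in (succ al) al Hal' (succ_in_self al)). auto. }
  rewrite (S3_at (succ al)), S_at_succ by auto. fold k.
  assert (Hold : ~ (E (or_new w x) (VQ al) /\ E (or_new w y) (VQ al) /\ E (or_new w z) (VQ al))).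
  { destruct Hnew as [->|[->| ->]]; simpl; tauto. }
  assert (Hcase : forall o, ok o -> E (or_new w o) A \/ or_new w o = w).
  { intros [v|] Ho; [left; apply HA; auto|now right]. }
  assert (Hcov : mCovers E k (VQ al) (Rf al) A SA w (or_new w x) (or_new w y) (or_new w z)).
  { split; [assumption|]. split; [now apply W_iff|]. auto. }
  assert (Hrepl : forall o, ok o -> forall v, mRepl w k (or_new w o) v <-> v = or_new k o).
  { intros [u|] Ho v; unfold mRepl; simpl.
    - assert (u <> w) by (intros ->; exact (Hwn (Hl w (Ho w eq_refl)))). tauto.
    - tauto. }
  assert (Htau' : tau x y z <-> E (tri (or_new k x) (or_new k y) (or_new k z)) SA).
  { rewrite HSA by assumption. unfold holds. tauto. }
  rewrite Htau'. unfold mSnext. split.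
  - intros (_ & _ & _ & [[H _]|[(_ & A' & SA' & w' & Hcov' & x' & y' & z' & Rx & Ry & Rz & H)|(_ & H)]]).
    + contradiction.
    + destruct Hcov' as ((HA1 & _) & Hw' & Cx & Cy & Cz).
      (* The new argument is outside the level [k], so it cannot come from [A'] and must be [w'].
         Since [w] determines [A] and [SA], no other pair covers the triple. *)
      assert (Ew : w' = w).
      { apply W_iff in Hw'.
        assert (Hsub : forall o, ok o -> E (or_new w o) A' \/ or_new w o = w' -> o = None -> w' = w).
        { intros o _ [Ho|Ho] ->; [destruct (Hwn (HA1 _ Ho))|now symmetry]. }
        destruct Hnew as [N|[N|N]]; eauto. }
      subst w'. apply W_iff in Hw'. apply opair_inj in Hw' as [_ Hw'].
      apply opair_inj in Hw' as [<- <-].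
      apply Hrepl in Rx, Ry, Rz; try assumption. subst. now apply Holds_iff.
    + exfalso. apply H. now exists A, SA, w.
  - intro H. do 3 (split; [now apply HV|]). right. left. split; [assumption|].
    exists A, SA, w. split; [assumption|].
    exists (or_new k x), (or_new k y), (or_new k z). rewrite !Hrepl by assumption.
    rewrite Holds_iff. auto.
Qed.

End SetTheory.

(** * Passing to the domain as a type *)

Section Transport.
Variable D : both_structure.
Hypothesis HD : model D T_both.

Definition carrier : Type := {x : nat | bdom D x}.
Definition val (x : carrier) : nat := proj1_sig x.
Definition cE (x y : carrier) : Prop := bmem D (val x) (val y).
Definition cS3 (x y z : carrier) : Prop := bS D (val x) (val y) (val z).

Lemma sat_msat p : forall (r : nat -> carrier) r', (forall i, r' i = val (r i)) ->
  (sat D r' p <-> msat cE cS3 r p).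
Proof.
  assert (K : forall (r : nat -> carrier) r', (forall i, r' i = val (r i)) ->
    forall a i, scons (val a) r' i = val (scons a r i)) by (intros r r' H a [|i]; simpl; auto).
  induction p; intros r r' H; simpl; rewrite ?H; try reflexivity.
  2-4: now rewrite (IHp1 r r' H), (IHp2 r r' H).
  - unfold val. split; [|congruence]. destruct (r i) as [x Hx], (r j) as [y Hy].
    simpl. intros ->. f_equal. apply proof_irrelevance.
  - split.
    + intros Ha a. apply (IHp _ _ (K r r' H a)), Ha. exact (proj2_sig a).
    + intros Ha a Da. apply (IHp _ _ (K r r' H (exist _ a Da))), Ha.
  - split.
    + intros (a & Da & Ha). exists (exist _ a Da). apply (IHp _ _ (K r r' H (exist _ a Da))), Ha.
    + intros [a Ha]. exists (val a). split; [exact (proj2_sig a)|].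
      apply (IHp _ _ (K r r' H a)), Ha.
Qed.

Lemma carrier_model p : T_both p -> forall r, msat cE cS3 r p.
Proof.
  intros Hp r. apply (sat_msat p r (fun i => val (r i))); [reflexivity|].
  apply HD; [assumption|]. intro i. exact (proj2_sig (r i)).
Qed.

Lemma carrier_inhabited : inhabited carrier.
Proof. destruct (bdom_inhabited D) as [a Ha]. exact (inhabits (exist _ a Ha)). Qed.

Lemma model_mem_implies_S : mem_implies_S D.
Proof.
  intros x y z Hx Hy Hz Hxy. destruct carrier_inhabited as [m0].
  exact (S3_of_mem cE cS3 m0 carrier_model (exist _ x Hx) (exist _ y Hy) (exist _ z Hz) Hxy).
Qed.

Lemma model_extension_property : extension_property D.
Proof.
  intros l tau Hl Htau. destruct carrier_inhabited as [m0].
  assert (Hlift : exists l', map val l' = l).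
  { clear tau Htau. induction l as [|x l IH]; [now exists []|].
    destruct IH as [l' Hl']; [intros y Hy; apply Hl; now right|].
    exists (exist _ x (Hl x (or_introl eq_refl)) :: l'). simpl. now f_equal. }
  destruct Hlift as [l' <-].
  destruct (S3_extension cE cS3 m0 carrier_model l'
    (fun x y z => tau (option_map val x) (option_map val y) (option_map val z)))
    as (w & Hw & Hm & HS).
  - intros x y Hx Hy Hxy. apply Htau; [now apply in_map..|assumption].
  - exists (val w). split; [exact (proj2_sig w)|]. split; [|split].
    + intro H. apply in_map_iff in H as (v & Ev & Hv).
      assert (v = w) as ->; [|contradiction].
      destruct v as [v Dv], w as [w Dw]. simpl in Ev. subst v. f_equal. apply proof_irrelevance.
    + intros x Hx. change (In x (map val (w :: l'))) in Hx.
      apply in_map_iff in Hx as (v & <- & Hv). exact (Hm v Hv).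
    + intros x y z Hin Hnew.
      assert (Hlift : forall o, (forall v, Some v = o -> In v (map val l')) ->
        exists o' : option carrier, option_map val o' = o /\ or_new (val w) o = val (or_new w o')
          /\ (forall v, Some v = o' -> In v l') /\ (o = None -> o' = None)).
      { intros [v|] Ho; [|exists None; repeat split; discriminate].
        pose proof (Ho v eq_refl) as Hv. apply in_map_iff in Hv as (v' & <- & Hv).
        exists (Some v'). repeat split; try discriminate. now intros ? [= ->]. }
      destruct (Hlift x) as (x' & <- & -> & Ix & Nx); [auto|].
      destruct (Hlift y) as (y' & <- & -> & Iy & Ny); [auto|].
      destruct (Hlift z) as (z' & <- & -> & Iz & Nz); [auto|].
      apply HS; [intros v [H|[H|H]]; auto|tauto].
Qed.

End Transport.

Theorem theorem4p1p3 (D : both_structure) :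
  computable_both_structure zero' D ->
  model D T_both ->
  exists C : S_structure,
    computable_S_structure empty_oracle C /\ isomorphic C (reduct_S D).
Proof.
  intros HD HM. apply computable_copy; [assumption| |].
  - now apply model_mem_implies_S.
  - now apply model_extension_property.
Qed.
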